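(* Let $d\ge 1$ and let $\{M_k\}_{k\ge1}$, $\{N_k\}_{k\ge1}$ be sequences of integers with $M_k\ge 2$ and $1\le N_k\le M_k^d$ for all $k$. Let $\Omega=\Omega(M_k,N_k)$ be the associated space of random Cantor sets $E\subset[0,1]^d$, with its probability measure $\mathbb{P}$, and let $t^*, s_1, s^*, s_2, s_3$ be the numbers defined in the context. Then: (1) For any $E\in\Omega$, $t^{*}\le \dim_H E\le \underline{\dim}_B E\le s_1$. (2) For any $E\in\Omega$, $s^{*}\le \dim_P E\le \overline{\dim}_B E\le s_2$. (3) Almost surely $\dim_H E=\underline{\dim}_B E=s_1$. (4) Almost surely $\dim_P E=\overline{\dim}_B E=s_2$. (5) If $\{N_k\}$ is bounded, then $\dim_A E=s_3$ for any $E\in\Omega$. If $\{N_k\}$ is unbounded, then almost surely $\dim_A E=d$.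
   Context: Notation: $P_n=\prod_{i=1}^n N_i$, $r_n=\big(\prod_{i=1}^n M_i\big)^{-1}$, $P(n,n+k)=\prod_{i=n}^{n+k}N_i$, $r(n,n+k)=\big(\prod_{i=n}^{n+k}M_i\big)^{-1}$. $\mathcal{D}_n$ is the family of closed cubes $\prod_{\ell=1}^d[i_\ell r_n,(i_\ell+1)r_n]$ with integers $0\le i_\ell\le r_n^{-1}-1$. Random Cantor sets: divide $[0,1]^d$ into the $M_1^d$ cubes of $\mathcal{D}_1$ and choose $N_1$ distinct ones uniformly at random without replacement; $E_1$ is their union. Given $E_n$ (a union of $P_n$ cubes of $\mathcal{D}_n$), divide each chosen cube of $E_n$ into $M_{n+1}^d$ cubes of $\mathcal{D}_{n+1}$ and choose $N_{n+1}$ distinct ones uniformly at random without replacement, independently for different cubes of $E_n$; $E_{n+1}$ is the union of all chosen cubes. Put $E=\bigcap_{n\ge1}E_n$. $\Omega$ consists of all possible outcomes of the limit sets $E$, and $\mathbb{P}$ is the resulting probability; ''almost surely'' refers to $\mathbb{P}$, ''any $E\in\Omega$'' means every possible outcome. Numbers: $$s_1=\liminf_{n\to\infty}\frac{\log P_n}{-\log r_n},\quad s_2=\limsup_{n\to\infty}\frac{\log P_{n+1}}{-\log r_n+\frac1d\log N_{n+1}},\quad s_3=\limsup_{k\to\infty}\sup_{n\in\mathbb{N}}\frac{\log P(n,n+k)}{-\log r(n,n+k)},$$ $$t^*=\liminf_{n\to\infty}\frac{\log P_n}{-\log r_{n+1}-\frac1d\log N_{n+1}},\quad s^*=\limsup_{n\to\infty}\frac{\log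 P_n}{-\log r_n}.$$ $\dim_H,\dim_P,\underline{\dim}_B,\overline{\dim}_B$ are the usual Hausdorff, packing, lower box and upper box dimensions. $\mathcal{N}(F,\delta)$ is the smallest number of sets of diameter at most $\delta$ which can cover $F$. The Assouad dimension $\dim_A E$ is the infimum of $s\ge0$ for which there is $C>0$ such that for all $0<r<R\le\sqrt d$, $\sup_{x\in E}\mathcal{N}(E\cap B(x,R),r)\le C(R/r)^s$. *)

(* Defs.v *)
From HB Require Import structures.
From mathcomp Require Import all_boot all_order all_algebra.
From mathcomp Require Import all_classical all_reals all_analysis.

Set Implicit Arguments.
Unset Strict Implicit.
Unset Printing Implicit Defensive.

Import Order.TTheory GRing.Theory Num.Theory.
Import numFieldNormedType.Exports.

Local Open Scope classical_set_scope.
Local Open Scope ring_scope.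

(* The library norm on 'rV[R]_d is the sup norm, so the Euclidean metric and
   the metric notions derived from it are introduced here. *)
Section EuclideanMetric.
Variables (R : realType) (d : nat).
Implicit Types (x y : 'rV[R]_d) (A F : set 'rV[R]_d).

Definition eucl_dist x y : R := Num.sqrt (\sum_(l < d) (x 0 l - y 0 l) ^+ 2).

Definition ecball x (rho : R) : set 'rV[R]_d := [set y | eucl_dist x y <= rho].

(* The maximum with 0 gives the empty set diameter 0 (ereal_sup set0 = -oo). *)
Definition diam A : \bar R :=
  maxe 0%E (ereal_sup [set (eucl_dist p.1 p.2)%:E | p in A `*` A]).

(* |U|^s, where a nonempty set contributes 1 when s = 0 (the library has
   0 `^ 0 = 1) and the empty set always contributes 0. *)
Definition diam_pow (s : R) A : \bar R :=
  if A == set0 then 0%E else (diam A `^ s)%E.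

End EuclideanMetric.

Section Dimensions.
Variables (R : realType) (d : nat).
Implicit Types (F : set 'rV[R]_d) (s delta : R).
Local Open Scope ereal_scope.

Definition hausdorff_pre s delta F : \bar R :=
  ereal_inf [set \sum_(i <oo) diam_pow s (U i) |
    U in [set U : nat -> set 'rV[R]_d |
      (forall i, diam (U i) <= delta%:E) /\ F `<=` \bigcup_i U i]].

Definition hausdorff_measure s F : \bar R :=
  ereal_sup [set hausdorff_pre s delta F | delta in [set e : R | (0 < e)%R]].

Definition dimH F : \bar R :=
  ereal_inf [set s%:E | s in
    [set s : R | (0 <= s)%R /\ hausdorff_measure s F = 0]].

(* A countable delta-packing of F by disjoint closed balls
   B(c i, rho i), i in I, centred in F; I may be finite or empty. *)
Definition packing delta F (I : set nat) (c : nat -> 'rV[R]_d)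
    (rho : nat -> R) : Prop :=
  (forall i, I i -> F (c i) /\ (0 < rho i <= delta)%R) /\
  trivIset I (fun i => ecball (c i) (rho i)).

Definition packing_pre s delta F : \bar R :=
  ereal_sup [set v | exists I c rho, packing delta F I c rho /\
    v = \esum_(i in I) diam_pow s (ecball (c i) (rho i))].

Definition packing_premeasure s F : \bar R :=
  ereal_inf [set packing_pre s delta F | delta in [set e : R | (0 < e)%R]].

Definition packing_measure s F : \bar R :=
  ereal_inf [set \sum_(i <oo) packing_premeasure s (G i) |
    G in [set G : nat -> set 'rV[R]_d | F `<=` \bigcup_i G i]].

Definition dimP F : \bar R :=
  ereal_inf [set s%:E | s in
    [set s : R | (0 <= s)%R /\ packing_measure s F = 0]].

(* Equal to +oo when no finite cover exists. *)
Definition covering_number F delta : \bar R :=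
  ereal_inf [set n%:R%:E | n in [set n : nat |
    exists U : 'I_n -> set 'rV[R]_d,
      (forall i, diam (U i) <= delta%:E) /\
      F `<=` [set x | exists i, U i x]]].

Definition box_ratio F delta : \bar R :=
  lne (covering_number F delta) * ((- ln delta)^-1)%:E.

Definition lower_dimB F : \bar R := limf_einf (box_ratio F) 0^'+.

Definition upper_dimB F : \bar R := limf_esup (box_ratio F) 0^'+.

Definition dimA F : \bar R :=
  ereal_inf [set s%:E | s in [set s : R | (0 <= s)%R /\
    exists C : R, (0 < C)%R /\
      forall r rho : R, (0 < r)%R -> (r < rho)%R -> (rho <= Num.sqrt d%:R)%R ->
        ereal_sup [set covering_number (F `&` ecball x rho) r | x in F]
          <= (C * (rho / r) `^ s)%:E]].

End Dimensions.

(* The sequences M and N are indexed from 1; M 0 and N 0 play no role. *)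
Section Numbers.
Variables (R : realType) (d : nat) (M N : nat -> nat).

(* P(m,n) and r(m,n); P_n = P(1,n) and r_n = r(1,n). *)
Definition prodN (m n : nat) : R := (\prod_(m <= i < n.+1) N i)%N%:R.
Definition scale (m n : nat) : R := ((\prod_(m <= i < n.+1) M i)%N%:R)^-1.

Definition s1 : \bar R :=
  limn_einf (fun n => (ln (prodN 1 n) / - ln (scale 1 n))%:E).

Definition s2 : \bar R :=
  limn_esup (fun n => (ln (prodN 1 n.+1) /
    (- ln (scale 1 n) + d%:R^-1 * ln (N n.+1)%:R))%:E).

Definition s3 : \bar R :=
  limn_esup (fun k => ereal_sup
    [set (ln (prodN n (n + k)) / - ln (scale n (n + k)))%:E |
      n in [set n : nat | (1 <= n)%N]]).

Definition tstar : \bar R :=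
  limn_einf (fun n => (ln (prodN 1 n) /
    (- ln (scale 1 n.+1) - d%:R^-1 * ln (N n.+1)%:R))%:E).

Definition sstar : \bar R :=
  limn_esup (fun n => (ln (prodN 1 n) / - ln (scale 1 n))%:E).

End Numbers.

Section RandomCantor.
Variables (d : nat) (M N : nat -> nat).

(* Index vectors (i_1, ..., i_d) with 0 <= i_l <= r_n^-1 - 1. There is a single
   index at level 0, standing for [0,1]^d. *)
Definition cube (n : nat) : finType :=
  {ffun 'I_d -> 'I_(\prod_(1 <= i < n.+1) M i)}.

Definition cube_set (R : realType) n (Q : cube n) : set 'rV[R]_d :=
  [set x | forall l, (Q l)%:R * scale R M 1 n <= x 0 l
                     /\ x 0 l <= (Q l).+1%:R * scale R M 1 n].

(* As r_n = M_(n+1) r_(n+1), the interval of index j at level n+1 lies in the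
   interval of index i at level n exactly when j %/ M_(n+1) = i. *)
Definition children n (Q : cube n) : {set cube n.+1} :=
  [set Q' : cube n.+1 | [forall l, (Q' l %/ M n.+1)%N == Q l]]%SET.

(* The possible choices of N_(n+1) distinct subcubes of Q. *)
Definition selections n (Q : cube n) : {set {set cube n.+1}} :=
  [set B : {set cube n.+1} | (B \subset children Q) && (#|B| == N n.+1)]%SET.

(* c n is the set of (indices of) cubes of level n whose union is E_n. *)
Definition outcome (c : forall n, {set cube n}) : Prop :=
  c 0%N = [set: cube 0]%SET /\
  forall n,
    (forall Q, Q \in c n -> c n.+1 :&: children Q \in selections Q)%SET /\
    (forall Q', Q' \in c n.+1 -> exists2 Q, Q \in c n & Q' \in children Q).

Definition stage (R : realType) (c : forall n, {set cube n}) n : set 'rV[R]_d :=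
  [set x | exists2 Q, Q \in c n & cube_set Q x].

Definition limit_set (R : realType) (c : forall n, {set cube n}) :
    set 'rV[R]_d :=
  \bigcap_(n in [set n : nat | (1 <= n)%N]) stage c n.

Definition Omega (R : realType) : set (set 'rV[R]_d) :=
  [set E | exists2 c, outcome c & E = limit_set c].

(* A realisation of the random construction on a probability space. The last
   clause says that, given E_0, ..., E_n, the selections made in the different
   cubes of E_n are independent, each being uniform over the possible ones. *)
Record random_cantor (R : realType) (disp : measure_display)
    (T : measurableType disp) (Pr : probability T R)
    (C : T -> forall n, {set cube n}) : Prop := RandomCantor {
  rc_outcome : forall w, outcome (C w) ;
  rc_measurable : forall n (A : {set cube n}), measurable [set w | C w n = A] ;
  rc_law : forall n (A : forall k, {set cube k}) (B : cube n -> {set cube n.+1}),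
    (forall Q, Q \in A n -> B Q \in selections Q) ->
    Pr [set w | (forall k, (k <= n)%N -> C w k = A k) /\
                (forall Q, Q \in A n -> (C w n.+1 :&: children Q)%SET = B Q)]
    = (Pr [set w | forall k, (k <= n)%N -> C w k = A k] *
       (\prod_(Q in A n) (#|selections Q|%:R)^-1)%:E)%E
}.

(* These axioms determine the joint law of the sequence (E_n), so that being
   almost sure does not depend on the chosen realisation. *)
Definition almost_surely (R : realType) (H : set 'rV[R]_d -> Prop) : Prop :=
  forall (disp : measure_display) (T : measurableType disp)
    (Pr : probability T R) (C : T -> forall n, {set cube n}),
    random_cantor Pr C -> {ae Pr, forall w, H (limit_set (C w))}.

End RandomCantor.

(* Main.v *)
From mathcomp Require Import all_boot all_order all_algebra.
From mathcomp Require Import all_classical all_reals all_analysis.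
From mathcomp Require Import ring lra zify.
Require Import Defs.

(* Everything is read off the cubes of the construction. A covering of E is
   compared, through a compactness argument on the tree of cubes, with a finite
   set of cubes of one deep level, which gives a mass distribution principle
   with counting measures; for the packing dimension a Baire category argument
   on the same tree reduces the lower bound to counting separated cubes inside
   each cube of the construction.

   All the randomness enters through one inequality: a set A of cubes of level
   n + 1 is contained in the random selection with probability at most
   (N_(n+1) / M_(n+1)^d)^#|A| times the probability that all the parents were
   selected. For two cubes this bounds the expected s-energy of the uniform
   measure by sum_n r_n^-s / P_n, which converges for s < s1; and it shows that
   the N_(n+1) subcubes chosen in a cube occupy, in mean square, a positive
   proportion of the boxes of a grid with about N_(n+1) boxes, which produces
   the scales r_n N_(n+1)^(-1/d) of s2, and dimension d when N is unbounded. *)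

Set Implicit Arguments.
Unset Strict Implicit.
Unset Printing Implicit Defensive.

Import Order.TTheory GRing.Theory Num.Theory.
Import numFieldNormedType.Exports.

Local Open Scope classical_set_scope.
Local Open Scope ring_scope.

(** * Limits, powers and scales *)

Section LimitBounds.
Variable R : realType.
Implicit Types (u : nat -> \bar R) (f : R -> \bar R) (s : R) (x : \bar R).

(** No limit measure on [E] is built. The lower bounds ask for counts of cubes at suitable deep
    levels only, each level with a set of its own. This is all that the randomness has to supply:
    nonnegative variables with bounded means are almost surely bounded along infinitely many
    indices, though perhaps not along all.

    The exponents come from the worst radius between two consecutive scales. If the [N_(n+1)]
    subcubes of a cube cluster, they fill a cube of side about [r_(n+1) N_(n+1)^(1/d)], whence
    [tstar]; if they spread out, they stay distinguishable up to side [r_n N_(n+1)^(-1/d)], whence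
    [s2]. In both cases the count is a minimum of two quantities, replaced by their geometric mean
    with weight [s / d].

    A strict inequality between exponents, [s < s'], leaves a spare power of a small scale, which
    absorbs multiplicative constants, even random ones. Since each [N_k] is positive, no branch dies
    out: every chosen cube contains points of [E], and cubes can stand for points. *)

Lemma limn_esup_lt_near u x : (limn_esup u < x)%E ->
  exists n0, forall n, (n0 <= n)%N -> (u n < x)%E.
Proof.
move=> /ereal_inf_lt[_ [V [n0 _ Vn0] <-] Vx].
exists n0 => n n0n; apply: le_lt_trans Vx.
by apply: ereal_sup_ubound; exists n => //; apply: Vn0.
Qed.

Lemma limn_esup_gt_freq u x : (x < limn_esup u)%E ->
  forall n0, exists2 n, (n0 <= n)%N & (x < u n)%E.
Proof.
move=> xu n0.
have : (x < ereal_sup (u @` [set n | (n0 <= n)%N]))%E.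
  apply: lt_le_trans xu _; apply: ereal_inf_lbound.
  by exists [set n | (n0 <= n)%N] => //; exists n0.
by move=> /ereal_sup_gt[_ [n /= n0n <-] xun]; exists n.
Qed.

Lemma limn_einf_gt_near u x : (x < limn_einf u)%E ->
  exists n0, forall n, (n0 <= n)%N -> (x < u n)%E.
Proof.
rewrite /limn_einf lteNr => /limn_esup_lt_near[n0 h].
by exists n0 => n /h /=; rewrite lteN2.
Qed.

Lemma limn_einf_lt_freq u x : (limn_einf u < x)%E ->
  forall n0, exists2 n, (n0 <= n)%N & (u n < x)%E.
Proof.
rewrite /limn_einf lteNl => /limn_esup_gt_freq h n0.
by have [n n0n /=] := h n0; rewrite lteN2 => ?; exists n.
Qed.

Lemma limf_esup0_lt_near f x : (limf_esup f 0^'+ < x)%E ->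
  exists2 e : R, 0 < e & forall t, 0 < t < e -> (f t < x)%E.
Proof.
move=> /ereal_inf_lt[_ [V [e /= e0 Ve] <-] Vx].
exists e => // t /andP[t0 te]; apply: le_lt_trans Vx.
apply: ereal_sup_ubound; exists t => //; apply: Ve => //=.
by rewrite /ball_ /= sub0r normrN gtr0_norm.
Qed.

Lemma limf_esup0_le f x (e : R) : 0 < e ->
  (forall t, 0 < t < e -> (f t <= x)%E) -> (limf_esup f 0^'+ <= x)%E.
Proof.
move=> e0 fx.
have : (limf_esup f 0^'+ <= ereal_sup (f @` [set t | (0 < t < e)%R]))%E.
  apply: ereal_inf_lbound; exists [set t | 0 < t < e] => //.
  exists e => //= t te t0; rewrite t0 /=.
  by rewrite /ball_ /= sub0r normrN gtr0_norm in te.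
move=> /le_trans; apply; apply: ge_ereal_sup => _ [t te <-]; exact: fx.
Qed.

Lemma limf_einf0_lt_freq f x : (limf_einf f 0^'+ < x)%E ->
  forall e : R, 0 < e -> exists2 t, 0 < t < e & (f t < x)%E.
Proof.
move=> fx e e0; apply: contrapT => h.
have := @limf_esup0_le (\- f)%E (- x)%E e e0.
rewrite /limf_einf in fx; rewrite leNgt lteNl fx => /(_ _)/negP.
rewrite /= in h *; apply => // t te; rewrite leNgt lteN2; apply/negP => ftx.
by apply: h; exists t.
Qed.

Lemma limf_einf0_le f x :
  (forall e : R, 0 < e -> exists2 t, 0 < t < e & (f t <= x)%E) ->
  (limf_einf f 0^'+ <= x)%E.
Proof.
move=> h; rewrite leNgt; apply/negP.
rewrite /limf_einf lteNr => /limf_esup0_lt_near[e e0 he].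
have [t te ft] := h _ e0; have := he _ te.
by rewrite lteN2 ltNge ft.
Qed.

(** Dimensions are extended reals defined through real exponents; this and [lee_lt_real] let each
    comparison be made at one real exponent, infinite values included. *)
Lemma lee_gt_real x (y : \bar R) : (forall s, (x < s%:E)%E -> (y <= s%:E)%E) ->
  (y <= x)%E.
Proof.
move=> h; rewrite leNgt; apply/negP => xy.
case: x y h xy => [x| |] [y| |] //= h xy.
- have := h ((x + y) / 2); rewrite !(lte_fin,lee_fin) in xy * => h'.
  have := h' ltac:(lra); lra.
- by have := h (x + 1); rewrite lte_fin ltrDl ltr01 => /(_ isT).
- have := h (y - 1) (ltNyr _); rewrite lee_fin; lra.
- by have := h 0 (ltNyr _).
Qed.

Lemma lee_lt_real x (y : \bar R) : (forall s, (s%:E < x)%E -> (s%:E <= y)%E) ->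
  (x <= y)%E.
Proof.
move=> h; rewrite -leeN2; apply: lee_gt_real => s; rewrite lteNl => /h.
by rewrite -leeN2 EFinN oppeK.
Qed.

End LimitBounds.

Lemma powRD_gt0 (R : realType) (x a b : R) : 0 < x -> x `^ (a + b) = x `^ a * x `^ b.
Proof. by move=> x0; apply: powRD; apply/implyP => _; rewrite gt_eqF. Qed.

(** Places a radius between two consecutive scales, for [r n] as well as for dyadic powers: [k.+1]
    is the least index from [k0] on whose term is below [rho]. *)
Lemma locate_scale (R : realFieldType) (a : nat -> R) (k0 : nat) (rho : R) :
  rho <= a k0 -> (exists2 k, (k0 <= k)%N & a k < rho) ->
  exists2 k, (k0 <= k)%N & a k.+1 < rho <= a k.
Proof.
move=> rho0 [k1 k01 ak1].
have ex : exists k, (k0 <= k)%N && (a k < rho) by exists k1; rewrite k01.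
case: (ex_minnP ex) => -[|m] /andP[k0m am] mmin.
  by move: k0m am rho0; rewrite leqn0 => /eqP -> /lt_le_trans h /h; rewrite ltxx.
have [mk|km] := ltnP m k0.
  have e : k0 = m.+1 by apply/eqP; rewrite eqn_leq k0m mk.
  by move: am; rewrite -e ltNge rho0.
exists m => //; rewrite am leNgt; apply/negP => am'.
by have := mmin m; rewrite km am' ltnn => /(_ isT).
Qed.

Lemma half_pow_small (R : realType) (e : R) : 0 < e ->
  exists n, forall m, (n <= m)%N -> 2^-1 ^+ m < e.
Proof.
move=> e0; exists (Num.truncn e^-1) => m nm.
rewrite exprVn invf_plt ?posrE ?exprn_gt0//.
rewrite (lt_le_trans (truncnS_gt _))// -natrX ler_nat.
by apply: leq_ltn_trans nm _; apply: ltn_expl.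
Qed.

Lemma powR_exprn (R : realType) (x t : R) (m : nat) : 0 <= x ->
  (x ^+ m) `^ t = (x `^ t) ^+ m.
Proof.
by move=> x0; rewrite -(powR_mulrn m x0) -powRrM mulrC powRrM powR_mulrn ?powR_ge0.
Qed.

(** * The tree of cubes *)

Lemma card_ord_itv (K a b : nat) :
  (#|[pred j : 'I_K | (a <= j < b)%N]| <= b - a)%N.
Proof.
rewrite -sum1_card.
rewrite -(big_mkord (fun j => (a <= j < b)%N) (fun=> 1%N)).
have -> : (b - a = \sum_(a <= j < b) 1)%N by rewrite sum_nat_const_nat muln1.
rewrite (@big_nat_widen _ _ _ a b (maxn b K)) ?leq_maxl//.
rewrite (@big_nat_widenl _ _ _ a 0)//.
rewrite (@big_nat_widen _ _ _ 0 K (maxn b K)) ?leq_maxr//.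
rewrite [leqLHS]big_mkcond [leqRHS]big_mkcond; apply: leq_sum => j _.
by case: (a <= j)%N; case: (j < b)%N; case: (j < K)%N.
Qed.

Lemma card_ord_itv_eq (K a b : nat) : (b <= K)%N ->
  #|[pred j : 'I_K | (a <= j < b)%N]| = (b - a)%N.
Proof.
move=> bK; rewrite -sum1_card.
rewrite -(big_mkord (fun j => (a <= j < b)%N) (fun=> 1%N)).
have -> : (b - a = \sum_(a <= j < b) 1)%N by rewrite sum_nat_const_nat muln1.
rewrite (@big_nat_widen _ _ _ a b K)//.
rewrite (@big_nat_widenl _ _ _ a 0)//.
by apply: eq_bigl => j /=; rewrite andbC.
Qed.

Lemma card_coord (d K : nat) (P : 'I_d -> pred 'I_K) :
  #|[set Q : {ffun 'I_d -> 'I_K} | [forall l, P l (Q l)]]%SET|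
  = (\prod_l #|P l|)%N.
Proof.
have -> : #|[set Q : {ffun 'I_d -> 'I_K} | [forall l, P l (Q l)]]%SET| =
    #|family P|.
  by apply: eq_card => Q; rewrite !inE; apply/forallP/familyP.
rewrite card_family (_ : foldr _ _ _ = \prod_(x <- enum 'I_d) #|P x|)%N.
  by rewrite big_enum.
by rewrite foldrE big_map.
Qed.

Lemma card_coord_le (d K B : nat) (P : 'I_d -> pred 'I_K) :
  (forall l, #|P l| <= B)%N ->
  (#|[set Q : {ffun 'I_d -> 'I_K} | [forall l, P l (Q l)]]%SET| <= B ^ d)%N.
Proof.
move=> PB; rewrite card_coord -[in (B ^ d)%N](card_ord d) -prod_nat_const.
exact: leq_prod.
Qed.

Lemma card_coord_eq (d K B : nat) (P : 'I_d -> pred 'I_K) :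
  (forall l, #|P l| = B)%N ->
  (#|[set Q : {ffun 'I_d -> 'I_K} | [forall l, P l (Q l)]]%SET| = B ^ d)%N.
Proof.
move=> PB; rewrite card_coord -[in (B ^ d)%N](card_ord d) -prod_nat_const.
exact: eq_bigr.
Qed.

Lemma divn_eq_itv (j b i : nat) : (0 < b)%N ->
  (j %/ b == i)%N = (i * b <= j < i.+1 * b)%N.
Proof.
move=> b0; rewrite eqn_leq andbC -leq_divRL//; congr andb.
by rewrite -ltnS ltn_divLR.
Qed.

Section Cubes.
Variables (d : nat) (M N : nat -> nat).
Hypothesis M2 : forall k, (1 <= k)%N -> (2 <= M k)%N.
Hypothesis NM : forall k, (1 <= k)%N -> (1 <= N k)%N && (N k <= M k ^ d)%N.

Definition pprod (u : nat -> nat) (m n : nat) : nat := (\prod_(m <= i < n.+1) u i)%N.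

Local Notation pM := (pprod M).
Local Notation pN := (pprod N).
Local Notation cube := (cube d M).

Lemma pprod_recr u m n : (m <= n.+1)%N -> pprod u m n.+1 = (pprod u m n * u n.+1)%N.
Proof. by move=> mn; rewrite /pprod big_nat_recr. Qed.

Lemma pprod_nil u n : pprod u n.+1 n = 1%N.
Proof. by rewrite /pprod big_geq. Qed.

Lemma pprod_cat u m n p : (m <= n.+1)%N -> (n <= p)%N ->
  pprod u m p = (pprod u m n * pprod u n.+1 p)%N.
Proof. by move=> mn np; rewrite /pprod -big_cat_nat. Qed.

Lemma pprod_gt0 u m n : (forall k, (m <= k)%N -> (0 < u k)%N) -> (0 < pprod u m n)%N.
Proof.
by move=> u0; rewrite /pprod big_nat_cond prodn_cond_gt0// => i /andP[/andP[/u0]].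
Qed.

Lemma pM_gt0 m n : (0 < pM m.+1 n)%N.
Proof. by apply: pprod_gt0 => k mk; rewrite (leq_trans _ (M2 _))// (leq_ltn_trans _ mk). Qed.

Lemma pN_gt0 m n : (0 < pN m.+1 n)%N.
Proof. by apply: pprod_gt0 => k mk; have /andP[] := NM (leq_ltn_trans (leq0n m) mk). Qed.

Lemma pM_ge_exp m n : (2 ^ (n - m) <= pM m.+1 n)%N.
Proof.
have [nm|mn] := leqP n m.
  by rewrite (eqP (_ : n - m == 0)%N) ?expn0 ?pM_gt0// subn_eq0.
rewrite /pprod -(subSS m n) -prod_nat_const_nat big_nat_cond [leqRHS]big_nat_cond.
by apply: leq_prod => i /andP[/andP[mi _] _]; apply: M2; apply: leq_ltn_trans mi.
Qed.

Lemma pN_le_pM m n : (pN m.+1 n <= pM m.+1 n ^ d)%N.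
Proof.
rewrite /pprod (big_morph (expn^~ d) (fun a b => expnMn a b d) (exp1n d)) big_nat_cond
  [leqRHS]big_nat_cond.
apply: leq_prod => i /andP[/andP[mi _] _].
by have /andP[] := NM (leq_ltn_trans (leq0n m) mi).
Qed.

Lemma par_subproof n (Q : cube n.+1) l :
  (Q l %/ M n.+1 < \prod_(1 <= i < n.+1) M i)%N.
Proof.
have := ltn_ord (Q l); rewrite [ltnRHS]big_nat_recr//= => h.
by rewrite ltn_divLR// (leq_trans _ (M2 _)).
Qed.

Definition par n (Q : cube n.+1) : cube n :=
  [ffun l => Ordinal (par_subproof Q l)].

Lemma in_children n (Q : cube n) (Q' : cube n.+1) :
  (Q' \in children Q) = (par Q' == Q).
Proof.
rewrite inE; apply/forallP/eqP => [h|<- l]; last by rewrite ffunE.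
by apply/ffunP => l; apply/val_inj; rewrite ffunE /=; apply/eqP.
Qed.

(** Ancestry in closed form: one division by the product of all intermediate [M] replaces a chain of
    parents. It is meant for [n <= m]; at [n = m] the product is empty and the relation is
    equality. *)
Definition below n m (Q : cube n) (Q' : cube m) : bool :=
  [forall l, (Q' l %/ pM n.+1 m == Q l)%N].

Lemma below_refl n (Q Q' : cube n) : below Q Q' = (Q' == Q).
Proof.
apply/forallP/eqP => [h|-> l]; last by rewrite pprod_nil divn1.
apply/ffunP => l; apply/val_inj; have := h l.
by rewrite pprod_nil divn1 => /eqP.
Qed.

Lemma below_par n m (Q : cube n) (Q' : cube m.+1) : (n <= m)%N ->
  below Q Q' = below Q (par Q').
Proof.
move=> nm; apply: eq_forallb => l; rewrite ffunE /=.
by rewrite pprod_recr// mulnC divnMA.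
Qed.

Lemma below_inj n m (Q1 Q2 : cube n) (Q' : cube m) :
  below Q1 Q' -> below Q2 Q' -> Q1 = Q2.
Proof.
move=> /forallP h1 /forallP h2; apply/ffunP => l; apply/val_inj => /=.
by rewrite -(eqP (h1 l)) (eqP (h2 l)).
Qed.

Lemma below_trans n m p (Q : cube n) (Q' : cube m) (Q'' : cube p) :
  (n <= m)%N -> (m <= p)%N -> below Q Q' -> below Q' Q'' -> below Q Q''.
Proof.
move=> nm mp /forallP h1 /forallP h2; apply/forallP => l.
rewrite (@pprod_cat _ _ m)// -(eqP (h1 l)) -(eqP (h2 l)).
by rewrite mulnC divnMA.
Qed.

Lemma below0 m (Q : cube 0) (Q' : cube m) : below Q Q'.
Proof.
apply/forallP => l; rewrite divn_small//; apply/eqP.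
by have := ltn_ord (Q l); rewrite [ltnRHS]big_geq//; case: (nat_of_ord _).
Qed.

Lemma card_children n (Q : cube n) : #|children Q| = (M n.+1 ^ d)%N.
Proof.
have M0 : (0 < M n.+1)%N by rewrite (leq_trans _ (M2 _)).
apply: (@card_coord_eq d _ _ (fun l j => (j %/ M n.+1 == Q l)%N)) => l.
rewrite (eq_card (B := [pred j : 'I_(pM 1 n.+1) | (Q l * M n.+1 <= j < (Q l).+1 * M n.+1)%N])).
  rewrite card_ord_itv_eq ?mulSn ?addnK// -mulSn (pprod_recr M (m := 1))//.
  by rewrite leq_mul2r [X in _ || X](ltn_ord (Q l)) orbT.
by move=> j; rewrite !inE; apply: divn_eq_itv.
Qed.

Lemma card_below_le n m (Q : cube n) :
  (#|[set Q' : cube m | below Q Q']%SET| <= pM n.+1 m ^ d)%N.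
Proof.
apply: (@card_coord_le d _ _ (fun l j => (j %/ pM n.+1 m == Q l)%N)) => l.
rewrite (eq_card (B := [pred j : 'I_(pM 1 m) | (Q l * pM n.+1 m <= j < (Q l).+1 * pM n.+1
  m)%N])).
  by apply: leq_trans (card_ord_itv _ _ _) _; rewrite mulSn addnK.
by move=> j; rewrite !inE; apply: divn_eq_itv; apply: pM_gt0.
Qed.

Lemma card_cube n : #|{: cube n}| = (pM 1 n ^ d)%N.
Proof. by rewrite card_ffun !card_ord. Qed.

Section Outcome.
Variable c : forall n, {set cube n}.
Hypothesis Oc : outcome N c.

Lemma outcome_par n (Q : cube n.+1) : Q \in c n.+1 -> par Q \in c n.
Proof.
by move=> /(proj2 (Oc.2 n))[Q' Q'c]; rewrite in_children => /eqP ->.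
Qed.

Lemma card_outcome_children n (Q : cube n) : Q \in c n ->
  #|c n.+1 :&: children Q|%SET = N n.+1.
Proof. by move=> /(proj1 (Oc.2 n)); rewrite inE => /andP[_ /eqP]. Qed.

Lemma outcome_anc n m (Q' : cube m) : (n <= m)%N -> Q' \in c m ->
  exists2 Q, Q \in c n & below Q Q'.
Proof.
elim: m Q' => [|m IH] Q'.
  by rewrite leqn0 => /eqP -> ?; exists Q'; rewrite ?below_refl.
rewrite leq_eqVlt => /predU1P[->|] Q'c; first by exists Q'; rewrite ?below_refl.
move=> /outcome_par => /(IH _ Q'c)[Q Qc Qb]; exists Q => //.
by rewrite below_par.
Qed.

Lemma card_outcome_below n m (Q : cube n) : (n <= m)%N -> Q \in c n ->
  #|[set Q' in c m | below Q Q']%SET| = pN n.+1 m.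
Proof.
elim: m => [|m IH].
  rewrite leqn0 => /eqP n0; subst n => Qc; rewrite pprod_nil.
  rewrite -(cards1 Q); apply: eq_card => Q'; rewrite !inE below_refl andbC.
  by case: eqP => // ->; rewrite Qc.
rewrite leq_eqVlt => /predU1P[nm|nm] Qc.
  subst n; rewrite pprod_nil -(cards1 Q); apply: eq_card => Q'.
  by rewrite !inE below_refl andbC; case: eqP => // ->; rewrite Qc.
rewrite pprod_recr ?(leqW nm)// -(IH nm Qc).
rewrite -sum1dep_card (partition_big (@par m) (mem [set Q' in c m | below Q Q']%SET)) /=;
  last first.
  by move=> Q' /andP[Q'c]; rewrite below_par// inE outcome_par.
rewrite -sum_nat_const; apply: eq_bigr => Q'.
rewrite inE => /andP[Q'c QQ']; rewrite -(card_outcome_children Q'c) -sum1_card.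
apply: eq_bigl => Q''; rewrite finset.in_setI in_children -andbA; congr andb.
by rewrite below_par//; case: eqP => [->|]; rewrite ?andbF// QQ'.
Qed.

Lemma outcome_root (Q : cube 0) : Q \in c 0.
Proof. by rewrite Oc.1 inE. Qed.

Lemma card_outcome m : #|c m| = pN 1 m.
Proof.
have [Q] : exists Q : cube 0, true.
  by exists [ffun=> Ordinal (pM_gt0 0 0)].
rewrite -(card_outcome_below (leq0n m) (outcome_root Q)) => _.
by apply: eq_card => Q'; rewrite inE below0 andbT.
Qed.

Lemma outcome_desc n m (Q : cube n) : (n <= m)%N -> Q \in c n ->
  exists2 Q', Q' \in c m & below Q Q'.
Proof.
move=> nm /(card_outcome_below nm) h.
have /card_gt0P[Q'] : (0 < #|[set Q' in c m | below Q Q']%SET|)%N.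
  by rewrite h pN_gt0.
by rewrite inE => /andP[]; exists Q'.
Qed.

End Outcome.

(** Each chosen cube has chosen descendants at every later level, as [N] is positive, so [c k] is
    recovered from [c n] as the set of its ancestors. Conditioning on one level therefore conditions
    on the whole past. *)
Lemma outcome_prev_eq (c c' : forall n, {set cube n}) n k :
  outcome N c -> outcome N c' -> c n = c' n -> (k <= n)%N -> c k = c' k.
Proof.
move=> oc oc' e kn.
have H (a b : forall n, {set cube n}) : outcome N a -> outcome N b ->
    a n = b n -> {subset a k <= b k}.
  move=> oa ob ab Q /(outcome_desc oa kn)[Q' Q'a QQ'].
  rewrite ab in Q'a; have [Q1 Q1b Q1Q'] := outcome_anc ob kn Q'a.
  by rewrite (below_inj QQ' Q1Q').
by apply/setP => Q; apply/idP/idP; [exact: (H c c')|exact: (H c' c)].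
Qed.

End Cubes.

(** * Coverings and the Euclidean metric *)

Section Euclid.
Variables (R : realType) (d : nat).
Implicit Types (x y : 'rV[R]_d) (F U : set 'rV[R]_d).

Lemma ler_eucl_dist x y l : `|x 0 l - y 0 l| <= eucl_dist x y.
Proof.
rewrite -sqrtr_sqr; apply: ler_wsqrtr; rewrite (bigD1 l)//= lerDl.
by apply: sumr_ge0 => i _; apply: sqr_ge0.
Qed.

Lemma eucl_dist_le x y (h : R) : 0 <= h ->
  (forall l, `|x 0 l - y 0 l| <= h) -> eucl_dist x y <= Num.sqrt d%:R * h.
Proof.
move=> h0 xyh; rewrite -(ger0_norm h0) -sqrtr_sqr -sqrtrM ?ler0n//.
rewrite ler_wsqrtr// -[in leRHS](card_ord d) mulr_natl -sumr_const.
by apply: ler_sum => l _; rewrite -real_normK ?num_real// lerXn2r ?nnegrE.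
Qed.

Lemma diam_le U (h : R) : 0 <= h ->
  (forall x y, U x -> U y -> eucl_dist x y <= h) -> (diam U <= h%:E)%E.
Proof.
move=> h0 Uh; rewrite /diam ge_max lee_fin h0 /=.
by apply: ge_ereal_sup => _ [[x y] [Ux Uy] <-]; rewrite lee_fin; apply: Uh.
Qed.

Lemma le_diam U x y : U x -> U y -> ((eucl_dist x y)%:E <= diam U)%E.
Proof.
move=> Ux Uy; rewrite /diam le_max; apply/orP; right.
by apply: ereal_sup_ubound; exists (x, y).
Qed.

Lemma diam_ge0 U : (0 <= diam U)%E.
Proof. by rewrite /diam le_max lexx. Qed.

Lemma covering_number_le (T : finType) (A : {set T}) (U : T -> set 'rV[R]_d) F
    (delta : R) : (forall a, a \in A -> (diam (U a) <= delta%:E)%E) ->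
  (forall x, F x -> exists2 a, a \in A & U a x) ->
  (covering_number F delta <= #|A|%:R%:E)%E.
Proof.
move=> Ud FU; apply: ereal_inf_lbound; exists #|A| => //.
exists (fun i => U (enum_val i)); split => [i|x /FU[a aA Uax]].
  by apply: Ud; apply: enum_valP.
by exists (enum_rank_in aA a); rewrite enum_rankK_in.
Qed.

Lemma covering_number_ge_dist (T : finType) (A : {set T}) (x : T -> 'rV[R]_d) F
    (delta : R) : (forall a, a \in A -> F (x a)) ->
  (forall a b, a \in A -> b \in A -> a != b -> delta < eucl_dist (x a) (x b)) ->
  (#|A|%:R%:E <= covering_number F delta)%E.
Proof.
move=> Fx xd; apply: le_ereal_inf_tmp => _ [n [U [Ud FU]] <-].
rewrite lee_fin ler_nat.
have [->|[a0 a0A]] := set_0Vmem A; first by rewrite cards0.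
have [i0 _] := FU _ (Fx _ a0A).
pose f a := xget i0 [set i | U i (x a)].
have fP a : a \in A -> U (f a) (x a).
  by move=> aA; have [i Ui] := FU _ (Fx _ aA); apply: (@xgetPex _ i0 [set i | U i (x a)]);
    exists i.
rewrite -[leqRHS]card_ord -(@card_in_imset _ _ f A) ?max_card// => a b aA bA fab.
apply/eqP; apply: contraT => /(xd _ _ aA bA); rewrite ltNge => /negP[].
rewrite -lee_fin; apply: le_trans (Ud (f a)).
by apply: le_diam; rewrite ?fab; [rewrite -fab|]; apply: fP.
Qed.

Lemma covering_number_ge (T : finType) (A : {set T}) (x : T -> 'rV[R]_d) F
    (delta : R) : (forall a, a \in A -> F (x a)) ->
  (forall a b, a \in A -> b \in A -> a != b ->
     exists l, delta < `|x a 0 l - x b 0 l|) ->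
  (#|A|%:R%:E <= covering_number F delta)%E.
Proof.
move=> Fx xd; apply: covering_number_ge_dist Fx _ => a b aA bA /(xd _ _ aA bA)[l].
by move=> /lt_le_trans; apply; apply: ler_eucl_dist.
Qed.

Lemma subdivide_itv (t : nat) (h y : R) : (0 < t)%N -> 0 <= y -> y <= h ->
  exists j : 'I_t, j%:R * (h / t%:R) <= y /\ y <= j.+1%:R * (h / t%:R).
Proof.
move=> t0 y0 yh.
have ex : exists j, y <= j.+1%:R * (h / t%:R).
  by exists t.-1; rewrite prednK// mulrC divfK// pnatr_eq0 -lt0n.
have mt : (ex_minn ex < t)%N.
  case: ex_minnP => m _ /(_ t.-1) mt; rewrite -(prednK t0) ltnS mt//.
  by rewrite prednK// mulrC divfK// pnatr_eq0 -lt0n.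
exists (Ordinal mt) => /=; case: ex_minnP => -[|m] ym mmin; split=> //.
  by rewrite mul0r.
by rewrite leNgt; apply/negP => /ltW /mmin; rewrite ltnn.
Qed.

(** Each box of side [h] is cut into [t] parts per side; the third hypothesis says that a piece, of
    Euclidean diameter at most [sqrt d * h / t], is an admissible covering set. *)
Lemma covering_number_boxes (T : finType) (A : {set T}) (u : T -> 'rV[R]_d) F
    (delta h : R) (t : nat) : (0 < t)%N -> 0 <= h ->
  Num.sqrt d%:R * h <= t%:R * delta ->
  (forall x, F x -> exists2 a, a \in A &
     forall l, u a 0 l <= x 0 l /\ x 0 l <= u a 0 l + h) ->
  (covering_number F delta <= (#|A| * t ^ d)%:R%:E)%E.
Proof.
move=> t0 h0 htd FA.
have t0R : (0 : R) < t%:R by rewrite ltr0n.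
have -> : (#|A| * t ^ d = #|finset.setX A [set: {ffun 'I_d -> 'I_t}]%SET|)%N.
  by rewrite cardsX cardsT card_ffun !card_ord.
apply: (@covering_number_le _ _ (fun p : T * {ffun 'I_d -> 'I_t} => [set x |
   forall l, (p.2 l)%:R * (h / t%:R) <= x 0 l - u p.1 0 l /\
             x 0 l - u p.1 0 l <= (p.2 l).+1%:R * (h / t%:R)])).
  move=> [a j] _; apply: (@le_trans _ _ (Num.sqrt d%:R * (h / t%:R))%:E).
    apply: diam_le => [|x y /= Ux Uy].
      by rewrite mulr_ge0 ?sqrtr_ge0 ?divr_ge0 ?ler0n.
    apply: eucl_dist_le; first by rewrite divr_ge0 ?ler0n.
    move=> l; have [x1 x2] := Ux l; have [y1 y2] := Uy l.
    rewrite -[(j l).+1]addn1 natrD mulrDl mul1r in x2 y2.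
    by rewrite ler_norml; apply/andP; split; lra.
  by rewrite lee_fin mulrA ler_pdivrMr// [leRHS]mulrC.
move=> x /FA[a aA ax].
have /choice[j jP] : forall l, exists j : 'I_t,
    j%:R * (h / t%:R) <= x 0 l - u a 0 l /\ x 0 l - u a 0 l <= j.+1%:R * (h / t%:R).
  by move=> l; have [? ?] := ax l; apply: subdivide_itv => //; lra.
exists (a, [ffun l => j l]); first by rewrite !inE aA.
by move=> l /=; rewrite ffunE.
Qed.

End Euclid.

(** * Cubes as subsets of space *)

Section CubeGeometry.
Variables (R : realType) (d : nat) (M N : nat -> nat).
Hypothesis M2 : forall k, (1 <= k)%N -> (2 <= M k)%N.
Hypothesis NM : forall k, (1 <= k)%N -> (1 <= N k)%N && (N k <= M k ^ d)%N.

Local Notation cube := (cube d M).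
Local Notation pM := (pprod M).
Local Notation pN := (pprod N).
Local Notation r := (scale R M 1).
Local Notation cset := (@cube_set d M R _).

Lemma scaleE n : r n = (pM 1 n)%:R^-1.
Proof. by []. Qed.

Lemma scale_gt0 n : 0 < r n.
Proof. by rewrite invr_gt0 ltr0n pM_gt0. Qed.

Lemma scale0 : r 0 = 1.
Proof. by rewrite scaleE pprod_nil invr1. Qed.

Lemma scale_mul n m : (n <= m)%N -> r n = (pM n.+1 m)%:R * r m.
Proof.
move=> nm; rewrite !scaleE (@pprod_cat M 1 n m)// natrM invfM mulrCA divff ?mulr1//.
by rewrite pnatr_eq0 -lt0n pM_gt0.
Qed.

Lemma scale_le n m : (n <= m)%N -> r m <= r n.
Proof.
move=> nm; rewrite (scale_mul nm) ler_peMl ?ler1n ?pM_gt0//.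
exact/ltW/scale_gt0.
Qed.

Lemma scale_le1 n : r n <= 1.
Proof. by rewrite -scale0 scale_le. Qed.

Lemma scale_le_exp n : r n <= 2^-1 ^+ n.
Proof.
rewrite exprVn lef_pV2 ?posrE ?exprn_gt0 ?ltr0n ?pM_gt0//.
by rewrite -natrX ler_nat -[in (2 ^ n)%N](subn0 n) pM_ge_exp.
Qed.

Lemma scale_small (e : R) : 0 < e -> exists n, forall m, (n <= m)%N -> r m < e.
Proof.
move=> /half_pow_small[n nP]; exists n => m /nP.
exact: le_lt_trans (scale_le_exp m).
Qed.

Definition corner n (Q : cube n) : 'rV[R]_d := \row_l ((Q l)%:R * r n).

Lemma cube_set_corner n (Q : cube n) : cset Q (corner Q).
Proof.
move=> l; rewrite mxE; split=> //.
by rewrite ler_pM2r ?scale_gt0// ler_nat.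
Qed.

Lemma cube_set_below n m (Q : cube n) (Q' : cube m) : (n <= m)%N ->
  below Q Q' -> cset Q' `<=` cset Q.
Proof.
move=> nm /forallP QQ' x xQ' l; have [x1 x2] := xQ' l.
rewrite (scale_mul nm) !mulrA -!natrM.
have := QQ' l; rewrite divn_eq_itv ?pM_gt0// => /andP[h1 h2].
split; [apply: le_trans x1|apply: (le_trans x2)].
all: by rewrite ler_pM2r ?scale_gt0// ler_nat.
Qed.

(** Sup distance between lower corners, decidable on indices so that neighbours can be counted.
    Passing from points to the cubes of level [n] that contain them, or from cubes to ancestors of
    level [n], costs an additive [r n]. *)
Definition near (rho : R) n (Q Q' : cube n) : bool :=
  [forall l, `|(Q l)%:R - (Q' l)%:R| * r n <= rho].

Lemma near_points n (Q Q' : cube n) (x x' : 'rV[R]_d) (rho : R) :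
  cset Q x -> cset Q' x' -> (forall l, `|x 0 l - x' 0 l| <= rho) ->
  near (rho + r n) Q Q'.
Proof.
move=> Qx Q'x' xx'; apply/forallP => l.
have := xx' l; have [a1 a2] := Qx l; have [b1 b2] := Q'x' l.
rewrite -natr1 mulrDl mul1r in a2; rewrite -natr1 mulrDl mul1r in b2.
rewrite -[X in _ * X](ger0_norm (ltW (scale_gt0 n))) -normrM mulrBl !ler_norml.
by move=> /andP[h1 h2]; apply/andP; split; lra.
Qed.

Lemma near_anc n m (P P' : cube n) (Q Q' : cube m) (rho : R) : (n <= m)%N ->
  below P Q -> below P' Q' -> near rho Q Q' -> near (rho + r n) P P'.
Proof.
move=> nm PQ P'Q' QQ'; apply: (@near_points n P P' (corner Q) (corner Q')).
- exact: (cube_set_below nm PQ (cube_set_corner Q)).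
- exact: (cube_set_below nm P'Q' (cube_set_corner Q')).
move=> l; have := forallP QQ' l.
by rewrite !mxE -mulrBl normrM (ger0_norm (ltW (scale_gt0 m))).
Qed.

Lemma near_le n (Q Q' : cube n) (rho rho' : R) : rho <= rho' ->
  near rho Q Q' -> near rho' Q Q'.
Proof.
by move=> le /forallP h; apply/forallP => l; apply: le_trans le.
Qed.

Lemma card_near n (Q : cube n) (rho : R) : 0 <= rho ->
  #|[set Q' | near rho Q Q']%SET|%:R <= (2 * rho / r n + 1) ^+ d.
Proof.
move=> rho0; set w := Num.truncn (rho / r n).
have w0 : 0 <= rho / r n by rewrite divr_ge0// ltW ?scale_gt0.
have wle : w%:R <= rho / r n by rewrite truncn_le.
apply: (@le_trans _ _ ((2 * w + 1) ^ d)%N%:R); last first.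
  have le1 : (2 * w + 1)%N%:R <= 2 * rho / r n + 1 by rewrite natrD natrM -mulrA; lra.
  by rewrite natrX lerXn2r ?nnegrE// (le_trans _ le1).
rewrite ler_nat; apply: (@leq_trans
    #|[set Q' : cube n | [forall l, (Q l - w <= Q' l < Q l + w + 1)%N]]%SET|).
  apply: subset_leq_card; apply/fintype.subsetP => Q'; rewrite !inE => /forallP h.
  apply/forallP => l; have := h l; rewrite -ler_pdivlMr ?scale_gt0//.
  have eab (a b : nat) : `|a%:R - b%:R| <= rho / r n -> (a <= b + w)%N.
    move=> ab; have [|/ltnW ba] := leqP a b; first by move=> /leq_trans; apply;
      rewrite leq_addr.
    rewrite -leq_subLR truncn_ge_nat// natrB//.
    exact: le_trans (ler_norm _) ab.
  by move=> hh; move: (eab _ _ hh); rewrite distrC in hh; move: (eab _ _ hh); lia.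
apply: (@card_coord_le d _ _ (fun l j => (Q l - w <= j < Q l + w + 1)%N)) => l.
by apply: leq_trans (card_ord_itv _ _ _) _; lia.
Qed.

(** The point is the coordinatewise supremum of the left endpoints. The levels may jump, as the
    category argument requires; by [i <= lev i], the ancestor of [Q n] at level [n] certifies that
    the point lies in stage [n]. *)
Lemma nested_point (c : forall n, {set cube n}) (lev : nat -> nat)
    (Q : forall i, cube (lev i)) :
  outcome N c -> (forall i, Q i \in c (lev i)) -> (forall i, (i <= lev i)%N) ->
  (forall i, (lev i <= lev i.+1)%N /\ below (Q i) (Q i.+1)) ->
  exists x, limit_set c x /\ forall i, cset (Q i) x.
Proof.
move=> oc Qc lev_ge step.
have nest i j : (i <= j)%N -> cset (Q j) `<=` cset (Q i).
  elim: j => [|j IH]; first by rewrite leqn0 => /eqP ->.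
  rewrite leq_eqVlt => /predU1P[->//|/IH] h; apply: subset_trans h.
  exact: cube_set_below (step j).1 (step j).2.
pose lo i l : R := (Q i l)%:R * r (lev i).
pose hi i l : R := (Q i l).+1%:R * r (lev i).
have lohi i j l : lo i l <= hi j l.
  have [ij|/ltnW ji] := leqP i j.
    have [+ _] := nest _ _ ij _ (cube_set_corner (Q j)) l.
    have [_ +] := cube_set_corner (Q j) l.
    by move=> a b; apply: le_trans b a.
  have [_ +] := nest _ _ ji _ (cube_set_corner (Q i)) l.
  by rewrite mxE.
pose x : 'rV[R]_d := \row_l sup [set lo i l | i in [set: nat]].
have xQ i : cset (Q i) x.
  move=> l; rewrite mxE; split.
    apply: ub_le_sup; last by exists i.
    by exists (hi 0%N l) => _ [j _ <-]; apply: lohi.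
  apply: ge_sup; first by exists (lo 0%N l); exists 0%N.
  by move=> _ [j _ <-]; apply: lohi.
exists x; split => // n /= n1.
have [P Pc PQ] := outcome_anc M2 oc (lev_ge n) (Qc n).
by exists P => //; apply: cube_set_below (xQ n).
Qed.

Lemma limit_set_in_cube (c : forall n, {set cube n}) n (Q : cube n) :
  outcome N c -> Q \in c n -> exists2 x, limit_set c x & cset Q x.
Proof.
move=> oc Qc.
have st (i : nat) (P : {P : cube (n + i) | P \in c (n + i)%N}) :
    {P' : {P' : cube (n + i.+1) | P' \in c (n + i.+1)%N} |
       below (sval P) (sval P')}.
  have nn : (n + i <= n + i.+1)%N by rewrite leq_add2l.
  case: P => P Pc /=; have [P' P'c PP'] := cid2 (outcome_desc M2 NM oc nn Pc).
  by exists (exist _ P' P'c).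
have Q0 : {P : cube (n + 0) | P \in c (n + 0)%N & below Q P}.
  by apply/cid2; apply: (outcome_desc M2 NM oc _ Qc); rewrite addn0.
case: Q0 => Q0 Q0c QQ0.
pose S := fix S i : {P : cube (n + i) | P \in c (n + i)%N} :=
  if i is j.+1 then sval (st j (S j)) else exist _ Q0 Q0c.
have [] := @nested_point c (fun i => (n + i)%N) (fun i => sval (S i)) oc.
- by move=> i; case: (S i).
- by move=> i; rewrite leq_addl.
- by move=> i; split; [rewrite leq_add2l|rewrite /=; case: (st i (S i))].
move=> x [Ex xS]; exists x => //.
by apply: cube_set_below QQ0 _ (xS 0%N); rewrite addn0.
Qed.

End CubeGeometry.

(** Cauchy-Schwarz on the fibre sizes [n b], whose squares sum to the number of colliding pairs.
    Expanding the squares of [n b - 2 * K] yields the constant [4 * K / 3], rounded up to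
    [2 * K]. *)
Lemma card_image_collisions (R : realFieldType) (T T' : finType) (f : T -> T')
    (S : {set T}) (K : R) : 0 < K ->
  \sum_(x in S) \sum_(y in S) (f x == f y)%:R <= K * #|S|%:R ->
  #|S|%:R <= 2 * K * #|[set f x | x in S]%SET|%:R.
Proof.
move=> K0; set B := [set f x | x in S]%SET => pairsK.
pose n b : R := \sum_(y in S) (b == f y)%:R.
have part (F : T' -> R) : \sum_(x in S) F (f x) = \sum_(b in B) n b * F b.
  rewrite (partition_big f (mem B)) /= => [|x xS]; last exact: imset_f.
  apply: eq_bigr => b _; rewrite /n mulr_suml [LHS]big_mkcondr/=.
  by apply: eq_bigr => x _; rewrite eq_sym; case: eqP => [->|]; rewrite ?mul1r ?mul0r.
have cS : \sum_(b in B) n b = #|S|%:R.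
  by under eq_bigr do rewrite -[n _]mulr1; rewrite -(part (fun=> 1)) sumr_const.
have : 0 <= \sum_(b in B) (n b - 2 * K) ^+ 2 by apply: sumr_ge0 => b _; apply: sqr_ge0.
have -> : \sum_(b in B) (n b - 2 * K) ^+ 2 =
    \sum_(x in S) n (f x) - 4 * K * #|S|%:R + 4 * K ^+ 2 * #|B|%:R.
  rewrite part -cS mulr_sumr -sumrB -[#|B|%:R](sumr_const (mem B)) mulr_sumr -big_split /=.
  by apply: eq_bigr => b _; ring.
move: pairsK; rewrite -/(n _) => pK h.
have : 0 <= K * (4 * K * #|B|%:R - 3 * #|S|%:R).
  by apply: le_trans h _; rewrite expr2; lra.
rewrite pmulr_rge0// => h'.
have : (0 : R) <= #|S|%:R by [].
by lra.
Qed.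

(** * Mesh boxes and separated families of cubes *)

Section Separation.
Variables (R : realType) (d : nat) (M : nat -> nat).
Hypothesis M2 : forall k, (1 <= k)%N -> (2 <= M k)%N.

Local Notation cube := (cube d M).
Local Notation pM := (pprod M).
Local Notation r := (scale R M 1).
Local Notation cset := (@cube_set d M R _).

(** With [r n / L] as mesh size, this is the index of the mesh box that holds the lower corner of
    [Q]. Positions are measured in the whole unit cube, not relative to the parent. *)
Definition box n (L : nat) (Q : cube n.+1) : {ffun 'I_d -> 'I_(pM 1 n.+1).+1} :=
  [ffun l => inord (Q l * L %/ M n.+1)].

Lemma val_box n L (Q : cube n.+1) l : (L <= M n.+1)%N ->
  box L Q l = (Q l * L %/ M n.+1)%N :> nat.
Proof.
move=> LM; rewrite ffunE inordK// ltnS.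
have M0 : (0 < M n.+1)%N by rewrite (leq_trans _ (M2 _)).
rewrite (@leq_trans (Q l))//; last exact: ltnW.
by rewrite -[leqRHS](mulnK _ M0) leq_div2r// leq_mul2l LM orbT.
Qed.

(** The mesh refines the cubes of level [n]: dividing the floor of [Q l * L / M n.+1] by [L] gives
    the floor of [Q l / M n.+1], the parent coordinate. *)
Lemma box_par n L (Q Q' : cube n.+1) : (1 <= L <= M n.+1)%N ->
  box L Q = box L Q' -> par M2 Q = par M2 Q'.
Proof.
move=> /andP[L0 LM] e; apply/ffunP => l; apply/val_inj; rewrite !ffunE /=.
have : (box L Q l %/ L = box L Q' l %/ L)%N by rewrite e.
have M0 : (0 < M n.+1)%N by rewrite (leq_trans _ (M2 _)).
rewrite !val_box// -!divnMA mulnC.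
by rewrite !(mulnC _ L) !divnMl.
Qed.

Lemma box_full_inj n : injective (@box n (M n.+1)).
Proof.
move=> Q Q' e; apply/ffunP => l; apply/val_inj => /=.
have M0 : (0 < M n.+1)%N by rewrite (leq_trans _ (M2 _)).
by have := congr1 (fun f : {ffun 'I_d -> 'I_(pM 1 n.+1).+1} => nat_of_ord (f l)) e;
  rewrite !val_box// !mulnK.
Qed.

Lemma card_same_box n L (Q : cube n.+1) : (1 <= L <= M n.+1)%N ->
  (#|[set Q' | box L Q == box L Q']%SET| <= (M n.+1 %/ L).+1 ^ d)%N.
Proof.
move=> /andP[L0 LM].
have M0 : (0 < M n.+1)%N by rewrite (leq_trans _ (M2 _)).
(* The ceiling of [b * M n.+1 / L], for [b] the box coordinate: the first index that falls into the
   box. *)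
pose lo l := ((box L Q l * M n.+1 + L.-1) %/ L)%N.
apply: (@leq_trans #|[set Q' : cube n.+1 |
    [forall l, (lo l <= Q' l < lo l + (M n.+1 %/ L).+1)%N]]%SET|).
  apply: subset_leq_card; apply/fintype.subsetP => Q'; rewrite !inE => /eqP e.
  apply/forallP => l; have : (Q' l * L %/ M n.+1 == box L Q l)%N by rewrite e val_box.
  rewrite divn_eq_itv// /lo; set b := nat_of_ord (box L Q l); set q := nat_of_ord (Q' l).
  move=> /andP[h1 h2]; apply/andP; split.
    by rewrite -ltnS ltn_divLR// mulSn addnC -ltnS -[X in (_ < X)%N]addSn; lia.
  set a := ((b * M n.+1 + L.-1) %/ L)%N.
  have ha : (b * M n.+1 <= a * L)%N.
    have := ltn_ceil (b * M n.+1 + L.-1) L0; rewrite -/a mulSn; lia.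
  rewrite addnS ltnS -leq_subLR leq_divRL// mulnBl; lia.
apply: (@card_coord_le d _ _ (fun l j => (lo l <= j < lo l + (M n.+1 %/ L).+1)%N)) => l.
by apply: leq_trans (card_ord_itv _ _ _) _; rewrite addKn.
Qed.

(* Keeping the occupied boxes of a single residue class modulo 3 leaves two
   empty boxes between any two of them. *)
Lemma separated_subset n L (S : {set cube n.+1}) : (1 <= L <= M n.+1)%N ->
  exists A : {set cube n.+1}, [/\ A \subset S,
    (#|[set box L Q | Q in S]%SET| <= 3 ^ d * #|A|)%N &
    forall Q1 Q2 x1 x2, Q1 \in A -> Q2 \in A -> Q1 != Q2 ->
      cset Q1 x1 -> cset Q2 x2 ->
      exists l, r n / L%:R < `|x1 0 l - x2 0 l| ].
Proof.
move=> /andP[L0 LM]; set B := [set box L Q | Q in S]%SET.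
have [S0|[Q0 Q0S]] := set_0Vmem S.
  by exists finset.set0; rewrite finset.sub0set /B S0 imset0 !cards0 muln0; split=> // ? ?;
    rewrite inE.
have M0 : (0 < M n.+1)%N by rewrite (leq_trans _ (M2 _)).
pose cls (b : {ffun 'I_d -> 'I_(pM 1 n.+1).+1}) : {ffun 'I_d -> 'I_3} :=
  [ffun l => inord (b l %% 3)].
(* Pigeonhole over the [3 ^ d] residue classes. One cube of [S] is then picked in each retained
   box. *)
have [k hk] : exists k, (#|B| <= 3 ^ d * #|[set b in B | cls b == k]%SET|)%N.
  apply: contrapT => /forallNP h.
  have : (#|B| * 3 ^ d = \sum_(k : {ffun 'I_d -> 'I_3}) 3 ^ d * #|[set b in B | cls b ==
    k]%SET|)%N.
    rewrite -big_distrr /= mulnC; congr muln.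
    rewrite -sum1_card (partition_big cls xpredT)//=.
    by apply: eq_bigr => k _; rewrite -sum1_card; apply: eq_bigl => b; rewrite !inE.
  have -> : (#|B| * 3 ^ d = \sum_(k : {ffun 'I_d -> 'I_3}) #|B|)%N.
    by rewrite sum_nat_const card_ffun !card_ord mulnC.
  apply/eqP; rewrite neq_ltn; apply/orP; right.
  rewrite (bigD1 [ffun=> ord0])// [ltnRHS](bigD1 [ffun=> ord0])//=.
  rewrite -addSn leq_add//; first by rewrite ltnNge; apply/negP/h.
  by apply: leq_sum => k _; rewrite leqNgt; apply/negP => /ltnW /h.
pose g b := odflt Q0 [pick Q in S | box L Q == b].
have gP b : b \in B -> g b \in S /\ box L (g b) = b.
  move=> /imsetP[Q QS ->]; rewrite /g; case: pickP => [Q' /andP[? /eqP]//|/(_ Q)].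
  by rewrite QS eqxx.
pose Bk := [set b in B | cls b == k]%SET.
exists (g @: Bk)%SET; split.
- by apply/fintype.subsetP => _ /imsetP[b + ->]; rewrite inE => /andP[/gP[]].
- rewrite card_in_imset// => b1 b2; rewrite !inE => /andP[/gP[_ e1] _] /andP[/gP[_ e2] _].
  by move=> e; rewrite -e1 -e2 e.
move=> _ _ x1 x2 /imsetP[b1 + ->] /imsetP[b2 + ->].
rewrite !inE => /andP[/gP[_ e1] /eqP c1] /andP[/gP[_ e2] /eqP c2] ne.
have {}ne : b1 != b2 by apply: contraNneq ne => ->.
have /existsP[l bl] : [exists l, b1 l != b2 l].
  apply: contraNT ne; rewrite negb_exists => /forallP h.
  by apply/eqP/ffunP => l; apply/eqP; rewrite -[_ == _]negbK.
have m3 : (b1 l = b2 l %[mod 3])%N.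
  have := congr1 (fun f : {ffun 'I_d -> 'I_3} => nat_of_ord (f l)) (etrans c1 (esym c2)).
  by rewrite !ffunE !inordK ?ltn_pmod.
(* Box coordinates 3 apart put the lower corners more than two mesh sizes apart; the cube [Q2]
   itself takes up at most one of these, as [L <= M n.+1]. *)
have key (Q1 Q2 : cube n.+1) (y1 y2 : 'rV[R]_d) : (box L Q2 l + 3 <= box L Q1 l)%N ->
    cset Q1 y1 -> cset Q2 y2 -> r n / L%:R < y1 0 l - y2 0 l.
  rewrite !val_box// => b3 /(_ l)[h1 _] /(_ l)[_ h2].
  have q1 := leq_divM (Q1 l * L) (M n.+1).
  have q2 := ltn_ceil (Q2 l * L) M0.
  have q12 : (Q2 l * L + 2 * M n.+1 < Q1 l * L)%N by nia.
  have rE : r n = (M n.+1)%:R * r n.+1 by rewrite (scale_mul R M2 (leqnSn n)) /pprod big_nat1.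
  have r0 : 0 < r n.+1 by rewrite scale_gt0.
  have L0R : (0 : R) < L%:R by rewrite ltr0n.
  rewrite ltr_pdivrMr// rE.
  have q12R : (Q2 l)%:R * L%:R + 2 * (M n.+1)%:R < (Q1 l)%:R * L%:R :> R.
    by rewrite -!natrM -natrD ltr_nat.
  have LMR : L%:R <= (M n.+1)%:R :> R by rewrite ler_nat.
  apply: (@lt_le_trans _ _ (((Q1 l)%:R * r n.+1 - (Q2 l).+1%:R * r n.+1) * L%:R)).
    rewrite -mulrBl mulrAC ltr_pM2r// -natr1; lra.
  by rewrite ler_pM2r//; lra.
have gap (a b : nat) : a = b %[mod 3] -> (a < b)%N -> (a + 3 <= b)%N by lia.
have [lt|le] := ltnP (b1 l) (b2 l) => xQ1 xQ2.
  exists l; rewrite distrC; apply: lt_le_trans (ler_norm _).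
  by apply: key xQ2 xQ1; rewrite e1 e2; apply: gap.
have {}le : (b2 l < b1 l)%N by rewrite ltn_neqAle le eq_sym bl.
exists l; apply: lt_le_trans (ler_norm _).
by apply: key xQ1 xQ2; rewrite e1 e2; apply: gap.
Qed.

End Separation.

(** * Lower bounds for the Hausdorff and packing dimensions *)

Section LowerBounds.
Variables (R : realType) (d : nat) (M N : nat -> nat).
Hypothesis M2 : forall k, (1 <= k)%N -> (2 <= M k)%N.
Hypothesis NM : forall k, (1 <= k)%N -> (1 <= N k)%N && (N k <= M k ^ d)%N.

Local Notation cube := (cube d M).
Local Notation pM := (pprod M).
Local Notation pN := (pprod N).
Local Notation r := (scale R M 1).
Local Notation cset := (@cube_set d M R _).

(** A property inherited by at least one chosen child follows an infinite branch by dependent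
    choice, and the branch shrinks to a point of the limit set. A failure of compactness is thus
    turned into a concrete point. *)
Lemma koenig_point (c : forall n, {set cube n}) (bad : forall n, cube n -> Prop) :
  outcome N c -> (exists Q : cube 0, bad 0%N Q) ->
  (forall n Q, Q \in c n -> bad n Q ->
     exists2 Q', Q' \in c n.+1 & below Q Q' /\ bad n.+1 Q') ->
  exists x : 'rV[R]_d, limit_set c x /\
    forall n, exists2 Q, Q \in c n & bad n Q /\ cset Q x.
Proof.
move=> oc /cid[Q0 bQ0] step.
have st n (P : {P : cube n | P \in c n /\ bad n P}) :
    {P' : {P' : cube n.+1 | P' \in c n.+1 /\ bad n.+1 P'} |
       below (sval P) (sval P')}.
  case: P => P [Pc bP] /=; have [P' P'c [PP' bP']] := cid2 (step _ _ Pc bP).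
  by exists (exist _ P' (conj P'c bP')).
pose S := fix S i : {P : cube i | P \in c i /\ bad i P} :=
  if i is j.+1 then sval (st j (S j))
  else exist _ Q0 (conj (outcome_root oc Q0) bQ0).
have [] := @nested_point R _ _ _ M2 c id (fun i => sval (S i)) oc.
- by move=> i; case: (S i) => ? [].
- by [].
- by move=> i; split=> //; rewrite /=; case: (st i (S i)).
move=> x [Ex xS]; exists x; split => // n.
exists (sval (S n)); first by case: (S n) => ? [].
by split=> //; case: (S n) => ? [].
Qed.

(* Compactness of the limit set in combinatorial form. *)
Lemma cover_finite_level (c : forall n, {set cube n}) (U : nat -> set 'rV[R]_d)
    (rho : nat -> R) : outcome N c -> (forall i, 0 < rho i) ->
  limit_set c `<=` \bigcup_i U i ->
  exists m0 p, forall m Q, (m0 <= m)%N -> Q \in c m ->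
    exists i : 'I_p, r m < rho i /\
      exists y, U i y /\ exists2 x, cset Q x & forall l, `|x 0 l - y 0 l| <= rho i.
Proof.
move=> oc rho0 cU.
(* [Q] is good when finitely many of the fattened [U i] reach all its deep descendants. If all
   chosen children are good, the maxima of their bounds serve for [Q]; so badness passes to a
   child. *)
pose good n (Q : cube n) := exists m0 p, forall m Q', (m0 <= m)%N -> (n <= m)%N ->
  Q' \in c m -> below Q Q' -> exists i : 'I_p, r m < rho i /\
      exists y, U i y /\ exists2 x, cset Q' x & forall l, `|x 0 l - y 0 l| <= rho i.
have [[Q0 bQ0]|/forallNP gQ0] := pselect (exists Q : cube 0, ~ good 0%N Q); last first.
  have /contrapT[m0 [p h]] := gQ0 [ffun=> Ordinal (pM_gt0 M2 0 0)].
  by exists m0, p => m Q mm Qc; apply: h => //; apply: below0.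
exfalso.
have [] := @koenig_point c (fun n Q => ~ good n Q) oc.
- by exists Q0.
- move=> n Q Qc; apply: contra_notP => /forall2NP h.
  have /choice[f fP] : forall Q' : cube n.+1, exists mp : nat * nat,
      forall (_ : Q' \in c n.+1) (_ : below Q Q') m Q'', (mp.1 <= m)%N -> (n.+1 <= m)%N ->
      Q'' \in c m -> below Q' Q'' -> exists i : 'I_mp.2, r m < rho i /\
      exists y, U i y /\ exists2 x, cset Q'' x & forall l, `|x 0 l - y 0 l| <= rho i.
    move=> Q'; case: (h Q') => [nQ'|].
      by exists (0%N, 0%N).
    move=> /not_andP[nQ'|/contrapT[m0 [p hp]]]; first by exists (0%N, 0%N).
    by exists (m0, p) => _ _; apply: hp.
  exists (maxn n.+1 (\max_Q' (f Q').1)), (\max_Q' (f Q').2) => m Q''.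
  rewrite geq_max => /andP[nm /bigmax_leqP fm] _ Q''c QQ''.
  have [Q' Q'c Q'Q''] := outcome_anc M2 oc nm Q''c.
  have QQ' : below Q Q'.
    rewrite (below_par M2 Q Q' (leqnn n)) below_refl; apply/eqP.
    have e : below (par M2 Q') Q'.
      by rewrite (below_par M2 _ _ (leqnn n)) below_refl.
    by apply: (below_inj (below_trans (leqnSn n) nm e Q'Q'') QQ'').
  have [i [ri [y [Uy yP]]]] := fP Q' Q'c QQ' m Q'' (fm Q' isT) nm Q''c Q'Q''.
  have ip : (i < \max_Q' (f Q').2)%N.
    by apply: leq_trans (ltn_ord i) _; apply: (leq_bigmax Q').
  by exists (Ordinal ip); split => //; exists y.
move=> x [Ex xc].
(* The [U i] are arbitrary sets; the positive margin [rho i] stands in for openness, since it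
   exceeds the side of a deep enough cube around [x]. *)
have [i _ Uix] := cU _ Ex.
have [n rn] := scale_small M2 (rho0 i).
have [Q Qc [nG xQ]] := xc n; apply: nG.
exists n, i.+1 => m Q' nm _ Q'c QQ'.
exists ord_max; split; first exact: rn.
exists x; split => //; exists (corner R Q'); first exact: cube_set_corner.
move=> l; have [a1 a2] := cube_set_below M2 nm QQ' (cube_set_corner R M2 Q') l.
have [b1 b2] := xQ l.
have := rn n (leqnn n); rewrite -natr1 mulrDl mul1r in a2 b2 => /ltW rle.
by apply: le_trans rle; rewrite ler_norml; apply/andP; split; lra.
Qed.

Lemma sum_half_pow (p : nat) : \sum_(i < p) 2^-1 ^+ i.+1 <= 1 :> R.
Proof.
have -> : \sum_(i < p) 2^-1 ^+ i.+1 = 1 - 2^-1 ^+ p :> R.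
  elim: p => [|p IH]; first by rewrite big_ord0 expr0 subrr.
  by rewrite big_ord_recr /= IH exprS; field.
by rewrite gerBl exprn_ge0// invr_ge0.
Qed.

(* Mass distribution principle, for the uniform measures on finite sets of
   cubes of arbitrarily deep levels. *)
Lemma dimH_ge (c : forall n, {set cube n}) (s K rho0 : R) : outcome N c ->
  0 < s -> 0 < K -> 0 < rho0 ->
  (forall m0, exists m (A : {set cube m}), [/\ (m0 <= m)%N, A \subset c m,
     (#|c m| <= 2 * #|A|)%N &
     forall Q rho, Q \in A -> r m < rho -> rho <= rho0 ->
       #|[set Q' in A | near (4 * rho) Q Q']%SET|%:R
         <= K * rho `^ s * #|c m|%:R]) ->
  (s%:E <= dimH (limit_set c : set 'rV[R]_d))%E.
Proof.
move=> oc s0 K0 rho00 mass; apply: le_ereal_inf_tmp => _ [t [t0 Ht] <-].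
rewrite lee_fin leNgt; apply/negP => ts.
pose delta := Num.min rho0 1.
have delta0 : 0 < delta by rewrite lt_min rho00 ltr01.
(* The first term keeps the radii [eps i] below [rho0]; the second gives [K * (2 * eta) <= 1/4], so
   the cover captures at most a quarter of the mass while [A] carries at least half of it. *)
pose eta := Num.min (rho0 `^ s) (8 * K)^-1.
have eta0 : 0 < eta by rewrite lt_min powR_gt0//= invr_gt0 mulr_gt0.
have : (hausdorff_pre t delta (limit_set c : set 'rV[R]_d) < eta%:E)%E.
  apply: (@le_lt_trans _ _ 0%E); last by rewrite lte_fin.
  by rewrite -Ht; apply: ereal_sup_ubound; exists delta.
move=> /ereal_inf_lt[_ [U [Udelta cU] <-] sumU].
pose D i := fine (diam (U i)).
have Dfin i : (diam (U i) = (D i)%:E).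
  rewrite fineK// ge0_fin_numE ?diam_ge0//.
  by apply: le_lt_trans (Udelta i) _; rewrite ltry.
have D0 i : 0 <= D i by rewrite -lee_fin -Dfin diam_ge0.
have Dd i : D i <= delta by rewrite -lee_fin -Dfin.
pose a i : R := if U i == set0 then 0 else D i `^ t.
have aE i : diam_pow t (U i) = (a i)%:E.
  by rewrite /diam_pow /a; case: ifPn => // _; rewrite Dfin.
have a0 i : 0 <= a i by rewrite /a; case: ifP => // _; apply: powR_ge0.
have suma p : \sum_(i < p) a i <= eta.
  rewrite -lee_fin (le_trans _ (ltW sumU))//.
  have := @nneseries_lim_ge R (fun i => diam_pow t (U i)) xpredT 0 p.
  rewrite big_mkord -sumEFin; under eq_bigr do rewrite aE.
  by apply => i _ _; rewrite aE lee_fin.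
have etah (i : nat) : 0 <= eta * 2^-1 ^+ i.+1.
  by apply: mulr_ge0; [exact: ltW | apply: exprn_ge0; rewrite invr_ge0].
(* A set of tiny or zero diameter has no usable scale. It is given the radius [eps i], whose [s]-th
   powers sum to at most [eta]. *)
pose eps i := (eta * 2^-1 ^+ i.+1) `^ s^-1.
have epsE i : eps i `^ s = eta * 2^-1 ^+ i.+1.
  by rewrite -powRrM mulVf ?gt_eqF// powRr1.
have eps0 i : 0 < eps i by rewrite powR_gt0// mulr_gt0// exprn_gt0// invr_gt0.
have half1 (i : nat) : 2^-1 ^+ i.+1 <= 1 :> R.
  by rewrite exprn_ile1// ?invr_ge0// invf_le1// ler1n.
have epsrho i : eps i <= rho0.
  apply: (@le_trans _ _ ((rho0 `^ s) `^ s^-1)).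
    apply: ge0_ler_powR; rewrite ?nnegrE ?powR_ge0 ?invr_ge0 ?(ltW s0)//.
    by rewrite (@le_trans _ _ eta)// ?ge_min ?lexx// ler_piMr// ltW.
  by rewrite -powRrM mulfV ?gt_eqF// powRr1// ltW.
pose rho i := Num.max (D i) (eps i).
have rhogt0 i : 0 < rho i by rewrite lt_max eps0 orbT.
have rholt i : rho i <= rho0.
  by rewrite ge_max epsrho (le_trans (Dd i))// ge_min lexx.
have [m0 [p mp]] := cover_finite_level oc rhogt0 cU.
have [m [A [m0m Ac cA mass']]] := mass m0.
pose Ai i := [set Q in A | `[< r m < rho i /\ exists y, U i y /\
  exists2 x, cset Q x & forall l, `|x 0 l - y 0 l| <= rho i >]]%SET.
have cardA : (#|A| <= \sum_(i < p) #|Ai i|)%N.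
  apply: (@leq_trans #|\bigcup_(i < p) Ai i|%SET).
    apply: subset_leq_card; apply/fintype.subsetP => Q QA.
    have [i ip] := mp m Q m0m (fintype.subsetP Ac _ QA).
    by apply/bigcupP; exists i => //; rewrite inE QA; apply/asboolP.
  elim/big_rec2 : _ => [|i k B _ IH]; first by rewrite cards0.
  by rewrite (leq_trans (leq_card_setU _ _))// leq_add2l.
have cardAi i : #|Ai i|%:R <= K * (a i + eta * 2^-1 ^+ i.+1) * #|c m|%:R.
  have [->|[Q]] := set_0Vmem (Ai i).
    by rewrite cards0 mulr_ge0// mulr_ge0 ?(ltW K0)// addr_ge0.
  rewrite inE => /andP[QA /asboolP[rmi [y [Uy [x xQ xy]]]]].
  have Ui : U i == set0 = false by apply/negP => /eqP U0; move: Uy; rewrite U0.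
  apply: (@le_trans _ _ #|[set Q' in A | near (4 * rho i) Q Q']%SET|%:R).
    rewrite ler_nat; apply: subset_leq_card; apply/fintype.subsetP => Q'.
    rewrite !inE => /andP[Q'A /asboolP[_ [y' [Uy' [x' x'Q' xy']]]]].
    (* Origin of the factor 4: three moves from [x] through [y] and [y'] to [x'], each of length at
       most [rho i], and a cube side [r m < rho i] to pass to the corners. *)
    rewrite Q'A /=; apply: (@near_le _ _ _ _ _ _ (3 * rho i + r m));
      first by have := ltW rmi; lra.
    apply: (near_points M2 xQ x'Q') => l.
    have yy' : `|y 0 l - y' 0 l| <= rho i.
      apply: le_trans (ler_eucl_dist y y' l) _.
      rewrite le_max; apply/orP; left; rewrite -lee_fin -Dfin.
      exact: le_diam.
    move: (xy l) (xy' l) yy'; rewrite !ler_norml => /andP[? ?] /andP[? ?] /andP[? ?].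
    by apply/andP; split; lra.
  apply: le_trans (mass' Q _ QA rmi (rholt i)) _.
  rewrite ler_wpM2r ?ler0n// ler_wpM2l ?(ltW K0)//.
  have Das : D i `^ s <= a i.
    rewrite /a Ui; have [->|D0'] := eqVneq (D i) 0.
      by rewrite powR0 ?gt_eqF// powR_ge0.
    apply: ger_powR; last exact: ltW.
    by rewrite lt_neqAle eq_sym D0' D0 /= (le_trans (Dd i))// ge_min lexx orbT.
  have := etah i; have := a0 i; rewrite /rho; have [|] := leP (D i) (eps i) => _;
    rewrite ?epsE; lra.
have c0 : 0 < #|c m|%:R :> R by rewrite ltr0n (card_outcome M2 oc) (pN_gt0 NM).
have : #|A|%:R <= K * (2 * eta) * #|c m|%:R.
  apply: (@le_trans _ _ (\sum_(i < p) #|Ai i|%:R)).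
    by rewrite -natr_sum ler_nat.
  apply: (@le_trans _ _ (\sum_(i < p) K * (a i + eta * 2^-1 ^+ i.+1) * #|c m|%:R)).
    by apply: ler_sum => i _.
  rewrite -mulr_suml ler_wpM2r ?ler0n// -mulr_sumr ler_wpM2l ?(ltW K0)//.
  rewrite big_split /= -mulr_sumr.
  have := suma p; have := ler_wpM2l (ltW eta0) (sum_half_pow p); rewrite mulr1; lra.
have etaK : eta * K <= 8^-1.
  apply: (@le_trans _ _ ((8 * K)^-1 * K)); first by rewrite ler_pM2r// ge_min lexx orbT.
  by rewrite invfM mulrVK// unitfE gt_eqF.
have : #|c m|%:R <= 2 * #|A|%:R :> R by rewrite -natrM ler_nat.
have := ler_wpM2r (ltW c0) etaK; lra.
Qed.

End LowerBounds.

Section PackingLowerBound.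
Variables (R : realType) (d : nat) (M N : nat -> nat).
Hypothesis d0 : (1 <= d)%N.
Hypothesis M2 : forall k, (1 <= k)%N -> (2 <= M k)%N.
Hypothesis NM : forall k, (1 <= k)%N -> (1 <= N k)%N && (N k <= M k ^ d)%N.

Local Notation cube := (cube d M).
Local Notation r := (scale R M 1).
Local Notation cset := (@cube_set d M R _).

(** The centre translated by [rho] along the first axis lies in the ball, so the diameter is at
    least the radius; [1 <= d] supplies the axis. *)
Lemma diam_pow_ecball_ge (x : 'rV[R]_d) (t rho : R) : 0 <= t -> 0 < rho ->
  ((rho `^ t)%:E <= diam_pow t (ecball x rho))%E.
Proof.
move=> t0 rho0; rewrite /diam_pow.
pose y : 'rV[R]_d := \row_l (x 0 l + (l == Ordinal d0)%:R * rho).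
have dxy : eucl_dist x y = rho.
  rewrite /eucl_dist (bigD1 (Ordinal d0))//= big1 ?addr0.
    by rewrite mxE eqxx mul1r opprD addNKr sqrrN sqrtr_sqr gtr0_norm.
  by move=> l /negbTE l0; rewrite mxE l0 mul0r addr0 subrr expr0n.
have xB : ecball x rho x.
  rewrite /ecball /= /eucl_dist big1 ?sqrtr0 ?ltW// => l _.
  by rewrite subrr expr0n.
have yB : ecball x rho y by rewrite /ecball /= dxy.
have -> : ecball x rho == set0 = false by apply/negP => /eqP e; rewrite e in xB.
rewrite -poweR_EFin; apply: gt0_ler_poweR => //.
- by rewrite in_itv /= lee_fin (ltW rho0) leey.
- by rewrite in_itv /= diam_ge0 leey.
- by have := le_diam xB yB; rewrite dxy.
Qed.

Lemma packing_pre_ge (F : set 'rV[R]_d) (T : finType) (A : {set T})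
    (x : T -> 'rV[R]_d) (t rho delta : R) : 0 <= t -> 0 < rho <= delta ->
  (forall a, a \in A -> F (x a)) ->
  (forall a b, a \in A -> b \in A -> a != b ->
     exists l, 2 * rho < `|x a 0 l - x b 0 l|) ->
  ((#|A|%:R * rho `^ t)%:E <= packing_pre t delta F)%E.
Proof.
move=> t0 rhod Fx sep; have [/andP[rho0 _]] := (rhod).
have [->|[a0 a0A]] := set_0Vmem A.
  rewrite cards0 mul0r; apply: ereal_sup_ubound.
  exists set0, (fun=> 0), (fun=> 1); split; first by split=> //; apply: trivIset_set0.
  by rewrite esum_set0.
pose e (i : nat) := nth a0 (enum A) i.
have eA i : (i < #|A|)%N -> e i \in A by move=> iA; rewrite -mem_enum mem_nth// -cardE.
apply: (@le_trans _ _ (\esum_(i in `I_#|A|) diam_pow t (ecball (x (e i)) rho))).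
  apply: esum_ge; exists `I_#|A|; first by split => //; exact: finite_II.
  rewrite -fsbig_ord.
  apply: (@le_trans _ _ (\sum_(i < #|A|) (rho `^ t)%:E)%E).
    by rewrite sumEFin sumr_const card_ord mulr_natl.
  by apply: lee_sum => i _; apply: diam_pow_ecball_ge.
apply: ereal_sup_ubound; exists `I_#|A|, (fun i => x (e i)), (fun=> rho); split=> //.
split=> [i iA|]; first by split=> //; apply/Fx/eA.
apply/trivIsetP => i j iA jA ij; apply/eqP; apply: contraT => /set0P[z [zi zj]].
have [|l] := sep (e i) (e j) (eA _ iA) (eA _ jA).
  by rewrite nth_uniq ?enum_uniq// -cardE.
have := le_trans (ler_eucl_dist _ _ l) zi.
have := le_trans (ler_eucl_dist _ _ l) zj.
rewrite !ler_norml => /andP[? ?] /andP[? ?]; rewrite ltNge => /negP[].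
by rewrite ler_norml; apply/andP; split; lra.
Qed.

(* Baire category argument: a set of finite packing premeasure avoids some
   cube inside any given one. *)
Lemma dimP_ge (c : forall n, {set cube n}) (s : R) : outcome N c ->
  (forall k (Q : cube k) (B delta : R), Q \in c k -> 0 < delta ->
     exists m (A : {set cube m}) (rho : R), [/\ (k <= m)%N,
       forall Q', Q' \in A -> Q' \in c m /\ below Q Q',
       0 < rho <= delta,
       forall Q1 Q2 x1 x2, Q1 \in A -> Q2 \in A -> Q1 != Q2 ->
         cset Q1 x1 -> cset Q2 x2 -> exists l, 2 * rho < `|x1 0 l - x2 0 l| &
       B <= #|A|%:R * rho `^ s]) ->
  (s%:E <= dimP (limit_set c : set 'rV[R]_d))%E.
Proof.
move=> oc sep; apply: le_ereal_inf_tmp => _ [t [t0 Pt] <-].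
rewrite lee_fin leNgt; apply/negP => ts.
have : (packing_measure t (limit_set c : set 'rV[R]_d) < 1)%E by rewrite Pt.
move=> /ereal_inf_lt[_ [G cG <-] sumG].
have P0 i : (0 <= packing_premeasure t (G i))%E.
  apply: le_ereal_inf_tmp => _ [delta /= delta0 <-]; apply: ereal_sup_ubound.
  exists set0, (fun=> 0), (fun=> 1); split; first by split=> //; apply: trivIset_set0.
  by rewrite esum_set0.
have Gfin i : exists2 delta, 0 < delta & (packing_pre t delta (G i) < +oo)%E.
  have : (packing_premeasure t (G i) < +oo)%E.
    apply: (@le_lt_trans _ _ 1%E); last exact: ltry.
    apply: le_trans (ltW sumG);
      have := @nneseries_lim_ge R (fun i => packing_premeasure t (G i)) xpredT 0 i.+1.
    rewrite big_mkord big_ord_recr /= => /(_ (fun _ _ _ => P0 _)); apply: le_trans.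
    by apply: leeDr; apply: sume_ge0.
  by move=> /ereal_inf_lt[_ [delta delta0 <-] h]; exists delta.
(* If [G i] met every chosen descendant of [Q], a point of it in each separated cube would be the
   centre of a disjoint ball, and the packing sums at the exponent [t < s] would exceed the finite
   value of [packing_pre]. *)
have avoid i k (Q : cube k) : Q \in c k -> exists m (Q' : cube m),
    [/\ (k <= m)%N, Q' \in c m, below Q Q' & forall x, cset Q' x -> ~ G i x].
  move=> Qc; apply: contrapT => noavoid.
  have [delta delta0 Gd] := Gfin i.
  have delta10 : 0 < Num.min delta 1 by rewrite lt_min delta0 ltr01.
  have [m [A [rho [km Ac /andP[rho0 rhod] Asep Abig]]]] :=
    sep k Q (fine (packing_pre t delta (G i)) + 1) _ Qc delta10.
  have /choice[x xP] : forall Q' : cube m, exists x, Q' \in A -> cset Q' x /\ G i x.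
    move=> Q'; have [Q'A|] := boolP (Q' \in A); last by exists 0.
    have [Q'c QQ'] := Ac _ Q'A.
    apply: contrapT => /forallNP h; apply: noavoid; exists m, Q'; split => // y yQ' Gy.
    by apply: (h y).
  move: rhod; rewrite le_min => /andP[rhod rho1].
  have := @packing_pre_ge (G i) _ A x t rho delta t0.
  rewrite rho0 rhod => /(_ isT) h.
  have {}h : ((#|A|%:R * rho `^ t)%:E <= packing_pre t delta (G i))%E.
    apply: h => [a /xP[]//|a b aA bA ab].
    by apply: (Asep a b) => //; [case: (xP _ aA)|case: (xP _ bA)].
  have : ((#|A|%:R * rho `^ t)%:E <= (fine (packing_pre t delta (G i)))%:E)%E.
    rewrite fineK// ge0_fin_numE//; apply: le_trans h.
    by rewrite lee_fin mulr_ge0 ?powR_ge0.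
  rewrite lee_fin leNgt => /negP[]; apply: (@lt_le_trans _ _ (#|A|%:R * rho `^ s)).
    by apply: lt_le_trans Abig; rewrite ltrDl.
  by rewrite ler_wpM2l// ger_powR ?rho0// ltW.
have st i (P : {k : nat & {Q : cube k | Q \in c k}}) :
    {P' : {k : nat & {Q : cube k | Q \in c k}} |
      [/\ (tag P < tag P')%N, below (sval (tagged P)) (sval (tagged P')) &
         forall x, cset (sval (tagged P')) x -> ~ G i x]}.
  case: P => k [Q Qc] /=; apply/cid.
  have [m [Q1 [km Q1c QQ1 av]]] := avoid i k Q Qc.
  (* One extra generation makes the levels strictly increase, which gives [i <= lev i]; [m] itself
     may equal [k]. *)
  have [Q2 Q2c Q12] := outcome_desc M2 NM oc (leqnSn m) Q1c.
  exists (existT _ m.+1 (exist _ Q2 Q2c)); split => //=.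
    exact: below_trans QQ1 Q12.
  by move=> x /(cube_set_below M2 (leqnSn m) Q12); apply: av.
pose Q0 : cube 0 := [ffun=> Ordinal (pM_gt0 M2 0 0)].
pose S := fix S i : {k : nat & {Q : cube k | Q \in c k}} :=
  if i is j.+1 then sval (st j (S j)) else existT _ 0%N (exist _ Q0 (outcome_root oc Q0)).
have [] := @nested_point R _ _ _ M2 c (fun i => tag (S i)) (fun i => sval (tagged (S i))) oc.
- by move=> i; case: (tagged (S i)).
- elim=> // i IH; apply: leq_ltn_trans IH _ => /=.
  by case: (st i (S i)) => P [].
- move=> i /=; case: (st i (S i)) => P [/= h1 h2 _].
  by split; [exact: ltnW|].
move=> x [Ex xS]; have [i _ Gx] := cG _ Ex.
have := xS i.+1; rewrite /=; case: (st i (S i)) => P [/= _ _ h3] /h3.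
exact.
Qed.

End PackingLowerBound.

(** * Comparison with the box dimensions *)

Section DimensionInequalities.
Variables (R : realType) (d : nat).
Implicit Types (F : set 'rV[R]_d) (s t tau : R).

Lemma covering_number_ge0 F tau : (0 <= covering_number F tau)%E.
Proof. by apply: le_ereal_inf_tmp => _ [n _ <-]; rewrite lee_fin. Qed.

Lemma covering_number_ge1 F tau : F !=set0 -> (1 <= covering_number F tau)%E.
Proof.
move=> [x Fx]; have := @covering_number_ge R d unit [set tt]%SET (fun=> x) F tau.
by rewrite cards1; apply=> // -[] [].
Qed.

Lemma box_ratio_lt F tau s : 0 < tau < 1 -> (box_ratio F tau < s%:E)%E ->
  (covering_number F tau < (tau `^ (- s))%:E)%E.
Proof.
move=> /andP[tau0 tau1]; rewrite /box_ratio => h.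
have ln0 : 0 < - ln tau by rewrite oppr_gt0 ln_lt0// tau0.
rewrite -(@lte_lne R); last 2 first.
- by rewrite in_itv /= covering_number_ge0 leey.
- by rewrite in_itv /= lee_fin powR_ge0 leey.
rewrite lne_EFin ?powR_gt0// ln_powR mulNr -mulrN EFinM -lte_pdivrMr//.
Qed.

Lemma box_ratio_le F tau (a : R) : 0 < tau < 1 -> 0 < a ->
  (covering_number F tau <= a%:E)%E ->
  (box_ratio F tau <= (ln a / - ln tau)%:E)%E.
Proof.
move=> /andP[tau0 tau1] a0 h; rewrite /box_ratio EFinM.
have ln0 : 0 < - ln tau by rewrite oppr_gt0 ln_lt0// tau0.
apply: lee_wpmul2r; first by rewrite lee_fin invr_ge0 ltW.
rewrite -lne_EFin// lee_lne//; first by rewrite in_itv /= covering_number_ge0 leey.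
by rewrite in_itv /= lee_fin ltW// leey.
Qed.

Lemma box_ratio_ge0 F tau : F !=set0 -> 0 < tau < 1 -> (0 <= box_ratio F tau)%E.
Proof.
move=> F0 /andP[tau0 tau1]; apply: mule_ge0.
  by rewrite lne_ge0 covering_number_ge1.
by rewrite lee_fin invr_ge0 ltW// oppr_gt0 ln_lt0// tau0.
Qed.

Lemma powR_small (e a : R) : 0 < a -> 0 < e ->
  exists2 b, 0 < b & forall tau, 0 < tau < b -> tau `^ a <= e.
Proof.
move=> a0 e0; exists (e `^ a^-1); first exact: powR_gt0.
move=> tau /andP[tau0 taue].
have -> : e = (e `^ a^-1) `^ a by rewrite -powRrM mulVf ?gt_eqF// powRr1// ltW.
by apply: ge0_ler_powR; rewrite ?nnegrE ?powR_ge0 ?(ltW a0) ?(ltW tau0) ?(ltW taue).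
Qed.

Lemma lee_small_fin (x : \bar R) : (forall e, 0 < e -> (x <= e%:E)%E) -> (x <= 0)%E.
Proof. by move=> h; apply: lee_gt_real => e; rewrite lte_fin => /h. Qed.

Lemma hausdorff_pre_ge0 s delta F : (0 <= hausdorff_pre s delta F)%E.
Proof.
apply: le_ereal_inf_tmp => _ [U _ <-]; apply: nneseries_ge0 => i _ _.
by rewrite /diam_pow; case: ifP => // _; apply: poweR_ge0.
Qed.

(** Fewer than [tau^(-s)] sets of diameter at most [tau] have an [s']-sum of at most [tau^(s' - s)],
    which is small with [tau]. Nonemptiness makes the box ratio nonnegative, so that [s] is
    positive; the finite cover is continued by empty sets, which contribute 0. *)
Lemma dimH_le_lower_dimB F : F !=set0 -> (dimH F <= lower_dimB F)%E.
Proof.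
move=> F0; apply: lee_gt_real => s lbs; apply: lee_gt_real => s'; rewrite lte_fin => ss'.
have s0 : 0 < s.
  have [tau tau1 /(le_lt_trans (box_ratio_ge0 F0 tau1))] := limf_einf0_lt_freq lbs ltr01.
  by rewrite lte_fin.
have s'0 : 0 < s' := lt_trans s0 ss'.
apply: ereal_inf_lbound; exists s' => //; split; first exact: ltW.
have pre0 delta : 0 < delta -> hausdorff_pre s' delta F = 0%E.
  move=> delta0; apply/eqP; rewrite eq_le hausdorff_pre_ge0 andbT.
  apply: lee_small_fin => e e0.
  have [b b0 bP] := @powR_small e (s' - s) ltac:(by rewrite subr_gt0) e0.
  have m0 : 0 < Num.min (Num.min delta b) 1 by rewrite !lt_min delta0 b0 ltr01.
  have [tau] := limf_einf0_lt_freq lbs m0.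
  rewrite !lt_min => /andP[tau0 /andP[/andP[taud taub] tau1]] ratio.
  have /ereal_inf_lt[_ [n [U [Utau FU]] <-]] : (covering_number F tau < (tau `^ (- s))%:E)%E.
    by apply: box_ratio_lt ratio; rewrite tau0.
  rewrite lte_fin => nlt.
  pose V (i : nat) : set 'rV[R]_d := if insub i is Some j then U j else set0.
  apply: (@le_trans _ _ (\sum_(i <oo) diam_pow s' (V i))%E).
    apply: ereal_inf_lbound; exists V => //; split=> [i|x /FU[i Ui]].
      rewrite /V; case: insub => [j|]; first by apply: le_trans (Utau j) _; rewrite lee_fin ltW.
      by apply: diam_le => //; exact: ltW.
    by exists (i : nat) => //; rewrite /V valK.
  rewrite (nneseries_split 0 n); last first.
    by move=> i _; rewrite /diam_pow; case: ifP => // _; apply: poweR_ge0.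
  rewrite eseries0 ?adde0; last first.
    move=> i; rewrite add0n => ni _; rewrite /V insubF ?ltnNge ?ni//.
    by rewrite /diam_pow eqxx.
  rewrite add0n big_mkord; apply: (@le_trans _ _ (\sum_(i < n) (tau `^ s')%:E)%E).
    apply: lee_sum => i _; rewrite /V valK /diam_pow; case: ifP => _.
      by rewrite lee_fin powR_ge0.
    rewrite -poweR_EFin; apply: gt0_ler_poweR => //; first exact: ltW.
    - by rewrite in_itv /= diam_ge0 leey.
    - by rewrite in_itv /= lee_fin (ltW tau0) leey.
  rewrite sumEFin sumr_const card_ord lee_fin -[leLHS]mulr_natl.
  apply: (@le_trans _ _ (tau `^ (s' - s))); last by apply: bP; rewrite tau0.
  rewrite powRD_gt0// mulrC ler_pM2l ?powR_gt0//.
  exact: ltW.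
rewrite /hausdorff_measure; apply/eqP; rewrite eq_le; apply/andP; split.
  by apply: ge_ereal_sup => _ [delta delta0 <-]; rewrite pre0.
rewrite -(pre0 1 ltr01); apply: ereal_sup_ubound; exists 1 => //; exact: ltr01.
Qed.


Lemma diam_ecball_le (x : 'rV[R]_d) (rho : R) : 0 <= rho ->
  (diam (ecball x rho) <= (Num.sqrt d%:R * (2 * rho))%:E)%E.
Proof.
move=> rho0; apply: diam_le => [|y z yB zB].
  by rewrite !mulr_ge0 ?sqrtr_ge0.
apply: eucl_dist_le => [|l]; first by rewrite mulr_ge0.
have := le_trans (ler_eucl_dist _ _ l) yB; have := le_trans (ler_eucl_dist _ _ l) zB.
by rewrite !ler_norml => /andP[? ?] /andP[? ?]; apply/andP; split; lra.
Qed.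

Lemma sum_geometric_le (q : R) (k n : nat) : 0 < q < 1 ->
  \sum_(k <= i < n) q ^+ i <= q ^+ k / (1 - q).
Proof.
move=> /andP[q0 q1]; have q1' : 0 < 1 - q by rewrite subr_gt0.
have [nk|kn] := leqP n k.
  by rewrite big_geq// divr_ge0 ?exprn_ge0 ?(ltW q0) ?(ltW q1').
rewrite ler_pdivlMr//.
have -> : (\sum_(k <= i < n) q ^+ i) * (1 - q) = q ^+ k - q ^+ n.
  elim: n kn => // n IH; rewrite ltnS => kn.
  rewrite big_nat_recr//= mulrDl exprS; move: kn; rewrite leq_eqVlt => /predU1P[<-|/IH ->].
    by rewrite big_geq//; ring.
  by ring.
by rewrite gerBl exprn_ge0// ltW.
Qed.

(* The balls of radius in ]2^-(k+1), 2^-k] of a packing have 2^-(k+1)-separated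
   centres. *)
Lemma packing_pre_le F s s' (e : R) (k0 : nat) : 0 < s -> s < s' ->
  (forall tau, 0 < tau < e -> (covering_number F tau <= (tau `^ (- s))%:E)%E) ->
  2^-1 ^+ k0 < e ->
  (packing_pre s' (2^-1 ^+ k0) F <=
   ((Num.sqrt d%:R * 2) `^ s' * (2 `^ s *
     ((2^-1 `^ (s' - s)) ^+ k0 / (1 - 2^-1 `^ (s' - s)))))%:E)%E.
Proof.
move=> s0 ss' cov k0e; have s'0 : 0 < s' := lt_trans s0 ss'.
apply: ge_ereal_sup => v [I [c [rho [[packI triv] ->]]]].
have h0 : 0 < 2^-1 :> R by rewrite invr_gt0.
have h1 : 2^-1 < 1 :> R by rewrite invf_lt1// ltr1n.
have ball0 i : (0 <= diam_pow s' (ecball (c i) (rho i)))%E.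
  by rewrite /diam_pow; case: ifP => // _; apply: poweR_ge0.
rewrite esum_mkcond -nneseries_esumT; last by move=> i; case: ifP.
apply: lime_le; first by apply: is_cvg_nneseries => i _ _; case: ifP.
near=> n; rewrite big_mkord.
have ball_le i : I i -> (diam_pow s' (ecball (c i) (rho i)) <=
    ((Num.sqrt d%:R * 2) `^ s' * rho i `^ s')%:E)%E.
  move=> /packI[_ /andP[rho0 _]]; rewrite -powRM ?mulr_ge0 ?sqrtr_ge0 ?(ltW rho0)//.
  rewrite /diam_pow; case: ifP => _; first by rewrite lee_fin powR_ge0.
  rewrite -poweR_EFin; apply: gt0_ler_poweR; first exact: ltW.
  - by rewrite in_itv /= diam_ge0 leey.
  - by rewrite in_itv /= lee_fin leey andbT !mulr_ge0 ?sqrtr_ge0 ?(ltW rho0).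
  - by apply: le_trans (diam_ecball_le _ _) _; rewrite ?(ltW rho0)// lee_fin mulrA.
have /choice[kk kkP] : forall i, exists k, I i ->
    (k0 <= k)%N /\ 2^-1 ^+ k.+1 < rho i <= 2^-1 ^+ k.
  move=> i; have [Ii|nIi] := pselect (I i); last by exists 0%N.
  have [_ /andP[rho0 rhok0]] := packI _ Ii.
  have [m mP] := half_pow_small rho0.
  have [|k k0k kP] := @locate_scale R (fun k => 2^-1 ^+ k) k0 (rho i) rhok0; last by exists k.
  by exists (maxn k0 m); rewrite ?leq_maxl// mP// leq_maxr.
pose K := (\max_(i < n) kk i).+1.
pose A k := [set i : 'I_n | ((i : nat) \in I) && (kk i == k)]%SET.
have cardA k : (k0 <= k)%N -> #|A k|%:R <= (2^-1 ^+ k.+1) `^ (- s).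
  move=> k0k; rewrite -lee_fin; apply: le_trans (cov (2^-1 ^+ k.+1) _); last first.
    rewrite exprn_gt0//= (le_lt_trans _ k0e)// ler_wiXn2l ?(ltW h0) ?(ltW h1)//.
    exact: leqW.
  apply: (@covering_number_ge_dist _ _ _ _ (fun i : 'I_n => c i)).
    by move=> i; rewrite inE => /andP[/set_mem /packI[]].
  move=> i j; rewrite !inE => /andP[/set_mem Ii /eqP ki] /andP[/set_mem Ij /eqP kj] ij.
  have [_ /andP[+ _]] := kkP _ Ii; rewrite ki => /lt_le_trans; apply.
  rewrite leNgt; apply/negP => lt.
  move/trivIsetP : triv => /(_ i j Ii Ij ij) /seteqP[+ _] => /(_ (c j)); apply.
  split; first exact: ltW.
  rewrite /ecball /= /eucl_dist big1 ?sqrtr0 => [|l _]; last by rewrite subrr expr0n.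
  by have [_ /andP[/ltW]] := packI _ Ij.
rewrite -big_mkcond /=.
apply: (@le_trans _ _ (\sum_(i < n | (i : nat) \in I)
    ((Num.sqrt d%:R * 2) `^ s' * rho i `^ s')%:E)%E).
  by apply: lee_sum => i /set_mem; apply: ball_le.
rewrite sumEFin lee_fin -mulr_sumr ler_wpM2l ?powR_ge0//.
pose q := 2^-1 `^ (s' - s) : R.
have q01 : 0 < q < 1.
  rewrite powR_gt0//=; have := @gt0_ltr_powR R (s' - s) _ 2^-1 1.
  by rewrite powR1; apply; rewrite ?subr_gt0 ?nnegrE.
(* The dyadic class [k] has at most [(2^-(k+1))^(-s)] balls, each contributing at most [(2^-k)^s']:
   together at most [2^s q^k]. *)
apply: (@le_trans _ _ (2 `^ s * \sum_(k0 <= k < K) q ^+ k)); last first.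
  by rewrite ler_pM2l ?powR_gt0//; apply: sum_geometric_le.
apply: (@le_trans _ _ (\sum_(i < n | (i : nat) \in I) \sum_(k0 <= k < K)
    (kk i == k)%:R * (2^-1 ^+ k) `^ s')).
  apply: ler_sum => i /set_mem Ii; have [k0k /andP[rho1 rho2]] := kkP _ Ii.
  rewrite (bigD1_seq (kk i)) ?iota_uniq//=; last first.
    by rewrite mem_index_iota k0k ltnS (leq_bigmax i).
  rewrite eqxx mul1r -[leLHS]addr0; apply: lerD; last first.
    by apply: sumr_ge0 => k _; rewrite mulr_ge0 ?powR_ge0.
  by apply: ge0_ler_powR; rewrite ?nnegrE ?(ltW s'0) ?exprn_ge0 ?(ltW h0)//;
    apply/ltW/(lt_trans _ rho1)/exprn_gt0.
rewrite exchange_big /= mulr_sumr big_nat [leRHS]big_nat; apply: ler_sum => k /andP[k0k _].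
rewrite -mulr_suml.
have -> : \sum_(i < n | (i : nat) \in I) (kk i == k)%:R = #|A k|%:R :> R.
  rewrite -sum1_card natr_sum big_mkcond [RHS]big_mkcond; apply: eq_bigr => i _.
  by rewrite inE; case: (_ \in I); case: eqP.
apply: (@le_trans _ _ ((2^-1 ^+ k.+1) `^ (- s) * (2^-1 ^+ k) `^ s')).
  by rewrite ler_wpM2r ?powR_ge0// cardA.
have pw m (t : R) : (2^-1 ^+ m) `^ t = (2^-1 `^ t) ^+ m.
  by rewrite powR_exprn// ltW.
rewrite !pw /q powRD_gt0// exprMn exprS -!mulrA.
rewrite (_ : 2^-1 `^ (- s) = 2 `^ s); last by rewrite -(@powR_inv1 _ 2)// -powRrM mulN1r opprK.
by rewrite [X in _ * X]mulrC.
Unshelve. all: by end_near. Qed.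

Lemma packing_pre_ge0 s delta F : (0 <= packing_pre s delta F)%E.
Proof.
apply: ereal_sup_ubound; exists set0, (fun=> 0), (fun=> 1).
by split; [split=> //; apply: trivIset_set0|rewrite esum_set0].
Qed.

Lemma packing_premeasure_ge0 s F : (0 <= packing_premeasure s F)%E.
Proof.
apply: le_ereal_inf_tmp => _ [delta _ <-]; exact: packing_pre_ge0.
Qed.

Lemma packing_premeasure0 s : packing_premeasure s (set0 : set 'rV[R]_d) = 0%E.
Proof.
apply/eqP; rewrite eq_le packing_premeasure_ge0 andbT.
apply: (@le_trans _ _ (packing_pre s 1 (set0 : set 'rV[R]_d))).
  by apply: ereal_inf_lbound; exists 1 => //; exact: ltr01.
apply: ge_ereal_sup => v [I [c [rho [[packI _] ->]]]].
rewrite (_ : I = set0) ?esum_set0//.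
by apply/seteqP; split=> // i /packI[].
Qed.

(** The packing measure is at most the premeasure, through the decomposition of [F] into [F] and
    empty sets. The bound of [packing_pre_le] is the tail of a geometric series, hence small. *)
Lemma dimP_le_upper_dimB F : F !=set0 -> (dimP F <= upper_dimB F)%E.
Proof.
move=> F0; apply: lee_gt_real => s ubs; apply: lee_gt_real => s'; rewrite lte_fin => ss'.
have [e0 e00 e0P] := limf_esup0_lt_near ubs.
pose e := Num.min e0 1.
have e_gt0 : 0 < e by rewrite lt_min e00 ltr01.
have ratio tau : 0 < tau < e -> (box_ratio F tau < s%:E)%E.
  by rewrite lt_min => /andP[t0 /andP[te _]]; apply: e0P; rewrite t0.
have cov tau : 0 < tau < e -> (covering_number F tau <= (tau `^ (- s))%:E)%E.
  move=> te; apply/ltW/box_ratio_lt; last exact: ratio.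
  by case/andP: te => ->; rewrite lt_min => /andP[_ ->].
have s0 : 0 < s.
  have t1 : 0 < e / 2 < 1.
    rewrite divr_gt0//= ltr_pdivrMr// mul1r (@le_lt_trans _ _ 1) ?ltr1n//.
    by rewrite ge_min lexx orbT.
  have /(ratio _) : 0 < e / 2 < e by rewrite divr_gt0//= ltr_pdivrMr//; lra.
  by move=> /(le_lt_trans (box_ratio_ge0 F0 t1)).
have s'0 : 0 < s' := lt_trans s0 ss'.
apply: ereal_inf_lbound; exists s' => //; split; first exact: ltW.
have pre0 : packing_premeasure s' F = 0%E.
  apply/eqP; rewrite eq_le packing_premeasure_ge0 andbT.
  apply: lee_small_fin => eta eta0.
  pose q : R := 2^-1 `^ (s' - s).
  have q0 : 0 < q by rewrite powR_gt0 ?invr_gt0.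
  have q1 : q < 1.
    have := @gt0_ltr_powR R (s' - s) _ 2^-1 1.
    by rewrite powR1; apply; rewrite ?subr_gt0 ?nnegrE ?invf_lt1 ?ltr1n.
  pose C := (Num.sqrt d%:R * 2) `^ s' * 2 `^ s / (1 - q) + 1.
  have C0 : 0 < C.
    by rewrite ltr_wpDl// divr_ge0 ?mulr_ge0 ?powR_ge0// subr_ge0 ltW.
  have [k1 k1P] := half_pow_small e_gt0.
  have [k2 k2P] : exists k2, forall k, (k2 <= k)%N -> q ^+ k < eta / C.
    have [b b0 bP] := @powR_small (eta / C / 2) (s' - s) ltac:(by rewrite subr_gt0) ltac:(by
      rewrite !divr_gt0).
    have [k2 k2P] := half_pow_small b0; exists k2 => k /k2P kb.
    apply: (@le_lt_trans _ _ (eta / C / 2)).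
      have := bP (2^-1 ^+ k); rewrite exprn_gt0 ?invr_gt0// kb => /(_ isT).
      by rewrite powR_exprn ?invr_ge0.
    by rewrite ltr_pdivrMr// ltr_pMr ?divr_gt0// ltr1n.
  pose k := maxn k1 k2.
  apply: (@le_trans _ _ (packing_pre s' (2^-1 ^+ k) F)).
    by apply: ereal_inf_lbound; exists (2^-1 ^+ k) => //=; rewrite exprn_gt0 ?invr_gt0.
  apply: le_trans (packing_pre_le s0 ss' cov (k1P k (leq_maxl _ _))) _.
  rewrite lee_fin -/q.
  have /ltW := k2P k (leq_maxr _ _); rewrite ler_pdivlMr// => h.
  apply: le_trans h; set a := _ `^ s'; set b := 2 `^ s.
  rewrite (_ : a * _ = q ^+ k * (C - 1)); last by rewrite /C -/a -/b; ring.
  by rewrite ler_pM2l ?exprn_gt0// gerBl.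
rewrite /packing_measure; apply/eqP; rewrite eq_le; apply/andP; split; last first.
  apply: le_ereal_inf_tmp => _ [G _ <-]; apply: nneseries_ge0 => i _ _.
  exact: packing_premeasure_ge0.
apply: ereal_inf_lbound; exists (fun i => if i == 0%N then F else set0).
  by move=> x Fx; exists 0%N.
by apply: eseries0 => -[|i] _ _; rewrite ?pre0 ?packing_premeasure0.
Qed.

End DimensionInequalities.

(** * Bounds valid for every outcome *)

Section Ratios.
Variable R : realType.
Implicit Types (s a tau x y th : R).

Lemma lt_ln_ratio s a tau : 0 < a -> 0 < tau < 1 ->
  (s < ln a / - ln tau) = (tau `^ (- s) < a).
Proof.
move=> a0 /andP[tau0 tau1].
have ln0 : 0 < - ln tau by rewrite oppr_gt0 ln_lt0// tau0.
by rewrite ltr_pdivlMr// mulrN -mulNr -ln_powR ltr_ln// posrE powR_gt0.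
Qed.

Lemma ln_ratio_lt s a tau : 0 < a -> 0 < tau < 1 ->
  (ln a / - ln tau < s) = (a < tau `^ (- s)).
Proof.
move=> a0 /andP[tau0 tau1].
have ln0 : 0 < - ln tau by rewrite oppr_gt0 ln_lt0// tau0.
by rewrite ltr_pdivrMr// mulrN -mulNr -ln_powR ltr_ln// posrE powR_gt0.
Qed.

(** Used with [th = s / d] on two competing counts at a radius between consecutive scales, to obtain
    a single power of that radius. *)
Lemma min_le_interp x y th : 0 < x -> 0 < y -> 0 <= th <= 1 ->
  Num.min x y <= x `^ th * y `^ (1 - th).
Proof.
move=> x0 y0 /andP[th0 th1]; have m0 : 0 < Num.min x y by rewrite lt_min x0.
rewrite -[leLHS](powRr1 (ltW m0)) -[X in _ `^ X](subrK th) addrC powRD_gt0//.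
apply: ler_pM; rewrite ?powR_ge0//; apply: ge0_ler_powR;
  by rewrite ?nnegrE ?subr_ge0 ?(ltW m0) ?(ltW x0) ?(ltW y0)// ge_min lexx ?orbT.
Qed.

Lemma dimH_ge0 d (F : set 'rV[R]_d) : (0 <= dimH F)%E.
Proof. by apply: le_ereal_inf_tmp => _ [s [s0 _] <-]; rewrite lee_fin. Qed.

Lemma dimP_ge0 d (F : set 'rV[R]_d) : (0 <= dimP F)%E.
Proof. by apply: le_ereal_inf_tmp => _ [s [s0 _] <-]; rewrite lee_fin. Qed.

Lemma box_ratio_le_exp d (F : set 'rV[R]_d) tau s : 0 < tau < 1 ->
  (covering_number F tau <= (tau `^ (- s))%:E)%E -> (box_ratio F tau <= s%:E)%E.
Proof.
move=> tau01; have /andP[tau0 tau1] := tau01;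
  have ln0 : 0 < - ln tau by rewrite oppr_gt0 ln_lt0// tau0.
move=> /(box_ratio_le tau01 (powR_gt0 _ tau0)); rewrite ln_powR mulNr -mulrN mulfK//.
by rewrite gt_eqF.
Qed.

End Ratios.

Section Deterministic.
Variables (R : realType) (d : nat) (M N : nat -> nat).
Hypothesis d0 : (1 <= d)%N.
Hypothesis M2 : forall k, (1 <= k)%N -> (2 <= M k)%N.
Hypothesis NM : forall k, (1 <= k)%N -> (1 <= N k)%N && (N k <= M k ^ d)%N.

Local Notation cube := (cube d M).
Local Notation pM := (pprod M).
Local Notation pN := (pprod N).
Local Notation r := (scale R M 1).
Local Notation cset := (@cube_set d M R _).

Lemma scale01 n : (1 <= n)%N -> 0 < r n < 1.
Proof.
move=> n1; rewrite scale_gt0//= (le_lt_trans (scale_le_exp _ _ _))//.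
by rewrite exprn_ilt1 ?invr_ge0 ?invf_lt1 ?ltr1n// -lt0n.
Qed.

Lemma prodN_gt0 n : 0 < (pN 1 n)%:R :> R.
Proof. by rewrite ltr0n (pN_gt0 NM). Qed.

Lemma N_gt0 n : 0 < (N n.+1)%:R :> R.
Proof. by rewrite ltr0n; have /andP[] := NM (ltn0Sn n). Qed.

Lemma N_root_le n : (N n.+1)%:R `^ d%:R^-1 <= (M n.+1)%:R :> R.
Proof.
have dn0 : (d%:R : R) != 0 by rewrite pnatr_eq0 -lt0n.
have -> : (M n.+1)%:R = ((M n.+1)%:R ^+ d) `^ d%:R^-1 :> R.
  by rewrite -powR_mulrn// -powRrM mulfV// powRr1.
apply: ge0_ler_powR; rewrite ?nnegrE ?exprn_ge0 ?invr_ge0//.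
by rewrite -natrX ler_nat; have /andP[] := NM (ltn0Sn n).
Qed.

Lemma covering_number_cubes n (S : {set cube n}) (F : set 'rV[R]_d)
    (delta : R) (t : nat) : (0 < t)%N ->
  (forall x, F x -> exists2 Q, Q \in S & cset Q x) ->
  Num.sqrt d%:R * r n <= t%:R * delta ->
  (covering_number F delta <= (#|S| * t ^ d)%:R%:E)%E.
Proof.
move=> t0 FS td; apply: (covering_number_boxes (u := @corner R d M n) t0 _ td).
  exact/ltW/scale_gt0.
move=> x /FS[Q QS xQ]; exists Q => // l; have [x1 x2] := xQ l.
by rewrite mxE; split=> //; rewrite -[X in _ + X]mul1r -mulrDl natr1.
Qed.

Section Outcome.
Variable c : forall n, {set cube n}.
Hypothesis oc : outcome N c.
Local Notation E := (limit_set c : set 'rV[R]_d).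

Lemma limit_set_stage n x : E x -> exists2 Q, Q \in c n & cset Q x.
Proof.
move=> Ex; have [Q Qc xQ] := Ex n.+1 isT.
exists (par M2 Q); first exact: (outcome_par M2 oc Qc).
by apply: cube_set_below xQ => //; rewrite (below_par M2)// below_refl.
Qed.

Lemma limit_set_nonempty : E !=set0.
Proof.
have Qc := outcome_root oc ([ffun=> Ordinal (pM_gt0 M2 0 0)] : cube 0).
by have [x Ex _] := limit_set_in_cube R M2 NM oc Qc; exists x.
Qed.

Lemma card_descendants n m (T : {set cube n}) : (n <= m)%N -> T \subset c n ->
  (#|[set Q in c m | [exists P in T, below P Q]]%SET| <= #|T| * pN n.+1 m)%N.
Proof.
move=> nm Tc.
apply: (@leq_trans #|\bigcup_(P in T) [set Q in c m | below P Q]|%SET).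
  apply: subset_leq_card; apply/fintype.subsetP => Q; rewrite inE => /andP[Qc].
  by move=> /exists_inP[P PT PQ]; apply/bigcupP; exists P => //; rewrite inE Qc.
rewrite -sum_nat_const; elim/big_rec2 : _ => [|P k B PT IH]; first by rewrite cards0.
rewrite (leq_trans (leq_card_setU _ _))// leq_add//.
by rewrite (card_outcome_below M2 oc)// (fintype.subsetP Tc).
Qed.

Lemma card_near_anc n m (P : cube n) (Q : cube m) (rho : R) : (n <= m)%N ->
  below P Q ->
  (#|[set Q' in c m | near rho Q Q']%SET| <=
   #|[set P' in c n | near (rho + r n) P P']%SET| * pN n.+1 m)%N.
Proof.
move=> nm PQ; set T := [set P' in c n | _]%SET.
have Tc : T \subset c n by apply/fintype.subsetP => P'; rewrite inE => /andP[].
apply: leq_trans (card_descendants nm Tc).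
apply: subset_leq_card; apply/fintype.subsetP => Q'; rewrite !inE => /andP[Q'c QQ'].
rewrite Q'c; have [P' P'c P'Q'] := outcome_anc M2 oc nm Q'c.
by apply/exists_inP; exists P' => //; rewrite inE P'c; apply: near_anc QQ'.
Qed.

Lemma powR_large (B a : R) : 0 < a -> exists n0, forall n, (n0 <= n)%N ->
  B <= r n `^ (- a).
Proof.
move=> a0; have B0 : 0 < Num.max B 1 by rewrite lt_max ltr01 orbT.
have [b b0 bP] := @powR_small R (Num.max B 1)^-1 a a0 ltac:(by rewrite invr_gt0).
have [n0 n0P] := scale_small M2 b0; exists n0 => n /n0P rb.
have /bP : 0 < r n < b by rewrite scale_gt0.
rewrite powRN => h; apply: (@le_trans _ _ (Num.max B 1)); first by rewrite le_max lexx.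
by rewrite -[leLHS]invrK lef_pV2 ?posrE ?invr_gt0// powR_gt0 ?scale_gt0.
Qed.

(** The uniform measure on all chosen cubes of level [m] is used. For [r_(n+1) < rho <= r_n], a
    [rho]-neighbourhood meets, up to a constant, at most the smaller of [(rho / r_(n+1))^d] and
    [N_(n+1)] cubes of level [n + 1]. The weight [s / d] turns this into [rho^s (r_(n+1)
    N_(n+1)^(1/d))^(-s) N_(n+1)], at most [rho^s P_(n+1)]. *)
Lemma tstar_le_dimH : (tstar R d M N <= dimH E)%E.
Proof.
apply: lee_lt_real => s; have [s0 _|s0] := leP s 0.
  by apply: le_trans (dimH_ge0 _); rewrite lee_fin.
move=> /limn_einf_gt_near[n1 n1P]; pose n0 := maxn 1 n1.
have dR0 : 0 < d%:R :> R by rewrite ltr0n.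
have PP n : (n0 <= n)%N -> (r n.+1 * (N n.+1)%:R `^ d%:R^-1) `^ (- s) < (pN 1 n)%:R.
  rewrite geq_max => /andP[n1' /n1P]; rewrite lte_fin.
  have -> : - ln (r n.+1) - d%:R^-1 * ln (N n.+1)%:R = - ln (r n.+1 * (N n.+1)%:R `^ d%:R^-1).
    by rewrite lnM ?posrE ?scale_gt0 ?powR_gt0 ?N_gt0// ln_powR opprD.
  rewrite lt_ln_ratio ?prodN_gt0// mulr_gt0 ?scale_gt0 ?powR_gt0 ?N_gt0//=.
  have /andP[_] := scale01 n1'; apply: le_lt_trans.
  rewrite (scale_mul R M2 (leqnSn n)) /pprod big_nat1 mulrC ler_pM2r ?scale_gt0//.
  exact: N_root_le.
(* Places the weight [s / d] in [0, 1]. It holds because [P_n] is at most [r_n^(-d)] while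
   [r_(n+1) N_(n+1)^(1/d)] is at most [r_n]. *)
have sd : s < d%:R.
  have n01 : (1 <= n0)%N by rewrite leq_maxl.
  rewrite ltNge; apply/negP => ds.
  have := PP n0 (leqnn _); apply/negP; rewrite -leNgt.
  have /andP[r0 r1] := scale01 n01.
  apply: (@le_trans _ _ (r n0 `^ (- d%:R))).
    rewrite powR_invn ?(ltW r0)// /scale exprVn invrK -natrX ler_nat.
    exact: pN_le_pM.
  apply: (@le_trans _ _ (r n0 `^ (- s))).
    by apply: ger_powR; rewrite ?r0 ?(ltW r1)// lerN2.
  rewrite !powRN lef_pV2 ?posrE ?powR_gt0 ?mulr_gt0 ?scale_gt0 ?powR_gt0 ?N_gt0//.
  apply: ge0_ler_powR; rewrite ?nnegrE ?(ltW s0) ?(ltW r0)//.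
    by rewrite mulr_ge0 ?powR_ge0// ltW ?scale_gt0.
  rewrite (scale_mul R M2 (leqnSn n0)) /pprod big_nat1 mulrC ler_pM2r ?scale_gt0//.
  exact: N_root_le.
(* 13 serves two counts: it bounds [8 u + 3] by [13 u] for [u >= 1], and equals [2 * 6 + 1] for the
   neighbours within [6 * r n]. Radii stop at [r n0] because [PP] starts at [n0]. *)
apply: (@dimH_ge _ _ _ _ M2 NM c s (13 ^+ d) (r n0)) => //; rewrite ?exprn_gt0 ?scale_gt0//.
move=> m0; exists (maxn m0 n0.+1), (c (maxn m0 n0.+1)).
set m := maxn m0 n0.+1; split => //; rewrite ?leq_maxl ?leq_pmull//.
move=> Q rho Qc rm rn0.
have [|n n0n /andP[rn1 rn]] := locate_scale rn0.
  by have [k kP] := scale_small M2 (lt_trans (scale_gt0 R M2 m) rm);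
    exists (maxn n0 k); rewrite ?leq_maxl// kP// leq_maxr.
have nm : (n < m)%N.
  rewrite ltnNge; apply/negP => mn.
  by have := lt_le_trans rm rn; rewrite ltNge scale_le.
have [P Pc PQ] := outcome_anc M2 oc nm Qc.
have rho0 : 0 < rho := lt_trans (scale_gt0 R M2 m) rm.
have r0 := scale_gt0 R M2 n.+1.
pose u := rho / r n.+1.
have u1 : 1 <= u by rewrite ler_pdivlMr// mul1r ltW.
have cT : #|[set P' in c n.+1 | near (4 * rho + r n.+1) P P']%SET|%:R <=
    13 ^+ d * Num.min (u ^+ d) (N n.+1)%:R.
  rewrite minr_pMr ?exprn_ge0// le_min; apply/andP; split.
    apply: (@le_trans _ _ #|[set P' | near (4 * rho + r n.+1) P P']%SET|%:R).
      by rewrite ler_nat; apply: subset_leq_card; apply/fintype.subsetP => P';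
        rewrite !inE => /andP[].
    apply: le_trans (card_near M2 _ _) _; first by rewrite addr_ge0 ?mulr_ge0 ?ltW.
    rewrite (_ : 2 * _ / _ + 1 = 8 * u + 3); last by rewrite /u; field; rewrite gt_eqF.
    by rewrite -exprMn lerXn2r ?nnegrE//; lra.
  have nn : (n <= n.+1)%N by [].
  have [P1 P1c P1P] := outcome_anc M2 oc nn Pc.
  apply: (@le_trans _ _ (#|[set P' in c n | near (4 * rho + r n.+1 + r n) P1 P']%SET| * pN
    n.+1 n.+1)%N%:R).
    by rewrite ler_nat; apply: card_near_anc.
  rewrite /pprod big_nat1 natrM ler_wpM2r//.
  apply: (@le_trans _ _ #|[set P' | near (6 * r n) P1 P']%SET|%:R).
    rewrite ler_nat; apply: subset_leq_card; apply/fintype.subsetP => P';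
      rewrite !inE => /andP[_].
    by apply: near_le; have := scale_le R M2 nn; lra.
  have rn' := scale_gt0 R M2 n.
  apply: le_trans (card_near M2 _ _) _; first by rewrite mulr_ge0 ?ltW.
  by rewrite (_ : 2 * (6 * r n) / r n + 1 = 13)//; field; rewrite gt_eqF.
apply: (@le_trans _ _ (#|[set P' in c n.+1 | near (4 * rho + r n.+1) P P']%SET| * pN n.+2
  m)%N%:R).
  by rewrite ler_nat; apply: card_near_anc.
rewrite (card_outcome M2 oc) (@pprod_cat N 1 n.+1 m)// pprod_recr//.
rewrite !natrM !mulrA ler_wpM2r//; apply: le_trans cT _.
rewrite -!mulrA ler_wpM2l ?exprn_ge0//.
apply: le_trans (min_le_interp (th := s / d%:R) _ _ _) _.
- by rewrite exprn_gt0// (lt_le_trans ltr01).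
- exact: N_gt0.
- by rewrite divr_ge0 ?ltW//= ltr_pdivrMr// mul1r.
rewrite -powR_mulrn ?(le_trans ler01 u1)// -powRrM mulrCA divff ?gt_eqF// mulr1.
rewrite powRD_gt0 ?N_gt0// powRr1// [leRHS]mulrA [X in _ * X]mulrC mulrA ler_pM2r ?N_gt0//.
apply: le_trans (ler_wpM2l (powR_ge0 rho s) (ltW (PP n n0n))).
rewrite powRM ?powR_ge0 ?(ltW r0)// -powRrM (_ : d%:R^-1 * - s = - (s / d%:R)); last by ring.
rewrite mulrA ler_wpM2r ?powR_ge0// /u powRM ?invr_ge0 ?(ltW r0) ?(ltW rho0)//.
by rewrite powRN -[in (r n.+1)^-1]powR_inv1 ?(ltW r0)// -powRrM mulN1r -powRN.
Qed.

End Outcome.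
End Deterministic.

Lemma dimA_le_dim (R : realType) (d : nat) (F : set 'rV[R]_d) :
  (dimA F <= d%:R%:E)%E.
Proof.
apply: ereal_inf_lbound; exists d%:R => //; split => //.
have sd0 : 0 <= Num.sqrt d%:R :> R := sqrtr_ge0 _.
exists ((2 * Num.sqrt d%:R + 1) ^+ d); split; first by rewrite exprn_gt0// ltr_wpDl// mulr_ge0.
move=> r rho r0 rrho _; apply: ge_ereal_sup => _ [x Fx <-].
have rho0 : 0 < rho := lt_trans r0 rrho.
have q1 : 1 <= rho / r by rewrite ler_pdivlMr// mul1r ltW.
have q0 : 0 <= rho / r := le_trans ler01 q1.
pose t := (Num.truncn (Num.sqrt d%:R * (2 * rho) / r)).+1.
apply: (@le_trans _ _ (#|[set: unit]%SET| * t ^ d)%:R%:E); last first.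
  rewrite cardsT card_unit mul1n lee_fin powR_mulrn// -exprMn natrX.
  have tle : t%:R <= (2 * Num.sqrt d%:R + 1) * (rho / r).
    have y0 : 0 <= Num.sqrt d%:R * (2 * rho) / r.
      by rewrite divr_ge0 ?mulr_ge0 ?(ltW rho0) ?(ltW r0).
    have := truncn_le (Num.sqrt d%:R * (2 * rho) / r); rewrite y0 => h.
    have -> : t%:R = (Num.truncn (Num.sqrt d%:R * (2 * rho) / r))%:R + 1 :> R by rewrite natr1.
    rewrite [leRHS]mulrDl mul1r; apply: lerD => //; apply: le_trans h _.
    by rewrite le_eqVlt; apply/orP; left; apply/eqP; ring.
  by rewrite lerXn2r// nnegrE// (le_trans _ tle).
apply: (@covering_number_boxes _ _ _ _ (fun=> \row_l (x 0 l - rho)) _ _ (2 * rho)) => //.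
- by rewrite mulr_ge0 ?ltW.
- by rewrite -ler_pdivrMr// ltW// truncnS_gt.
move=> y [_ xy]; exists tt => // l; rewrite mxE.
have := le_trans (ler_eucl_dist x y l) xy.
by rewrite ler_norml => /andP[? ?]; split; lra.
Qed.

Section Deterministic.
Variables (R : realType) (d : nat) (M N : nat -> nat).
Hypothesis d0 : (1 <= d)%N.
Hypothesis M2 : forall k, (1 <= k)%N -> (2 <= M k)%N.
Hypothesis NM : forall k, (1 <= k)%N -> (1 <= N k)%N && (N k <= M k ^ d)%N.

Local Notation cube := (cube d M).
Local Notation pM := (pprod M).
Local Notation pN := (pprod N).
Local Notation r := (scale R M 1).
Local Notation cset := (@cube_set d M R _).

Section Outcome.
Variable c : forall n, {set cube n}.
Hypothesis oc : outcome N c.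
Local Notation E := (limit_set c : set 'rV[R]_d).

(** An integer above the Euclidean diameter of the unit cube: cutting a cube of side [r n] into
    [D ^ d] pieces brings the diameter down to at most [r n]. *)
Let D := (Num.truncn (Num.sqrt d%:R : R)).+1.

Let D_ge : Num.sqrt d%:R <= D%:R :> R.
Proof. by rewrite ltW// truncnS_gt. Qed.

Lemma covering_number_stage n (delta : R) (t : nat) : (0 < t)%N ->
  Num.sqrt d%:R * r n <= t%:R * delta ->
  (covering_number E delta <= (pN 1 n * t ^ d)%:R%:E)%E.
Proof.
move=> t0 td; rewrite -(card_outcome M2 oc).
by apply: (covering_number_cubes M2 t0 _ td) => x /(limit_set_stage M2 oc n).
Qed.

Lemma lower_dimB_le_s1 : (lower_dimB E <= s1 R M N)%E.
Proof.
apply: lee_gt_real => s s1s; apply: lee_gt_real => s'; rewrite lte_fin => ss'.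
have [n1 n1P] := @powR_large R M M2 (D ^ d)%:R (s' - s) ltac:(by rewrite subr_gt0).
apply: limf_einf0_le => e e0; have [n2 n2P] := scale_small M2 e0.
have [n] := limn_einf_lt_freq s1s (maxn 1 (maxn n1 n2)).
rewrite !geq_max => /and3P[n_1 n_n1 n_n2]; have r01 := scale01 R M2 n_1.
have r0 := scale_gt0 R M2 n.
rewrite lte_fin ln_ratio_lt ?(prodN_gt0 R NM)// => Pn.
exists (r n); first by rewrite r0 n2P.
apply: box_ratio_le_exp => //.
apply: le_trans (@covering_number_stage n _ D _ _) _ => //.
  by rewrite ler_pM2r.
rewrite lee_fin natrM (_ : - s' = - s + - (s' - s)); last by ring.
rewrite powRD_gt0//; apply: ler_pM => //; first exact: ltW.
exact: n1P.
Qed.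

(** Two coverings compete at [r_(n+1) < tau <= r_n]: subdivided cubes of level [n], about
    [P_n (r_n / tau)^d] pieces, and the cubes of level [n + 1]. Interpolated, the smaller is up to a
    constant [tau^(-s) P_(n+1)] times the power [s] of the critical scale [r_n N_(n+1)^(-1/d)], and
    [P_(n+1)] times that power is at most 1. *)
Lemma upper_dimB_le_s2 : (upper_dimB E <= s2 R d M N)%E.
Proof.
apply: lee_gt_real => s s2s; apply: lee_gt_real => s'; rewrite lte_fin => ss'.
have [n1 n1P] := limn_esup_lt_near s2s; pose n0 := maxn 1 n1.
have dR0 : 0 < d%:R :> R by rewrite ltr0n.
have base n : (n0 <= n)%N -> 0 < r n * (N n.+1)%:R `^ (- d%:R^-1) < 1.
  rewrite geq_max => /andP[n_1 _]; have /andP[r0 r1] := scale01 R M2 n_1.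
  rewrite mulr_gt0 ?powR_gt0 ?(N_gt0 R NM)//=; apply: le_lt_trans r1.
  rewrite ler_piMr ?(ltW r0)// powRN invf_le1 ?powR_gt0 ?(N_gt0 R NM)//.
  apply: (@le_trans _ _ ((N n.+1)%:R `^ 0)); first by rewrite powRr0.
  apply: ler_powR; last by rewrite invr_ge0.
  by rewrite ler1n; have /andP[] := NM (ltn0Sn n).
have PP n : (n0 <= n)%N -> (pN 1 n.+1)%:R < (r n * (N n.+1)%:R `^ (- d%:R^-1)) `^ (- s).
  move=> n0n; have := n0n; rewrite geq_max => /andP[_ /n1P]; rewrite lte_fin.
  have -> : - ln (r n) + d%:R^-1 * ln (N n.+1)%:R = - ln (r n * (N n.+1)%:R `^ (- d%:R^-1)).
    by rewrite lnM ?posrE ?scale_gt0 ?powR_gt0 ?(N_gt0 R NM)// ln_powR mulNr opprB addrC.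
  by rewrite ln_ratio_lt ?(prodN_gt0 R NM) ?base.
have s0 : 0 < s.
  rewrite ltNge; apply/negP => sle0; have := PP n0 (leqnn _); apply/negP; rewrite -leNgt.
  apply: (@le_trans _ _ 1); last by rewrite ler1n (pN_gt0 NM).
  have /andP[b0 b1] := base n0 (leqnn _).
  apply: (@le_trans _ _ ((r n0 * (N n0.+1)%:R `^ (- d%:R^-1)) `^ 0)); last by rewrite powRr0.
  by apply: ger_powR; rewrite ?b0 ?(ltW b1)// oppr_ge0.
pose C : R := (2 * D%:R) ^+ d.
have C1 : 1 <= C by rewrite exprn_ege1// -natrM ler1n.
have covs tau : 0 < tau -> tau <= r n0 ->
    (covering_number E tau <= (C * tau `^ (- s))%:E)%E.
  move=> tau0 taur; have [|n n0n /andP[rn1 rn]] := locate_scale taur.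
    by have [k kP] := scale_small M2 tau0; exists (maxn n0 k);
      rewrite ?leq_maxl// kP// leq_maxr.
  have rn0 := scale_gt0 R M2 n.
  have tau_inv : (tau^-1) `^ s = tau `^ (- s).
    by rewrite -(powR_inv1 (ltW tau0)) -powRrM mulN1r.
  pose u := r n / tau; have u1 : 1 <= u by rewrite ler_pdivlMr// mul1r.
  have u0 : 0 <= u := le_trans ler01 u1.
  have cov1 : (covering_number E tau <= (C * ((pN 1 n)%:R * u ^+ d))%:E)%E.
    pose t := (D * (Num.truncn u).+1)%N.
    have tu : t%:R <= 2 * D%:R * u.
      rewrite natrM [2 * _]mulrC -mulrA ler_wpM2l//.
      have -> : (Num.truncn u).+1%:R = (Num.truncn u)%:R + 1 :> R by rewrite natr1.
      by have := truncn_le u; rewrite u0 => h; have : (Num.truncn u)%:R <= u by []; lra.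
    apply: le_trans (@covering_number_stage n _ t _ _) _ => //.
      rewrite natrM -mulrA; apply: ler_pM => //; first by rewrite ltW.
      by rewrite -ler_pdivrMr// ltW// truncnS_gt.
    rewrite lee_fin natrM mulrCA ler_wpM2l// natrX -exprMn.
    by rewrite lerXn2r// nnegrE// (le_trans _ tu).
  have cov2 : (covering_number E tau <= (C * ((pN 1 n)%:R * (N n.+1)%:R))%:E)%E.
    apply: le_trans (@covering_number_stage n.+1 _ D _ _) _ => //.
      by apply: ler_pM => //; rewrite ltW// scale_gt0.
    rewrite lee_fin pprod_recr// natrM [C * _]mulrC natrM ler_wpM2l//.
    by rewrite natrX lerXn2r ?nnegrE ?mulr_ge0// ler_peMl// ler1n.
  (* Beyond [d] the weight would leave [0, 1], but the first covering alone suffices: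
     [P_n r_n^d <= 1] gives [tau^(-d)], at most [tau^(-s)]. *)
  have [sd|ds] := leP s d%:R.
    have : (covering_number E tau <= (C * ((pN 1 n)%:R * Num.min (u ^+ d) (N n.+1)%:R))%:E)%E.
      by have [?|?] := leP (u ^+ d) (N n.+1)%:R.
    move=> /le_trans; apply; rewrite lee_fin ler_wpM2l ?(le_trans ler01 C1)//.
    have th : 0 <= s / d%:R <= 1 by rewrite divr_ge0 ?(ltW s0)//= ler_pdivrMr// mul1r.
    apply: le_trans (ler_wpM2l _ (min_le_interp _ _ th)) _ => //.
    - by rewrite exprn_gt0// (lt_le_trans ltr01).
    - exact: (N_gt0 R NM).
    have -> : (u ^+ d) `^ (s / d%:R) = u `^ s.
      by rewrite -powR_mulrn// -powRrM mulrCA divff ?gt_eqF// mulr1.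
    rewrite powRD_gt0 ?(N_gt0 R NM)// powRr1//.
    rewrite (_ : _ * (u `^ s * _) = (pN 1 n.+1)%:R * (u `^ s * (N n.+1)%:R `^ (- (s /
      d%:R)))); last first.
      by rewrite pprod_recr// natrM; ring.
    have bs := ltW (PP n n0n); have /andP[b0 _] := base n n0n.
    apply: le_trans (ler_wpM2r _ bs) _; first by rewrite mulr_ge0 ?powR_ge0.
    rewrite powRN powRM ?powR_ge0 ?(ltW rn0)// -powRrM mulNr [d%:R^-1 * s]mulrC.
    rewrite /u powRM ?invr_ge0 ?(ltW rn0) ?(ltW tau0)// tau_inv.
    set a := r n `^ s; set b := _ `^ (- (s / d%:R)).
    have a0 : a != 0 by rewrite gt_eqF// powR_gt0.
    have bb0 : b != 0 by rewrite gt_eqF// powR_gt0 ?(N_gt0 R NM).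
    by rewrite le_eqVlt; apply/orP; left; apply/eqP; field; rewrite a0 bb0.
  apply: le_trans cov1 _; rewrite lee_fin ler_wpM2l ?(le_trans ler01 C1)//.
  apply: (@le_trans _ _ (tau^-1 ^+ d)).
    rewrite /u exprMn mulrA ler_piMl ?exprn_ge0 ?invr_ge0 ?(ltW tau0)//.
    rewrite /scale exprVn ler_pdivrMr ?mul1r ?exprn_gt0 ?ltr0n ?(pM_gt0 M2)//.
    by rewrite -natrX ler_nat (pN_le_pM NM).
  rewrite -powR_mulrn ?invr_ge0 ?(ltW tau0)// -tau_inv.
  apply: ler_powR; last exact: ltW.
  rewrite invf_ge1// (le_trans taur)//; exact: scale_le1.
have [b b0 bP] := @powR_small R C^-1 (s' - s) ltac:(by rewrite subr_gt0) ltac:(by rewrite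
  invr_gt0 (lt_le_trans ltr01)).
apply: (@limf_esup0_le _ _ _ (Num.min b (r n0))); first by rewrite lt_min b0 scale_gt0.
move=> tau /andP[tau0]; rewrite lt_min => /andP[taub taur].
have r01 : r n0 < 1 by have /andP[] := scale01 R M2 (leq_maxl 1 n1 : (1 <= n0)%N).
apply: box_ratio_le_exp; first by rewrite tau0 (lt_trans taur).
apply: le_trans (covs _ tau0 (ltW taur)) _; rewrite lee_fin.
rewrite (_ : - s' = - (s' - s) + - s); last by ring.
rewrite powRD_gt0// ler_wpM2r ?powR_ge0// powRN -[leLHS]invrK lef_pV2 ?posrE ?invr_gt0
  ?powR_gt0 ?(lt_le_trans ltr01 C1)//.
by apply: bP; rewrite tau0.
Qed.


(* [s'] is a box dimension seen at the scales [r n / L], for infinitely many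
   [n], inside each cube of the construction. *)
Lemma dimP_ge_boxes (s s' : R) : 0 <= s -> s < s' ->
  (forall k (Q : cube k), Q \in c k -> exists2 kappa : R, 0 < kappa &
     forall n0, exists n L, [/\ (n0 <= n)%N, (1 <= L <= M n.+1)%N &
       kappa * (r n / L%:R) `^ (- s') <=
         #|[set box L Q' | Q' in [set Q' in c n.+1 | below Q Q']]%SET|%:R]) ->
  (s%:E <= dimP E)%E.
Proof.
move=> s0 ss' H; apply: (dimP_ge d0 M2 NM oc) => k Q B delta Qc delta0.
have [kappa kappa0 HQ] := H k Q Qc.
(* Collects the losses: [3 ^+ d] from separation, [2^s] from halving the gap into a radius, and
   [kappa]. The spare power [s' - s] of the scale outgrows it. *)
pose K := B * 2 `^ s * (3 ^+ d) / kappa.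
have [n1 n1P] := @powR_large R M M2 K (s' - s) ltac:(by rewrite subr_gt0).
have [n2 n2P] := scale_small M2 delta0.
have [n [L [nn /andP[L0 LM] boxes]]] := HQ (maxn k (maxn n1 n2)).
move: nn; rewrite !geq_max => /and3P[kn n1n n2n].
have LM' : (1 <= L <= M n.+1)%N by rewrite L0.
have [A [AS cA Asep]] := separated_subset R M2 [set Q' in c n.+1 | below Q Q']%SET LM'.
have L0R : 1 <= L%:R :> R by rewrite ler1n.
have L0R' : 0 < L%:R :> R by rewrite ltr0n.
have rn0 := scale_gt0 R M2 n.
pose g := r n / L%:R; have g0 : 0 < g by rewrite divr_gt0.
have gr : g <= r n by rewrite ler_pdivrMr// ler_peMr// ltW.
exists n.+1, A, (g / 2); split.
- exact: leqW.
- by move=> Q' /(fintype.subsetP AS); rewrite inE => /andP[].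
- rewrite divr_gt0//= ler_pdivrMr// (le_trans gr)// (le_trans (ltW (n2P _ n2n)))// ler_peMr
  ?(ltW delta0)// ler1n//.
- move=> Q1 Q2 x1 x2 Q1A Q2A Q12 xQ1 xQ2; have [l h] := Asep _ _ _ _ Q1A Q2A Q12 xQ1 xQ2.
  by exists l; apply: le_lt_trans h; rewrite -/g; lra.
have {}cA : kappa * g `^ (- s') <= 3 ^+ d * #|A|%:R.
  by apply: le_trans boxes _; rewrite -natrX -natrM ler_nat.
have gK : K <= g `^ (- (s' - s)).
  apply: le_trans (n1P _ n1n) _; rewrite !powRN lef_pV2 ?posrE ?powR_gt0//.
  by apply: ge0_ler_powR; rewrite ?nnegrE ?subr_ge0 ?(ltW g0) ?(ltW rn0) ?(ltW ss').
have gs := powR_gt0 s g0.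
have {}cA : kappa * g `^ (- (s' - s)) <= 3 ^+ d * (#|A|%:R * g `^ s).
  rewrite (_ : - (s' - s) = - s' + s); last by ring.
  by rewrite powRD_gt0// !mulrA ler_pM2r.
have {}cA : B * 2 `^ s * (3 ^+ d) <= 3 ^+ d * (#|A|%:R * g `^ s).
  apply: le_trans cA; apply: le_trans (ler_wpM2l (ltW kappa0) gK).
  by rewrite /K mulrCA divff ?mulr1// gt_eqF.
move: cA; rewrite mulrC ler_pM2l ?exprn_gt0// => cA.
have p2 : 0 < 2 `^ s :> R by rewrite powR_gt0.
rewrite powRM ?invr_ge0 ?(ltW g0)// -[in 2^-1](@powR_inv1 _ 2)// -powRrM mulN1r powRN mulrA.
by rewrite ler_pdivlMr.
Qed.

(** With [L = M n.+1] the boxes are the subcubes themselves, all [P(k+1, n+1)] of which are occupied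
    below [Q] whatever the outcome; [kappa] is [1 / P_k] because the count is taken inside one cube
    of level [k]. *)
Lemma sstar_le_dimP : (sstar R M N <= dimP E)%E.
Proof.
apply: lee_lt_real => s; have [s0 _|s0] := ltP s 0.
  by apply: le_trans (dimP_ge0 _); rewrite lee_fin ltW.
move=> ss; have [s' ss' s's] : exists2 s', s < s' & (s'%:E < sstar R M N)%E.
  case: (sstar R M N) ss => [t| |] // st.
    by rewrite lte_fin in st; exists ((s + t) / 2); rewrite ?lte_fin; lra.
  by exists (s + 1); [rewrite ltrDl|exact: ltry].
apply: dimP_ge_boxes ss' _ => // k Q Qc.
have Pk := prodN_gt0 R NM k.
exists (pN 1 k)%:R^-1; first by rewrite invr_gt0.
move=> n0; have [[|n]] := limn_esup_gt_freq s's (maxn k n0).+1; rewrite ?ltn0// ltnS geq_max.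
move=> /andP[kn n0n]; have r01 := scale01 R M2 (ltn0Sn n).
rewrite lte_fin lt_ln_ratio ?(prodN_gt0 R NM)// => Pn.
exists n, (M n.+1); split => //; first by rewrite leqnn andbT (leq_trans _ (M2 _)).
rewrite card_imset; last exact: box_full_inj.
have kn1 : (k <= n.+1)%N by rewrite leqW.
rewrite (card_outcome_below M2 oc)// ler_pdivrMl// -natrM -(@pprod_cat N 1 k n.+1)//.
apply: le_trans (ltW Pn); rewrite (scale_mul R M2 (leqnSn n)) /pprod big_nat1 mulrC mulKf//.
by rewrite gt_eqF// ltr0n (leq_trans _ (M2 _)).
Qed.

(** Around a point of [E] in [Q], the ball of radius [sqrt d * r n] contains [Q], and separated
    subcubes of [Q] give points of [E] that require one covering set each. With an Assouad exponent
    [t < s], [X^s] would be bounded by a multiple of [X^t] for scale ratios [X] as large as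
    desired. *)
Lemma dimA_ge_boxes (s kappa : R) : 0 < kappa ->
  (forall B : R, exists n p (Q : cube n) L, [/\ (n <= p)%N, Q \in c n, (1 <= L <= M p.+1)%N,
     B <= r n / (r p / L%:R) & kappa * (r n / (r p / L%:R)) `^ s <=
         #|[set box L Q' | Q' in [set Q' in c p.+1 | below Q Q']]%SET|%:R]) ->
  (s%:E <= dimA E)%E.
Proof.
move=> kappa0 H; apply: le_ereal_inf_tmp => _ [t [t0 [C [C0 Ct]]] <-].
rewrite lee_fin leNgt; apply/negP => ts.
have sd1 : 1 <= Num.sqrt d%:R :> R by rewrite -[leLHS]sqrtr1 ler_wsqrtr// ler1n.
have sd0 := lt_le_trans ltr01 sd1.
pose K := 3 ^+ d * C * Num.sqrt d%:R `^ t / kappa.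
have K0 : 0 < K by rewrite divr_gt0 ?mulr_gt0 ?exprn_gt0 ?powR_gt0.
(* The bound 2 puts the small radius [g] below [rho]; the other bound yields
   [X^(s - t) >= 2 * K > K], the contradiction. *)
have [n [p [Q [L [np Qc LM]]]]] := H (Num.max 2 ((2 * K) `^ (s - t)^-1)).
rewrite ge_max; set X := r n / _ => /andP[X2 XK] boxes.
have /andP[L0 _] := LM.
have rn0 := scale_gt0 R M2 n; have rp0 := scale_gt0 R M2 p.
pose g := r p / L%:R; have g0 : 0 < g by rewrite divr_gt0// ltr0n.
have X0 : 0 < X by rewrite divr_gt0.
have [A [AS cA Asep]] := separated_subset R M2 [set Q' in c p.+1 | below Q Q']%SET LM.
have [x Ex xQ] := limit_set_in_cube R M2 NM oc Qc.
pose rho := Num.sqrt d%:R * r n.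
have gX : r n = X * g by rewrite /X divfK ?gt_eqF.
have grho : g < rho.
  rewrite /rho gX mulrA ltr_pMl// (lt_le_trans (ltr1n _ 2 : _))//.
  by rewrite (le_trans X2)// ler_peMl// ltW.
have rho1 : rho <= Num.sqrt d%:R by rewrite ler_piMr ?(ltW sd0)// scale_le1.
have := Ct g rho g0 grho rho1.
apply/negP; rewrite -ltNge;
  apply: (@lt_le_trans _ _ (covering_number (E `&` ecball x rho) g)); last first.
  by apply: ereal_sup_ubound; exists x.
have AE Q' : Q' \in A -> Q' \in c p.+1 /\ below Q Q'.
  by move=> /(fintype.subsetP AS); rewrite inE => /andP[].
have /choice[y yP] : forall Q' : cube p.+1, exists y, Q' \in A -> E y /\ cset Q' y.
  move=> Q'; have [/AE[Q'c _]|] := boolP (Q' \in A); last by exists 0.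
  by have [y Ey yQ'] := limit_set_in_cube R M2 NM oc Q'c; exists y.
apply: (@lt_le_trans _ _ #|A|%:R%:E); last first.
  apply: (covering_number_ge (x := y)) => [Q' Q'A|Q1 Q2 Q1A Q2A Q12].
    have [Ey yQ'] := yP _ Q'A; split=> //.
    have [_ QQ'] := AE _ Q'A.
    apply: eucl_dist_le; first exact: ltW.
    move=> l; have [a1 a2] := cube_set_below M2 (leqW np) QQ' yQ' l.
    have [b1 b2] := xQ l; rewrite -natr1 mulrDl mul1r in a2 b2.
    by rewrite ler_norml; apply/andP; split; lra.
  by apply: (Asep Q1 Q2) => //; [case: (yP _ Q1A)|case: (yP _ Q2A)].
rewrite lte_fin -(@ltr_pM2l _ (3 ^+ d)) ?exprn_gt0//.
apply: (@lt_le_trans _ _ (kappa * X `^ s)); last first.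
  by apply: le_trans boxes _; rewrite -natrX -natrM ler_nat.
have -> : rho / g = Num.sqrt d%:R * X by rewrite /rho gX mulrA mulfK ?gt_eqF.
rewrite powRM ?(ltW sd0) ?(ltW X0)//.
rewrite (_ : 3 ^+ d * _ = kappa * (K * X `^ t)); last first.
  by rewrite /K; field; rewrite gt_eqF.
rewrite ltr_pM2l// (_ : s = (s - t) + t); last by ring.
rewrite powRD_gt0// ltr_pM2r ?powR_gt0//.
apply: (@lt_le_trans _ _ (2 * K)); first by rewrite ltr_pMl// ltr1n.
have st : 0 < s - t by rewrite subr_gt0.
apply: (@le_trans _ _ (((2 * K) `^ (s - t)^-1) `^ (s - t))).
  by rewrite -powRrM mulVf ?gt_eqF// powRr1// mulr_ge0// ltW.
by apply: ge0_ler_powR; rewrite ?nnegrE ?powR_ge0 ?(ltW st) ?(ltW X0).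
Qed.

Lemma outcome_nonempty n : exists Q, Q \in c n.
Proof.
have Qc := outcome_root oc ([ffun=> Ordinal (pM_gt0 M2 0 0)] : cube 0).
by have [Q Q' _] := outcome_desc M2 NM oc (leq0n n) Qc; exists Q.
Qed.

Lemma s3_le_dimA : (s3 R M N <= dimA E)%E.
Proof.
apply: lee_lt_real => s ss; apply: (@dimA_ge_boxes s 1) => // B.
have [k Bk /ereal_sup_gt[_ [[|n] // _ <-]]] := limn_esup_gt_freq ss (Num.truncn B).+1.
rewrite lte_fin addSn => h.
have pM1 : 1 < (pM n.+1 (n + k).+1)%:R :> R.
  rewrite ltr1n; apply: leq_trans (pM_ge_exp M2 _ _).
  by rewrite -addnS addKn; apply: leq_ltn_trans (ltn_expl k.+1 (ltnSn 1)).
have rE : r n / (r (n + k)%N / (M (n + k).+1)%:R) = (pM n.+1 (n + k).+1)%:R.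
  have nk : (n <= (n + k).+1)%N by rewrite leqW// leq_addr.
  rewrite (scale_mul R M2 nk) (scale_mul R M2 (leqnSn (n + k))) /pprod big_nat1.
  have a0 : r (n + k).+1 != 0 by rewrite gt_eqF ?scale_gt0.
  have m0 : (M (n + k).+1)%:R != 0 :> R by rewrite gt_eqF// ltr0n (leq_trans _ (M2 _)).
  by field; rewrite a0 m0.
have [Q Qc] := outcome_nonempty n.
exists n, (n + k)%N, Q, (M (n + k).+1); split=> //.
- by rewrite leq_addr.
- by rewrite leqnn andbT (leq_trans _ (M2 _)).
- rewrite rE; apply: (@le_trans _ _ (Num.truncn B).+1%:R).
    exact/ltW/truncnS_gt.
  rewrite ler_nat (leq_trans Bk)// (leq_trans _ (pM_ge_exp M2 _ _))//.
  by rewrite -addnS addKn (leq_trans _ (ltnW (ltn_expl _ _))).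
rewrite rE mul1r card_imset; last exact: box_full_inj.
rewrite (card_outcome_below M2 oc)//; last by rewrite leqW// leq_addr.
have s01 : 0 < scale R M n.+1 (n + k).+1 < 1.
  by rewrite invr_gt0 (lt_trans ltr01 pM1)/= invf_lt1// (lt_trans ltr01 pM1).
move: h; rewrite lt_ln_ratio//; last by rewrite ltr0n (pN_gt0 NM).
move=> /ltW; apply: le_trans.
rewrite /scale -[in leRHS](@powR_inv1 _ (pM n.+1 (n + k).+1)%:R)//.
by rewrite -powRrM mulN1r opprK.
Qed.

Lemma covering_number_ball n m (x : 'rV[R]_d) (rho delta : R) : (n <= m)%N ->
  E x -> 0 < rho -> rho <= D%:R * r n -> r m <= delta ->
  (covering_number (E `&` ecball x rho) delta <=
     (((2 * D + 3) * D) ^ d * pN n.+1 m)%:R%:E)%E.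
Proof.
move=> nm Ex rho0 rhor rd.
have rn0 := scale_gt0 R M2 n.
have [Qx Qxc xQx] := limit_set_stage M2 oc n Ex.
pose T := [set P in c n | near (rho + r n) Qx P]%SET.
have Tc : T \subset c n by apply/fintype.subsetP => P; rewrite inE => /andP[].
have cT : (#|T| <= (2 * D + 3) ^ d)%N.
  rewrite -(ler_nat R); apply: (@le_trans _ _ #|[set P | near (rho + r n) Qx P]%SET|%:R).
    by rewrite ler_nat; apply: subset_leq_card; apply/fintype.subsetP => P;
      rewrite !inE => /andP[].
  apply: le_trans (card_near M2 _ _) _; first by rewrite addr_ge0// ltW.
  have le1 : 2 * (rho + r n) / r n + 1 <= (2 * D + 3)%N%:R.
    rewrite natrD natrM -lerBrDr ler_pdivrMr//; lra.
  rewrite natrX lerXn2r ?nnegrE// addr_ge0// divr_ge0 ?mulr_ge0 ?addr_ge0 ?(ltW rn0)// ltW//.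
apply: le_trans (@covering_number_cubes _ _ _ M2 m
  [set Q in c m | [exists P in T, below P Q]]%SET _ _ D _ _ _) _ => //.
- move=> y [Ey xy]; have [Qy Qyc yQy] := limit_set_stage M2 oc m Ey.
  exists Qy => //; rewrite inE Qyc; have [P Pc PQy] := outcome_anc M2 oc nm Qyc.
  apply/exists_inP; exists P => //; rewrite inE Pc.
  apply: (near_points M2 xQx (cube_set_below M2 nm PQy yQy)) => l.
  exact: le_trans (ler_eucl_dist x y l) xy.
- by apply: ler_pM => //; rewrite ltW// scale_gt0.
rewrite lee_fin ler_nat expnMn mulnAC leq_mul//.
by apply: leq_trans (card_descendants M2 oc nm Tc) _; rewrite leq_mul2r cT orbT.
Qed.

(** Between the two radii lie the complete levels [n + 2] to [m], counted by [s3]; the two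
    incomplete end levels cost a factor [b] each. With at most [k0 + 1] complete levels,
    [b ^ (k0 + 3)] bounds the count outright. *)
Lemma dimA_le_s3 (b : nat) : (forall k, (1 <= k)%N -> (N k <= b)%N) ->
  (dimA E <= s3 R M N)%E.
Proof.
move=> Nb; apply: lee_gt_real => s s3s.
have [k0 k0P] := limn_esup_lt_near s3s.
have b0 : (0 < b)%N by have /andP[h _] := NM (leqnn 1); apply: leq_trans h (Nb _ _).
have sP n k : (k0 <= k)%N -> (pN n.+1 (n.+1 + k))%:R < (pM n.+1 (n.+1 + k))%:R `^ s.
  move=> /k0P lts; have pM1 : 1 < (pM n.+1 (n.+1 + k))%:R :> R.
    rewrite ltr1n; apply: leq_trans (pM_ge_exp M2 _ _).
    by rewrite addSn -addnS addKn; apply: leq_ltn_trans (ltn_expl k.+1 (ltnSn 1)).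
  have s01 : 0 < scale R M n.+1 (n.+1 + k) < 1.
    by rewrite invr_gt0 (lt_trans ltr01 pM1)/= invf_lt1// (lt_trans ltr01 pM1).
  have : ((ln (prodN R N n.+1 (n.+1 + k)) / - ln (scale R M n.+1 (n.+1 + k)))%:E < s%:E)%E.
    by apply: le_lt_trans lts; apply: ereal_sup_ubound; exists n.+1.
  rewrite lte_fin ln_ratio_lt//; last by rewrite ltr0n (pN_gt0 NM).
  move=> /lt_le_trans; apply.
  rewrite /scale -[in leLHS](@powR_inv1 _ (pM n.+1 (n.+1 + k))%:R)//.
  by rewrite -powRrM mulN1r opprK.
have s0 : 0 < s.
  rewrite ltNge; apply/negP => sle0; have := sP 0%N k0 (leqnn _); apply/negP; rewrite -leNgt.
  apply: (@le_trans _ _ 1); last by rewrite ler1n (pN_gt0 NM).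
  apply: (@le_trans _ _ ((pM 1 (1 + k0))%:R `^ 0)); last by rewrite powRr0.
  by apply: ler_powR => //; rewrite ler1n pM_gt0.
pose K := (((2 * D + 3) * D) ^ d * b ^ (k0 + 3))%N.
have Nbs n m : (n <= m)%N -> (pN n.+1 m <= b ^ (m - n))%N.
  move=> nm; rewrite /pprod -(subSS n m) -prod_nat_const_nat big_nat_cond [leqRHS]big_nat_cond.
  by apply: leq_prod => i /andP[/andP[ni _] _]; apply: Nb; apply: leq_ltn_trans ni.
apply: ereal_inf_lbound; exists s => //; split; first exact: ltW.
exists K%:R; split; first by rewrite ltr0n muln_gt0 !expn_gt0 b0 muln_gt0 addn_gt0 !orbT.
move=> tau rho tau0 taurho rhod.
have rho0 := lt_trans tau0 taurho.
have q1 : 1 <= rho / tau by rewrite ler_pdivlMr// mul1r ltW.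
have qs1 : 1 <= (rho / tau) `^ s.
  apply: (@le_trans _ _ ((rho / tau) `^ 0)); first by rewrite powRr0.
  by apply: ler_powR => //; exact: ltW.
apply: ge_ereal_sup => _ [x Ex <-].
(* The factor [D] serves the radii between 1 and [sqrt d], which exceed every scale; for them
   [n = 0]. *)
have [n [rn nrho]] : exists n, rho <= D%:R * r n /\ r n.+1 < rho.
  have [rho1|rho1] := leP rho (r 0%N).
    have [|n _ /andP[n1 n2]] := locate_scale rho1.
      by have [k kP] := scale_small M2 rho0; exists k; rewrite ?kP.
    exists n; split => //; apply: (le_trans n2).
    by rewrite ler_peMl ?(ltW (scale_gt0 R M2 n))// ler1n.
  exists 0%N; split; first by rewrite scale0 mulr1 (le_trans rhod).
  apply: lt_trans rho1; have /andP[_] := scale01 R M2 (leqnn 1).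
  by rewrite scale0.
have [rtau|rtau] := leP tau (r n); last first.
  apply: le_trans (covering_number_ball (leqnn n) Ex rho0 rn (ltW rtau)) _.
  rewrite pprod_nil muln1 lee_fin /K natrM -mulrA ler_peMr//.
  by rewrite (le_trans qs1)// ler_peMl ?powR_ge0// ler1n expn_gt0 b0.
have [|m nm /andP[m1 m2]] := locate_scale rtau.
  by have [k kP] := scale_small M2 tau0; exists (maxn n k); rewrite ?leq_maxl// kP// leq_maxr.
have nm1 : (n <= m.+1)%N by rewrite leqW.
apply: le_trans (covering_number_ball nm1 Ex rho0 rn (ltW m1)) _.
rewrite lee_fin /K !natrM -mulrA ler_wpM2l//.
have [mk|mk] := leqP (m.+1 - n) (k0 + 3).
  apply: (@le_trans _ _ (b ^ (k0 + 3))%:R); last by rewrite ler_peMr.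
  by rewrite ler_nat (leq_trans (Nbs _ _ nm1))// leq_pexp2l.
have n2m : (n.+2 <= m)%N by clear -mk; lia.
have k0k : (k0 <= m - n.+2)%N by clear -mk; lia.
have sPk := sP n.+1 (m - n.+2)%N k0k; rewrite subnKC// in sPk.
have pMq : (pM n.+2 m)%:R <= rho / tau.
  rewrite ler_pdivlMr//; apply: (le_trans _ (ltW nrho)).
  by rewrite (scale_mul R M2 (ltnW n2m)) ler_wpM2l.
have -> : pN n.+1 m.+1 = (N n.+1 * pN n.+2 m * N m.+1)%N.
  rewrite pprod_recr; last by rewrite ltnS ltnW// ltnW.
  by rewrite (@pprod_cat N n.+1 n.+1 m) ?(ltnW n2m)// [pN n.+1 n.+1]/pprod big_nat1.
apply: (@le_trans _ _ ((b ^ 2)%:R * (rho / tau) `^ s)).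
  rewrite mulnAC !natrM; apply: ler_pM => //.
    by rewrite -!natrM ler_nat; apply: leq_mul; apply: Nb.
  apply: le_trans (ltW sPk) _; apply: ge0_ler_powR; rewrite ?nnegrE ?(ltW s0)//.
  exact: le_trans pMq.
by rewrite ler_wpM2r ?powR_ge0// ler_nat leq_pexp2l// addn3.
Qed.



End Outcome.
End Deterministic.

(** * Probability of selecting a set of cubes *)

Lemma card_draws_super (T : finType) (A D : {set T}) (n : nat) :
  A \subset D -> (#|A| <= n)%N ->
  (#|[set S : {set T} | [&& S \subset D, #|S| == n & A \subset S]]%SET|
   <= 'C(#|D| - #|A|, n - #|A|))%N.
Proof.
move=> AD An; have -> : (#|D| - #|A| = #|D :\: A|%SET)%N by rewrite cardsD (finset.setIidPr AD).
rewrite -cards_draws.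
rewrite -(@card_in_imset _ _ (fun S => S :\: A)%SET).
  apply: subset_leq_card; apply/fintype.subsetP => _ /imsetP[S + ->].
  rewrite !inE => /and3P[SD /eqP Sn AS]; rewrite finset.setSD//=.
  by rewrite cardsD (finset.setIidPr AS) Sn.
move=> S S'; rewrite !inE => /and3P[_ _ AS] /and3P[_ _ AS'] e.
apply/setP => x; have /setP/(_ x) := e; rewrite !inE.
have [xA _|//] := boolP (x \in A).
by rewrite (fintype.subsetP AS _ xA) (fintype.subsetP AS' _ xA).
Qed.

(** The quotient of the binomials is the product of the [a] factors [(n - i) / (m - i)], each at
    most [n / m] because [n <= m]; the induction adds one factor, with denominators cleared. *)
Lemma binomial_ratio (a m n : nat) : (a <= n)%N -> (n <= m)%N ->
  ('C(m - a, n - a) * m ^ a <= n ^ a * 'C(m, n))%N.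
Proof.
elim: a => [|a IH] an nm; first by rewrite !subn0 !muln1 mul1n.
have := IH (ltnW an) nm.
have [i ni] : exists i, n = (a + i.+1)%N by exists (n - a.+1)%N; lia.
have [j mj] : exists j, m = (a + j.+1)%N by exists (m - a.+1)%N; lia.
have [-> -> -> ->] : [/\ (m - a = j.+1)%N, (n - a = i.+1)%N, (m - a.+1 = j)%N &
   (n - a.+1 = i)%N] by split; lia.
have h := mul_bin_diag j.+1 i; rewrite /= in h.
move=> IH'.
have ij : (i.+1 * m <= n * j.+1)%N by nia.
rewrite -(@leq_pmul2l j.+1)// !expnS.
rewrite (_ : j.+1 * ('C(j, i) * (m * m ^ a)) = (j.+1 * 'C(j, i)) * m * m ^ a)%N; last by ring.
rewrite h (_ : i.+1 * 'C(j.+1, i.+1) * m * m ^ a = (i.+1 * m) * ('C(j.+1, i.+1) * m ^ a))%N;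
  last by ring.
by apply: leq_trans (leq_mul ij IH') _; rewrite leq_eqVlt; apply/orP; left; apply/eqP; ring.
Qed.

(** Uniform draws without replacement contain a fixed set at most as often as independent retention
    with probability [n / #|D|] would. If [#|A| > n], no draw qualifies. *)
Lemma card_draws_ratio (R : realFieldType) (T : finType) (A D : {set T}) (n : nat) :
  A \subset D -> (n <= #|D|)%N -> (0 < #|D|)%N ->
  #|[set S : {set T} | [&& S \subset D, #|S| == n & A \subset S]]%SET|%:R
    <= (n%:R / #|D|%:R) ^+ #|A| *
       #|[set S : {set T} | (S \subset D) && (#|S| == n)]%SET|%:R :> R.
Proof.
move=> AD nD D0; rewrite cards_draws.
have [An|nA] := leqP #|A| n; last first.
  rewrite (_ : [set S : {set T} | _]%SET = finset.set0) ?cards0; last first.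
    apply/setP => S; rewrite !inE; apply/negP => /and3P[_ /eqP Sn /subset_leq_card].
    by rewrite Sn leqNgt nA.
  by rewrite mulr_ge0// exprn_ge0// divr_ge0.
have D0R : 0 < #|D|%:R :> R by rewrite ltr0n.
rewrite expr_div_n mulrAC ler_pdivlMr ?exprn_gt0// -!natrX -!natrM ler_nat.
apply: leq_trans (binomial_ratio An nD).
by rewrite leq_mul2r card_draws_super// orbT.
Qed.

Section FinitePartition.
Context d (T : measurableType d) (R : realType) (P : probability T R).

Definition pr (A : set T) : R := fine (P A).

Lemma prE A : measurable A -> P A = (pr A)%:E.
Proof. by move=> mA; rewrite fineK// fin_num_measure. Qed.

Lemma pr_ge0 A : 0 <= pr A.
Proof. by rewrite fine_ge0. Qed.

Lemma pr_partition (I : finType) (g : T -> I) (A : set T) :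
  (forall i, measurable (A `&` [set w | g w = i])) ->
  pr A = \sum_i pr (A `&` [set w | g w = i]).
Proof.
move=> mA; have -> : A = \bigcup_(i in [set: I]) (A `&` [set w | g w = i]).
  by apply/seteqP; split => [w Aw|w [i _ []]//]; exists (g w).
have IE : [set: I] = [set` enum I].
  by apply/seteqP; split => // i _ /=; rewrite mem_enum.
rewrite {1}/pr measure_fin_bigcup//; first last.
- by apply/trivIsetP => i j _ _ ij; apply/seteqP; split=> // w [[_ /= gi] [_ /= gj]];
    rewrite -gi gj eqxx in ij.
- by rewrite IE; apply: finite_seq.
rewrite IE.
rewrite -fsbig_seq ?enum_uniq// big_enum /=.
under eq_bigr do rewrite prE//.
rewrite sumEFin; apply: eq_bigr => i _; congr pr.
apply/seteqP; split => [w [Aw gw]|w [[j _ []]//]].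
by split => //; exists i => //; rewrite /= mem_enum.
Qed.

Lemma pr_le (A B : set T) : measurable A -> measurable B -> A `<=` B -> pr A <= pr B.
Proof.
by move=> mA mB AB; rewrite -lee_fin -!prE//; apply: le_measure; rewrite ?inE.
Qed.

Lemma pr_le1 A : measurable A -> pr A <= 1.
Proof. by move=> mA; rewrite -lee_fin -prE//; apply: probability_le1. Qed.

End FinitePartition.

Section Random.
Variables (R : realType) (d : nat) (M N : nat -> nat).
Hypothesis M2 : forall k, (1 <= k)%N -> (2 <= M k)%N.
Hypothesis NM : forall k, (1 <= k)%N -> (1 <= N k)%N && (N k <= M k ^ d)%N.
Context (disp : measure_display) (T : measurableType disp) (P : probability T R).
Variable C : T -> forall n, {set cube d M n}.
Hypothesis rc : random_cantor N P C.

Local Notation cube := (cube d M).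
Local Notation pM := (pprod M).
Local Notation pN := (pprod N).
Local Notation pr := (pr P).

Lemma measurable_level n (p : pred {set cube n}) : measurable [set w | p (C w n)].
Proof.
have -> : [set w | p (C w n)] =
    \bigcup_(X in [set` [seq X <- enum {set cube n} | p X]]) [set w | C w n = X].
  apply/seteqP; split => [w pw|w [X]]; last first.
    by rewrite /= mem_filter => /andP[pX _] ->.
  by exists (C w n) => //=; rewrite mem_filter mem_enum andbT.
apply: fin_bigcup_measurable; first exact: finite_seq.
by move=> X _; apply: (rc_measurable rc).
Qed.

Definition keep_prob n : R := (N n.+1)%:R / (M n.+1)%:R ^+ d.

Lemma keep_prob_ge0 n : 0 <= keep_prob n.
Proof. by rewrite divr_ge0// exprn_ge0. Qed.

(** Unchosen cubes get the empty selection, so that a whole construction step is one point of a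
    fixed finite function space. *)
Definition selection n w : {ffun cube n -> {set cube n.+1}} :=
  [ffun Q => if Q \in C w n then (C w n.+1 :&: children Q)%SET else finset.set0].

(** Conditional law of the coordinate [Q] of [selection n] given [C n = X]: uniform on the
    admissible sets, or a point mass at the empty set. *)
Definition selection_weight n (X : {set cube n}) (Q : cube n)
    (S : {set cube n.+1}) : R :=
  if Q \in X then (S \in selections N Q)%:R / #|selections N Q|%:R
  else (S == finset.set0)%:R.

Lemma measurable_selection n X (B : {ffun cube n -> {set cube n.+1}}) :
  measurable ([set w | C w n = X] `&` [set w | selection n w = B]).
Proof.
pose F (X : {set cube n}) (Y : {set cube n.+1}) : {ffun cube n -> {set cube n.+1}} :=
  [ffun Q => if Q \in X then (Y :&: children Q)%SET else finset.set0].
have -> : [set w | C w n = X] `&` [set w | selection n w = B] =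
    [set w | C w n = X] `&` [set w | F X (C w n.+1) == B].
  apply/seteqP; split => w /= [XE]; rewrite -XE; first by move=> <-; split=> //; apply/eqP.
  by move=> /eqP.
apply: measurableI; first exact: (rc_measurable rc).
exact: (measurable_level (fun Y => F X Y == B)).
Qed.

(** As level [n] determines all earlier ones, [C n = X] is the same event as a full history, the one
    conditioned on in [rc_law]. For an inadmissible [B] both sides vanish. *)
Lemma pr_selection n (X : {set cube n}) (B : {ffun cube n -> {set cube n.+1}}) :
  pr ([set w | C w n = X] `&` [set w | selection n w = B]) =
  pr [set w | C w n = X] * \prod_Q selection_weight X Q (B Q).
Proof.
have [[w0 Xw0]|/forallNP noX] := pselect (exists w, C w n = X); last first.
  have -> : [set w | C w n = X] = set0 by apply/seteqP; split => // w /noX.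
  by rewrite set0I /pr measure0 /= mul0r.
have [good|] := boolP [forall Q, if Q \in X then B Q \in selections N Q else B Q ==
  finset.set0].
  have hist : [set w | C w n = X] = [set w | forall k, (k <= n)%N -> C w k = C w0 k].
    apply/seteqP; split => [w /= Xw k kn|w /= h]; last by rewrite -Xw0 h.
    apply: (outcome_prev_eq M2 NM (rc_outcome rc w) (rc_outcome rc w0)) kn.
    by rewrite Xw.
  have XB Q : Q \in C w0 n -> B Q \in selections N Q.
    by move=> Qw0; have := forallP good Q; rewrite -Xw0 Qw0.
  have := rc_law rc XB; rewrite -hist.
  have -> : [set w | (forall k, (k <= n)%N -> C w k = C w0 k) /\
      (forall Q, Q \in C w0 n -> (C w n.+1 :&: children Q)%SET = B Q)] =
     [set w | C w n = X] `&` [set w | selection n w = B].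
    rewrite hist; apply/seteqP; split => w /= [h1 h2]; split=> //.
      apply/ffunP => Q; rewrite ffunE h1//; case: ifP => [/h2//|Qw0].
      by have := forallP good Q; rewrite -Xw0 Qw0 => /eqP.
    by move=> Q Qw0; have /ffunP/(_ Q) := h2; rewrite ffunE h1// Qw0.
  move=> h; rewrite /pr h fineM ?fin_num_measure//; last first.
    exact: (rc_measurable rc).
  congr (_ * _); rewrite /= [LHS]big_mkcond /=; apply: eq_bigr => Q _.
  have := forallP good Q; rewrite /selection_weight Xw0.
  by case: ifP => _; [move=> ->; rewrite mul1r|move=> ->].
rewrite negb_forall => /existsP[Q bad].
rewrite (bigD1 Q)//= [selection_weight _ _ _](_ : _ = 0); last first.
  by move: bad; rewrite /selection_weight; case: ifP => _ /negbTE ->; rewrite ?mul0r.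
rewrite mul0r mulr0 (_ : _ `&` _ = set0) /pr ?measure0//.
apply/seteqP; split => // w /= [Xw /ffunP/(_ Q)]; rewrite ffunE Xw => BQ.
move: bad; rewrite -BQ; case: ifP => QX; rewrite ?QX; last by rewrite eqxx.
by rewrite -Xw in QX; rewrite ((rc_outcome rc w).2 n).1.
Qed.

Lemma sum_selection_weight n (X : {set cube n}) (Q : cube n) (A : {set cube n.+1}) :
  A \subset children Q ->
  \sum_S selection_weight X Q S * (A \subset S)%:R <=
  (if (Q \in X) || (A == finset.set0) then keep_prob n ^+ #|A| else 0).
Proof.
move=> AQ; have [QX|/negbTE QX] := boolP (Q \in X); rewrite /selection_weight QX /=; last first.
  rewrite (bigD1 finset.set0)//= eqxx mul1r [X in _ + X]big1 ?addr0; last first.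
    by move=> S /negbTE ->; rewrite mul0r.
  by rewrite finset.subset0; case: eqP => [->|]; rewrite ?cards0 ?expr0.
under eq_bigr do rewrite mulrAC.
rewrite -mulr_suml.
have N1 := NM (ltn0Sn n); rewrite -(card_children M2 Q) in N1.
have cS : 0 < #|selections N Q|%:R :> R.
  by rewrite ltr0n /selections cards_draws bin_gt0; case/andP: N1.
rewrite ler_pdivrMr//.
have /andP[N0 ND] := N1.
have := card_draws_ratio R AQ ND (leq_trans N0 ND).
rewrite [X in _%:R / X%:R](card_children M2) natrX; apply: le_trans.
rewrite le_eqVlt; apply/orP; left; apply/eqP.
rewrite -sum1_card natr_sum [RHS]big_mkcond /=; apply: eq_bigr => S _.
by rewrite !inE andbA; case: (_ && _); case: (_ \subset _); rewrite ?mulr0 ?mul0r ?mulr1.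
Qed.

(** Conditioned on [C n = X], the event splits over the parents, and by independence the sum over
    selections of a product becomes a product of sums, one for each parent [Q]. Each is at most
    [keep_prob n] to the number of cubes of [A] below [Q], and vanishes if [A] has a cube below an
    unchosen [Q]. *)
Lemma pr_subset_step n (A : {set cube n.+1}) :
  pr [set w | A \subset C w n.+1] <=
  keep_prob n ^+ #|A| * pr [set w | [set par M2 Q | Q in A]%SET \subset C w n].
Proof.
pose AQ (Q : cube n) := (A :&: children Q)%SET.
have sub w : (A \subset C w n.+1) = [forall Q, AQ Q \subset selection n w Q].
  apply/idP/forallP => [Aw Q|h].
    apply/fintype.subsetP => Q'; rewrite inE => /andP[Q'A Q'Q].
    have Q'w := fintype.subsetP Aw _ Q'A; rewrite ffunE.
    have := outcome_par M2 (rc_outcome rc w) Q'w; rewrite in_children in Q'Q.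
    by rewrite (eqP Q'Q) => ->; rewrite inE Q'w in_children.
  apply/fintype.subsetP => Q' Q'A; have /fintype.subsetP/(_ Q') := h (par M2 Q').
  rewrite inE Q'A in_children eqxx => /(_ isT); rewrite ffunE; case: ifP => _; rewrite inE//.
  by case/andP.
have mlev X : measurable [set w | C w n = X] by apply: (rc_measurable rc).
have mA := measurable_level (fun Y : {set cube n.+1} => A \subset Y).
have mpar := measurable_level (fun X : {set cube n} => [set par M2 Q | Q in A]%SET \subset X).
rewrite (@pr_partition _ _ _ P _ (fun w => C w n)); last first.
  by move=> X; apply: measurableI.
rewrite [X in _ * X](@pr_partition _ _ _ P _ (fun w => C w n)); last first.
  by move=> X; apply: measurableI.
rewrite mulr_sumr; apply: ler_sum => X _.
rewrite (_ : [set w | [set par M2 Q | Q in A]%SET \subset C w n] `&` [set w | C w n = X] =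
   if [set par M2 Q | Q in A]%SET \subset X then [set w | C w n = X] else set0); last first.
  apply/seteqP; split => w /=; first by move=> [h XE]; rewrite -XE h.
  by case: ifP => // h XE; rewrite XE.
rewrite (@pr_partition _ _ _ P _ (selection n)); last first.
  move=> B; rewrite -setIA; apply: measurableI => //; exact: measurable_selection.
have -> : \sum_B pr ([set w | A \subset C w n.+1] `&` [set w | C w n = X] `&`
     [set w | selection n w = B]) =
   pr [set w | C w n = X] *
     \sum_(B : {ffun cube n -> {set cube n.+1}})
        \prod_Q (selection_weight X Q (B Q) * (AQ Q \subset B Q)%:R).
  rewrite mulr_sumr; apply: eq_bigr => B _.
  have [h|] := boolP [forall Q, AQ Q \subset B Q].
    rewrite (_ : _ `&` _ = [set w | C w n = X] `&` [set w | selection n w = B]).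
      rewrite pr_selection; congr (_ * _); apply: eq_bigr => Q _.
      by rewrite (forallP h) mulr1.
    apply/seteqP; split => w /= [] => [[_ XE] BE//|XE BE]; split => //; split => //.
    by rewrite sub BE.
  move=> nh; rewrite (_ : _ `&` _ = set0).
    rewrite /pr measure0 /=; move: nh; rewrite negb_forall => /existsP[Q /negbTE nQ].
    by rewrite (bigD1 Q)//= nQ mulr0 mul0r mulr0.
  apply/seteqP; split => // w /= [[h _] BE]; move: nh; rewrite -BE => /negP; apply.
  by rewrite -sub.
rewrite -(bigA_distr_bigA (fun Q S => selection_weight X Q S * (AQ Q \subset S)%:R)) /=.
have pr0 := pr_ge0 P [set w | C w n = X].
have w0 Q S : 0 <= selection_weight X Q S.
  by rewrite /selection_weight; case: ifP => _; rewrite ?divr_ge0.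
have prodle : \prod_Q \sum_S selection_weight X Q S * (AQ Q \subset S)%:R <=
    \prod_Q (if (Q \in X) || (AQ Q == finset.set0) then keep_prob n ^+ #|AQ Q| else 0).
  apply: ler_prod => Q _; apply/andP; split.
    by apply: sumr_ge0 => S _; rewrite mulr_ge0.
  by apply: sum_selection_weight; apply: finset.subsetIr.
apply: le_trans (ler_wpM2l pr0 prodle) _.
case: ifPn => [sX|nX].
  rewrite mulrC ler_wpM2r// le_eqVlt; apply/orP; left; apply/eqP.
  rewrite (eq_bigr (fun Q => keep_prob n ^+ #|AQ Q|)); last first.
    move=> Q _; case: ifP => // /negbT; rewrite negb_or => /andP[QX /set0Pn[Q']].
    rewrite inE in_children => /andP[Q'A /eqP parQ'].
    by move: QX; rewrite -parQ' (fintype.subsetP sX) ?imset_f.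
  rewrite -expr_sum; congr (_ ^+ _).
  rewrite -sum1_card (partition_big (@par d M M2 n) xpredT)//=.
  apply: eq_bigr => Q _; rewrite -sum1_card; apply: eq_bigl => Q'.
  by rewrite inE in_children.
have /subsetPn[_ /imsetP[Q' Q'A ->] parX] := nX.
rewrite (bigD1 (par M2 Q'))//= (negbTE parX) /=.
case: eqP => [/setP/(_ Q')|_];
  last by rewrite mul0r mulr0 mulr_ge0 ?exprn_ge0 ?keep_prob_ge0 ?pr_ge0.
by rewrite finset.in_setI Q'A in_children eqxx inE.
Qed.

End Random.

(** * First and second moments *)

Section Moments.
Variables (R : realType) (d : nat) (M N : nat -> nat).
Hypothesis M2 : forall k, (1 <= k)%N -> (2 <= M k)%N.
Hypothesis NM : forall k, (1 <= k)%N -> (1 <= N k)%N && (N k <= M k ^ d)%N.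
Context (disp : measure_display) (T : measurableType disp) (P : probability T R).
Variable C : T -> forall n, {set cube d M n}.
Hypothesis rc : random_cantor N P C.

Local Notation cube := (cube d M).
Local Notation pM := (pprod M).
Local Notation pN := (pprod N).
Local Notation r := (scale R M 1).
Local Notation pr := (pr P).

(** [P_n] over the number [r_n^(-d)] of cubes of level [n], that is, the product of the ratios
    [keep_prob]: the chance that a given cube is chosen. *)
Definition density n : R := (pN 1 n)%:R * r n ^+ d.

Lemma density0 : density 0 = 1.
Proof. by rewrite /density scale0 pprod_nil expr1n mulr1. Qed.

Lemma densityS n : density n.+1 = density n * keep_prob R d M N n.
Proof.
rewrite /density /keep_prob pprod_recr// natrM (scale_mul R M2 (leqnSn n)) /pprod big_nat1.
have M0 : (M n.+1)%:R ^+ d != 0 :> R.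
  by rewrite gt_eqF// exprn_gt0// ltr0n (leq_trans _ (M2 _)).
by rewrite exprMn; field.
Qed.

Lemma density_gt0 n : 0 < density n.
Proof. by rewrite mulr_gt0 ?exprn_gt0 ?scale_gt0// ltr0n (pN_gt0 NM). Qed.

Lemma pr_mem n (Q : cube n) : pr [set w | Q \in C w n] <= density n.
Proof.
elim: n Q => [|n IH] Q.
  rewrite density0; apply: pr_le1;
    exact: (measurable_level rc (fun X : {set cube 0} => Q \in X)).
have := pr_subset_step M2 NM rc [set Q]%SET.
rewrite cards1 expr1 imset_set1.
under eq_fun do rewrite finset.sub1set.
under [X in _ <= _ * pr X]eq_fun do rewrite finset.sub1set.
by move=> /le_trans; apply; rewrite densityS mulrC ler_wpM2r ?keep_prob_ge0 ?IH.
Qed.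

Definition common_anc k n (Q1 Q2 : cube n) : bool :=
  [exists A : cube k, below A Q1 && below A Q2].

(* Two cubes with last common ancestor of level [k] are both chosen with
   probability at most [density n ^ 2 / density k]. *)
Lemma pr_pair n (Q1 Q2 : cube n) :
  pr [set w | (Q1 \in C w n) && (Q2 \in C w n)] <=
  density n ^+ 2 * \sum_(k < n.+1) (common_anc k Q1 Q2)%:R / density k.
Proof.
(* Summing over all common ancestors instead of keeping the last one makes the induction linear:
   distinct cubes have the common ancestors of their parents, and equal cubes are settled by the top
   term of the sum. *)
elim: n Q1 Q2 => [|n IH] Q1 Q2.
  rewrite density0 expr1n mul1r big_ord1 density0 divr1.
  rewrite (_ : common_anc 0 Q1 Q2); last by apply/existsP; exists Q1; rewrite !below0.
  by apply: pr_le1; apply: (measurable_level rc (fun X : {set cube 0} => (Q1 \in X) && (Q2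
    \in X))).
have dn0 k : 0 < density k := density_gt0 k.
have [->|Q12] := eqVneq Q1 Q2.
  under eq_fun do rewrite andbb.
  apply: le_trans (pr_mem Q2) _; rewrite big_ord_recr /=.
  rewrite (_ : common_anc n.+1 Q2 Q2); last by apply/existsP; exists Q2;
    rewrite below_refl eqxx.
  rewrite mulrDr expr2 mul1r mulfK ?gt_eqF// lerDr.
  apply: mulr_ge0; first exact: mulr_ge0 (ltW (dn0 _)) (ltW (dn0 _)).
  by apply: sumr_ge0 => k _; rewrite divr_ge0// ltW.
have := pr_subset_step M2 NM rc [set Q1; Q2]%SET.
rewrite cards2 Q12 imsetU1 imset_set1.
under eq_fun do rewrite finset.subUset !finset.sub1set.
under [X in _ <= _ * pr X]eq_fun do rewrite finset.subUset !finset.sub1set.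
move=> /le_trans; apply.
apply: le_trans (ler_wpM2l _ (IH _ _)) _; first by rewrite exprn_ge0// keep_prob_ge0.
rewrite mulrA (_ : _ * density n ^+ 2 = density n.+1 ^+ 2); last first.
  by rewrite densityS [RHS]exprMn mulrC.
rewrite ler_wpM2l ?sqr_ge0//.
rewrite [leRHS]big_ord_recr /= -[leLHS]addr0; apply: lerD; last by rewrite divr_ge0// ltW.
rewrite le_eqVlt; apply/orP; left; apply/eqP; apply: eq_bigr => k _.
rewrite (_ : common_anc k (par M2 Q1) (par M2 Q2) = common_anc k Q1 Q2)//.
by apply: eq_existsb => A; rewrite !(below_par M2)// -ltnS.
Qed.

(** A finite sum over the values of [C n] stands for the integral, so that exchanging finite sums
    replaces integration theory. *)
Definition expect n (f : {set cube n} -> R) : R :=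
  \sum_X pr [set w | C w n = X] * f X.

Lemma pr_level n (p : pred {set cube n}) :
  pr [set w | p (C w n)] = \sum_X pr [set w | C w n = X] * (p X)%:R.
Proof.
rewrite (@pr_partition _ _ _ P _ (fun w => C w n)); last first.
  by move=> X; apply: measurableI; [apply: (measurable_level rc)|apply: (rc_measurable rc)].
apply: eq_bigr => X _; have [pX|pX] := boolP (p X).
  by rewrite mulr1; congr pr; apply/seteqP; split => w /= [] // XE; rewrite XE.
rewrite mulr0 (_ : _ `&` _ = set0) /pr ?measure0//.
by apply/seteqP; split => // w /= [+ XE]; rewrite XE (negbTE pX).
Qed.

Lemma markov_level n (f : {set cube n} -> R) (K : R) : 0 < K ->
  (forall X, 0 <= f X) -> pr [set w | K < f (C w n)] <= expect f / K.
Proof.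
move=> K0 f0; rewrite (pr_level (fun X => K < f X)) /expect mulr_suml.
apply: ler_sum => X _; rewrite -mulrA ler_wpM2l ?pr_ge0//.
by case: ltP => [/ltW KX|_]; [rewrite ler_pdivlMr// mul1r|rewrite divr_ge0// ltW].
Qed.

Lemma expect_pairs n (w : cube n -> cube n -> R) :
  expect (fun X : {set cube n} => \sum_(Q1 in X) \sum_(Q2 in X) w Q1 Q2) =
  \sum_Q1 \sum_Q2 w Q1 Q2 * pr [set x | (Q1 \in C x n) && (Q2 \in C x n)].
Proof.
rewrite /expect.
transitivity (\sum_(X : {set cube n}) \sum_Q1 \sum_Q2
    w Q1 Q2 * (pr [set x | C x n = X] * ((Q1 \in X) && (Q2 \in X))%:R)).
  apply: eq_bigr => X _; rewrite mulr_sumr big_mkcond; apply: eq_bigr => Q1 _.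
  case: ifP => Q1X /=; last by rewrite [RHS]big1// => Q2 _; rewrite !mulr0.
  rewrite mulr_sumr big_mkcond; apply: eq_bigr => Q2 _.
  by case: ifP => Q2X; rewrite ?mulr1 ?mulr0// mulrC.
rewrite exchange_big; apply: eq_bigr => Q1 _; rewrite exchange_big; apply: eq_bigr => Q2 _.
by rewrite (pr_level (fun X => (Q1 \in X) && (Q2 \in X))) mulr_sumr.
Qed.

(** A Fatou argument: the limit inferior of the [f j] is almost surely finite. For each threshold,
    the event that all late [f j] exceed it is an increasing union of events controlled uniformly by
    Markov's inequality; the intersection over the thresholds is null. *)
Lemma ae_frequently_bounded (g : nat -> nat) (f : forall j, {set cube (g j)} -> R)
    (B : R) : (forall j X, 0 <= f j X) -> (forall j, expect (f j) <= B) ->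
  {ae P, forall w, exists2 K : R, 0 < K &
    forall j0, exists2 j, (j0 <= j)%N & f j (C w (g j)) <= K}.
Proof.
move=> f0 fB.
pose F (K j0 : nat) : set T := \bigcap_(j in [set j | (j0 <= j)%N])
   [set w | K.+1%:R < f j (C w (g j))].
have mF K j0 : measurable (F K j0).
  apply: bigcap_measurable => [|j _]; first by exists j0 => /=.
  exact: (measurable_level rc (fun X => K.+1%:R < f j X)).
pose G K := \bigcup_j0 F K j0.
have mG K : measurable (G K) by apply: bigcupT_measurable.
have GB K : (P (G K) <= (B / K.+1%:R)%:E)%E.
  have := @nondecreasing_cvg_mu _ _ _ P (F K) (mF K) (mG K).
  have nd : {homo F K : n m / (n <= m)%N >-> (n <= m)%O}.
    move=> n m nm; rewrite subsetEset => w Fw j /= mj.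
    by apply: Fw => /=; apply: leq_trans mj.
  move=> /(_ nd) h; rewrite -(cvg_lim _ h)//.
  apply: lime_le; first by apply/cvg_ex; exists (P (G K)).
  apply: nearW => j0 /=; rewrite prE// lee_fin.
  apply: (@le_trans _ _ (pr [set w | K.+1%:R < f j0 (C w (g j0))])).
    apply: pr_le => //; first exact: (measurable_level rc (fun X => K.+1%:R < f j0 X)).
    by move=> w Fw; apply: Fw => /=.
  apply: le_trans (markov_level _ (f0 j0)) _; first by rewrite ltr0n.
  by rewrite ler_pM2r ?invr_gt0 ?ltr0n.
exists (\bigcap_K G K); split; first by apply: bigcapT_measurable.
  apply/eqP; rewrite eq_le measure_ge0 andbT; apply: lee_small_fin => e e0.
  pose K := Num.truncn (B / e).
  apply: (@le_trans _ _ (P (G K))).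
    apply: le_measure; rewrite ?inE//; first by apply: bigcapT_measurable.
    by move=> w Gw; apply: Gw.
  apply: le_trans (GB K) _; rewrite lee_fin ler_pdivrMr ?ltr0n// mulrC -ler_pdivrMr//.
  exact/ltW/truncnS_gt.
move=> w; apply: contra_notP => nG.
have /existsNP[K GK] : ~ (forall K, G K w) by move=> h; apply: nG => K _; apply: h.
exists K.+1%:R => // j0; apply: contrapT => h; apply: GK; exists j0 => // j /= j0j.
by rewrite ltNge; apply/negP => le; apply: h; exists j.
Qed.

End Moments.

(** * Almost sure bounds *)

Section AlmostEverywhere.
Context (disp : measure_display) (T : measurableType disp) (R : realType)
  (P : probability T R).

Lemma ae_forall_countable (I : countType) (H : I -> T -> Prop) :
  (forall i, {ae P, forall w, H i w}) -> {ae P, forall w, forall i, H i w}.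
Proof.
move=> aeH.
pose H' n w := if unpickle n is Some i then H i w else True.
have : {ae P, forall w, forall n, H' n w}.
  apply: ae_foralln => n; rewrite /H'; case: (unpickle n) => [i|]; first exact: aeH.
  exact: aeW.
by apply: filterS => w Hw i; have := Hw (pickle i); rewrite /H' pickleK.
Qed.

(** The exceptional null set depends on [s]; rational exponents suffice, and there are countably
    many of them. *)
Lemma ae_lee_real (x : \bar R) (f : T -> \bar R) :
  (forall s : R, (s%:E < x)%E -> {ae P, forall w, (s%:E <= f w)%E}) ->
  {ae P, forall w, (x <= f w)%E}.
Proof.
move=> aef.
have : {ae P, forall w, forall q : rat, ((ratr q : R)%:E < x)%E -> ((ratr q)%:E <= f w)%E}.
  apply: ae_forall_countable => q.
  have [qx|nqx] := boolP ((ratr q : R)%:E < x)%E; last first.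
    exact: aeW.
  by apply: filterS (aef _ qx) => w ? _.
apply: filterS => w fq; apply: lee_lt_real => s sx.
have [s' ss' s'x] : exists2 s', s < s' & (s'%:E <= x)%E.
  case: x sx {aef fq} => [t| |] // st; first by exists t; rewrite // -lte_fin.
  by exists (s + 1); [rewrite ltrDl|exact: leey].
have [q /itvP qs] := rat_in_itvoo ss'.
apply: (@le_trans _ _ (ratr q)%:E); first by rewrite lee_fin ltW ?qs.
by apply: fq; apply: lt_le_trans s'x; rewrite lte_fin qs.
Qed.

End AlmostEverywhere.

(** * Occupation of mesh boxes by the random selection *)

Section BoxCounts.
Variables (R : realType) (d : nat) (M N : nat -> nat).
Hypothesis d0 : (1 <= d)%N.
Hypothesis M2 : forall k, (1 <= k)%N -> (2 <= M k)%N.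
Hypothesis NM : forall k, (1 <= k)%N -> (1 <= N k)%N && (N k <= M k ^ d)%N.

Local Notation cube := (cube d M).
Local Notation pM := (pprod M).
Local Notation pN := (pprod N).
Local Notation r := (scale R M 1).

(* About [N_(n+1) ^ (1/d)] boxes per side, that is about as many boxes as
   chosen subcubes in each cube. *)
Definition mesh n : nat := Num.truncn ((N n.+1)%:R `^ d%:R^-1 : R).

Lemma mesh_itv n : (mesh n)%:R <= (N n.+1)%:R `^ d%:R^-1 :> R /\
  (N n.+1)%:R `^ d%:R^-1 < (mesh n).+1%:R :> R.
Proof. by split; [rewrite truncn_le powR_ge0|exact: truncnS_gt]. Qed.

Lemma mesh_bounds n : (1 <= mesh n <= M n.+1)%N.
Proof.
have [h1 _] := mesh_itv n; apply/andP; split.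
  rewrite truncn_gt0; apply: (@le_trans _ _ ((N n.+1)%:R `^ 0)); first by rewrite powRr0.
  by apply: ler_powR; rewrite ?invr_ge0// ler1n; have /andP[] := NM (ltn0Sn n).
by rewrite -(ler_nat R) (le_trans h1)// N_root_le.
Qed.

Lemma root_exp n : ((N n.+1)%:R `^ d%:R^-1) ^+ d = (N n.+1)%:R :> R.
Proof. by rewrite -powR_mulrn ?powR_ge0// -powRrM mulVf ?powRr1// pnatr_eq0 -lt0n. Qed.

Lemma mesh_exp_le n : (mesh n ^ d <= N n.+1)%N.
Proof.
rewrite -(ler_nat R) natrX -root_exp lerXn2r ?nnegrE ?powR_ge0//.
by have [] := mesh_itv n.
Qed.

Lemma mesh_exp_ge n : (N n.+1 <= (2 * mesh n) ^ d)%N.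
Proof.
rewrite -(ler_nat R) natrX -root_exp lerXn2r ?nnegrE ?powR_ge0//.
have [_ /ltW h] := mesh_itv n; apply: le_trans h _.
by have /andP[m1 _] := mesh_bounds n; rewrite ler_nat mul2n -addnn -add1n leq_add2r.
Qed.

Context (disp : measure_display) (T : measurableType disp) (P : probability T R).
Variable C : T -> forall n, {set cube n}.
Hypothesis rc : random_cantor N P C.
Local Notation pr := (pr P).

Lemma pr_siblings n (Q1 Q2 : cube n.+1) : Q1 != Q2 -> par M2 Q1 = par M2 Q2 ->
  pr [set w | (Q1 \in C w n.+1) && (Q2 \in C w n.+1)] <=
  keep_prob R d M N n ^+ 2 * density R d M N n.
Proof.
move=> Q12 par12; have := pr_subset_step M2 NM rc [set Q1; Q2]%SET.
rewrite cards2 Q12 imsetU1 imset_set1 par12 finset.setUid.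
under eq_fun do rewrite finset.subUset !finset.sub1set.
under [X in _ <= _ * pr X]eq_fun do rewrite finset.sub1set.
move=> /le_trans; apply; rewrite ler_wpM2l ?exprn_ge0 ?keep_prob_ge0//.
exact: pr_mem.
Qed.

Definition box_collisions k n (Q0 : cube k) (X : {set cube n.+1}) : R :=
  \sum_(Q1 in X) \sum_(Q2 in X)
    [&& below Q0 Q1, below Q0 Q2 & box (mesh n) Q1 == box (mesh n) Q2]%:R.

(** For [L = mesh n], the at most [M / L + 1] indices per side and [N <= (2 L)^d] combine to
    [(2 M + 2 L)^d], at most [(4 M)^d]. This bounds the mean number of chosen subcubes in one box of
    a chosen parent. *)
Lemma card_same_mesh_box n (Q : cube n.+1) :
  #|[set Q' | box (mesh n) Q == box (mesh n) Q']%SET|%:R * keep_prob R d M N n <= 4 ^+ d.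
Proof.
have /andP[m1 mM] := mesh_bounds n.
have M0 : (0 : R) < (M n.+1)%:R by rewrite ltr0n (leq_trans _ (M2 _)).
have m0 : (0 : R) < (mesh n)%:R by rewrite ltr0n.
rewrite /keep_prob mulrA ler_pdivrMr ?exprn_gt0// -!natrX -!natrM ler_nat.
apply: leq_trans (leq_mul (card_same_box M2 Q (mesh_bounds n)) (mesh_exp_ge n)) _.
rewrite -!expnMn leq_exp2r//.
have := leq_divM (M n.+1) (mesh n); set q := (_ %/ _)%N => qM.
by rewrite mulnCA mulSn; clear -qM mM; lia.
Qed.

(** The diagonal gives the summand 1. Distinct cubes in one box are siblings, so [pr_siblings]
    applies and the box capacity gives [4 ^+ d]. The number of cubes below [Q0] times [density n.+1]
    is at most [P(k+1, n+1)] times [density k], and [density k] is at most 1. *)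
Lemma expect_box_collisions k n (Q0 : cube k) : (k <= n)%N ->
  expect P C (box_collisions Q0 : {set cube n.+1} -> R) <=
  (1 + 4 ^+ d) * (pN k.+1 n.+1)%:R.
Proof.
move=> kn; rewrite /box_collisions (expect_pairs rc).
have kn1 := leqW kn.
have dn0 := density_gt0 R M2 NM.
have q0 := keep_prob_ge0 R d M N n.
apply: (@le_trans _ _ (\sum_(Q1 : cube n.+1) (below Q0 Q1)%:R *
    (density R d M N n.+1 * (1 + 4 ^+ d)))).
  apply: ler_sum => Q1 _; have [bQ1|_] /= := boolP (below Q0 Q1); last first.
    by rewrite mul0r big1// => Q2 _; rewrite mul0r.
  rewrite mul1r (bigD1 Q1)//= bQ1 eqxx mul1r mulrDr mulr1; apply: lerD.
    by under eq_fun do rewrite andbb; apply: pr_mem.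
  apply: (@le_trans _ _ (\sum_(Q2 : cube n.+1) (box (mesh n) Q1 == box (mesh n) Q2)%:R *
     (keep_prob R d M N n ^+ 2 * density R d M N n))).
    rewrite big_mkcond; apply: ler_sum => Q2 _.
    have p0 : 0 <= keep_prob R d M N n ^+ 2 * density R d M N n.
      by rewrite mulr_ge0 ?exprn_ge0 ?(ltW (dn0 _)).
    case: ifPn => Q21; last by rewrite mulr_ge0.
    have [e|_] := eqVneq (box _ Q1) _; last by rewrite !andbF !mul0r.
    apply: ler_pM; rewrite ?pr_ge0//; first by rewrite andbT; case: (below _ _).
    rewrite eq_sym in Q21; apply: pr_siblings => //.
    exact: (box_par M2 (mesh_bounds n) e).
  rewrite -mulr_suml.
  have -> : \sum_(Q2 : cube n.+1) (box (mesh n) Q1 == box (mesh n) Q2)%:R =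
      #|[set Q' | box (mesh n) Q1 == box (mesh n) Q']%SET|%:R :> R.
    rewrite -sum1_card natr_sum [RHS]big_mkcond; apply: eq_bigr => Q2 _.
    by rewrite inE; case: (_ == _).
  have h := card_same_mesh_box Q1; rewrite (densityS R d N M2).
  rewrite (_ : _ * (_ * _) = (density R d M N n * keep_prob R d M N n) *
    (#|[set Q' | box (mesh n) Q1 == box (mesh n) Q']%SET|%:R * keep_prob R d M N n));
      last by ring.
  by rewrite ler_wpM2l// mulr_ge0// ltW.
rewrite -mulr_suml mulrA [leLHS]mulrC ler_wpM2l ?addr_ge0 ?exprn_ge0//.
have -> : \sum_(Q1 : cube n.+1) (below Q0 Q1)%:R = #|[set Q' : cube n.+1 | below Q0
  Q']%SET|%:R :> R.
  rewrite -sum1_card natr_sum [RHS]big_mkcond; apply: eq_bigr => Q2 _.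
  by rewrite inE; case: (below _ _).
apply: (@le_trans _ _ ((pM k.+1 n.+1 ^ d)%:R * density R d M N n.+1)).
  by rewrite ler_wpM2r ?(ltW (dn0 _))// ler_nat card_below_le.
rewrite /density mulrCA natrX -exprMn -(scale_mul R M2 kn1).
rewrite (@pprod_cat N 1 k n.+1)// natrM mulrAC ler_piMl// /scale exprVn.
rewrite ler_pdivrMr ?mul1r ?exprn_gt0 ?ltr0n ?(pM_gt0 M2)//.
by rewrite -natrX ler_nat (pN_le_pM NM).
Qed.

Lemma card_boxes_ge k n (Q0 : cube k) (c : forall n, {set cube n}) (K : R) :
  outcome N c -> (k <= n)%N -> Q0 \in c k -> 0 < K ->
  box_collisions Q0 (c n.+1) / (pN k.+1 n.+1)%:R <= K ->
  (pN k.+1 n.+1)%:R <= 2 * K *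
    #|[set box (mesh n) Q' | Q' in [set Q' in c n.+1 | below Q0 Q']]%SET|%:R.
Proof.
move=> oc kn Q0c K0; rewrite ler_pdivrMr ?ltr0n ?(pN_gt0 NM)// => coll.
have kn1 := leqW kn.
have cS := card_outcome_below M2 oc kn1 Q0c.
rewrite -cS; apply: card_image_collisions => //; rewrite cS.
apply: le_trans coll; rewrite le_eqVlt; apply/orP; left; apply/eqP.
rewrite /box_collisions big_mkcond [RHS]big_mkcond; apply: eq_bigr => Q1 _.
rewrite inE; have [Q1c|] //= := boolP (Q1 \in c n.+1).
have [Q01|_] /= := boolP (below Q0 Q1); last by rewrite big1.
rewrite big_mkcond [RHS]big_mkcond; apply: eq_bigr => Q2 _.
by rewrite inE; case: (Q2 \in _) => //=; case: (below _ Q2).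
Qed.

(** [nu] is fixed before the randomness, so it can follow indices that realise a limit superior.
    There are countably many cubes [Q0], chosen or not, so one null set serves for all; [K] may
    depend on the outcome and on [Q0]. *)
Lemma ae_boxes_often (nu : nat -> nat) : (forall j, (j <= nu j)%N) ->
  {ae P, forall w, forall k (Q0 : cube k), Q0 \in C w k -> exists2 K : R, 0 < K &
    forall j0, exists2 j, (j0 <= j)%N & (k <= nu j)%N /\
     (pN k.+1 (nu j).+1)%:R <= K *
       #|[set box (mesh (nu j)) Q' | Q' in [set Q' in C w (nu j).+1 | below Q0 Q']]%SET|%:R}.
Proof.
move=> nuj; apply: ae_foralln => k; apply: ae_forall_countable => Q0.
(* The value 0 is a placeholder where [nu j < k]; since [j <= nu j] this concerns finitely many [j],
   avoided below by asking for [j >= k]. *)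
pose f j (X : {set cube (nu j).+1}) : R :=
  if (k <= nu j)%N then box_collisions Q0 X / (pN k.+1 (nu j).+1)%:R else 0.
have V0 j : 0 < (pN k.+1 (nu j).+1)%:R :> R by rewrite ltr0n (pN_gt0 NM).
have coll0 j (X : {set cube (nu j).+1}) : 0 <= box_collisions Q0 X.
  by apply: sumr_ge0 => Q1 _; apply: sumr_ge0 => Q2 _.
have f0 j X : 0 <= f j X by rewrite /f; case: ifP => // _; rewrite divr_ge0.
have fB j : expect P C (f j) <= 1 + 4 ^+ d.
  rewrite /f; have [kn|kn] := boolP (k <= nu j)%N; last first.
    by rewrite /expect [leLHS]big1 ?addr_ge0 ?exprn_ge0// => X _; rewrite mulr0.
  rewrite (_ : expect _ _ _ = expect P C (box_collisions Q0 : {set cube (nu j).+1} -> R) /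
    (pN k.+1 (nu j).+1)%:R).
    by rewrite ler_pdivrMr// expect_box_collisions.
  by rewrite /expect mulr_suml; apply: eq_bigr => X _; rewrite mulrA.
have := ae_frequently_bounded rc f0 fB.
apply: filterS => w [K K0 KP] Q0c; exists (2 * K); first by rewrite mulr_gt0.
move=> j0; have [j jj fj] := KP (maxn j0 k).
move: jj; rewrite geq_max => /andP[j0j kj]; exists j => //.
have kn := leq_trans kj (nuj j); split=> //.
apply: (card_boxes_ge (rc_outcome rc w) kn Q0c K0).
by move: fj; rewrite /f kn.
Qed.

(** The levels [nu j] realise the limit superior above [s']. There [mesh] rounds [N^(1/d)] down, so
    the mesh size is at least the critical scale and its power [-s'] is at most [P_(n+1)]; below
    each [Q] the occupied boxes are, up to a constant, as numerous as the chosen cubes. *)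
Lemma ae_s2_le_dimP : {ae P, forall w, (s2 R d M N <= dimP (limit_set (C w) : set 'rV[R]_d))%E}.
Proof.
apply: ae_lee_real => s; have [s0 _|s0 ss2] := ltP s 0.
  by apply: aeW => w; apply: le_trans (dimP_ge0 _); rewrite lee_fin ltW.
have [s' ss' s's2] : exists2 s', s < s' & (s'%:E < s2 R d M N)%E.
  case: (s2 R d M N) ss2 => [t| |] // st.
    by rewrite lte_fin in st; exists ((s + t) / 2); rewrite ?lte_fin; lra.
  by exists (s + 1); [rewrite ltrDl|exact: ltry].
have s'0 : 0 <= s' := le_trans s0 (ltW ss').
have /choice[nu nuP] : forall j, exists n, (j <= n)%N /\
    (r n / (mesh n)%:R) `^ (- s') <= (pN 1 n.+1)%:R.
  move=> j; have [n] := limn_esup_gt_freq s's2 (maxn 1 j).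
  rewrite geq_max => /andP[n1 jn]; rewrite lte_fin => h; exists n; split=> //.
  have /andP[r0 r1] := scale01 R M2 n1; have N0 := N_gt0 R NM n.
  have N1 : (N n.+1)%:R `^ (- d%:R^-1) <= 1 :> R.
    rewrite powRN invf_le1 ?powR_gt0//.
    apply: (@le_trans _ _ ((N n.+1)%:R `^ 0)); first by rewrite powRr0.
    by apply: ler_powR; rewrite ?invr_ge0// ler1n -(ltr0n R).
  have b0 : 0 < r n * (N n.+1)%:R `^ (- d%:R^-1) by rewrite mulr_gt0 ?powR_gt0.
  move: h; have -> : - ln (r n) + d%:R^-1 * ln (N n.+1)%:R = - ln (r n * (N n.+1)%:R `^ (-
    d%:R^-1)).
    by rewrite lnM ?posrE ?powR_gt0// ln_powR mulNr opprB addrC.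
  rewrite lt_ln_ratio ?(prodN_gt0 R NM)//; last first.
    by rewrite b0 (le_lt_trans _ r1)// ler_piMr// ltW.
  move=> /ltW; apply: le_trans.
  have m0 : 0 < (mesh n)%:R :> R by rewrite ltr0n; have /andP[] := mesh_bounds n.
  have Nd0 : 0 < (N n.+1)%:R `^ d%:R^-1 :> R by rewrite powR_gt0.
  rewrite !powRN lef_pV2 ?posrE ?powR_gt0 ?divr_gt0//.
  apply: ge0_ler_powR; rewrite ?nnegrE ?divr_ge0 ?powR_ge0 ?(ltW r0)//.
  rewrite ler_wpM2l ?(ltW r0)// lef_pV2 ?posrE//.
  by have [] := mesh_itv n.
have := ae_boxes_often (fun j => (nuP j).1); apply: filterS => w wP.
apply: (dimP_ge_boxes d0 M2 NM (rc_outcome rc w) s0 ss') => k Q Qc.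
have [K K0 KP] := wP k Q Qc.
have Pk := prodN_gt0 R NM k.
exists (K * (pN 1 k)%:R)^-1; first by rewrite invr_gt0 mulr_gt0.
move=> n0; have [j n0j [kn h]] := KP n0.
exists (nu j), (mesh (nu j)); split.
- by rewrite (leq_trans n0j) ?(nuP j).1.
- exact: mesh_bounds.
rewrite ler_pdivrMl ?mulr_gt0//; apply: le_trans (nuP j).2 _.
have kn1 := leqW kn.
by rewrite (@pprod_cat N 1 k (nu j).+1)// natrM [K * _]mulrC -mulrA ler_pM2l.
Qed.

End BoxCounts.

Section AlmostSure.
Variables (R : realType) (d : nat) (M N : nat -> nat).
Hypothesis d0 : (1 <= d)%N.
Hypothesis M2 : forall k, (1 <= k)%N -> (2 <= M k)%N.
Hypothesis NM : forall k, (1 <= k)%N -> (1 <= N k)%N && (N k <= M k ^ d)%N.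

Local Notation cube := (cube d M).
Local Notation pM := (pprod M).
Local Notation pN := (pprod N).
Local Notation r := (scale R M 1).

Context (disp : measure_display) (T : measurableType disp) (P : probability T R).
Variable C : T -> forall n, {set cube n}.
Hypothesis rc : random_cantor N P C.
Local Notation pr := (pr P).
Local Notation mesh := (mesh R d N).

(** Averaging: each occupied box is occupied from some chosen cube of level [n], so if all [P_n] of
    these fell short of their share, the total would too. *)
Lemma exists_crowded_parent (c : forall n, {set cube n}) n (Q0 : cube 0) (K : R) :
  outcome N c -> 0 < K ->
  (pN 1 n.+1)%:R <= K *
    #|[set box (mesh n) Q' | Q' in [set Q' in c n.+1 | below Q0 Q']]%SET|%:R ->
  exists2 Q, Q \in c n & (N n.+1)%:R <= K *
    #|[set box (mesh n) Q' | Q' in [set Q' in c n.+1 | below Q Q']]%SET|%:R.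
Proof.
move=> oc K0 big; apply: contrapT => /forall2NP few.
pose S (Q : cube n) := [set box (mesh n) Q' | Q' in [set Q' in c n.+1 | below Q Q']]%SET.
have lt Q : Q \in c n -> K * #|S Q|%:R < (N n.+1)%:R.
  by move=> Qc; case: (few Q) => // /negP; rewrite -ltNge.
have [Qn Qnc] := outcome_nonempty M2 NM oc n.
have : K * \sum_(Q in c n) #|S Q|%:R < (pN 1 n.+1)%:R.
  have -> : (pN 1 n.+1)%:R = \sum_(Q in c n) (N n.+1)%:R :> R.
    by rewrite pprod_recr// natrM -(card_outcome M2 oc) mulr_natl sumr_const.
  rewrite mulr_sumr.
  apply: ltr_sum; first by apply/hasP; exists Qn => //; rewrite mem_index_enum.
  by move=> Q Qc; apply: lt.
apply/negP; rewrite -leNgt; apply: (le_trans big).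
rewrite ler_pM2l// -natr_sum ler_nat.
apply: (@leq_trans #|\bigcup_(Q in c n) S Q|%SET).
  apply: subset_leq_card; apply/fintype.subsetP => _ /imsetP[Q' + ->].
  rewrite inE => /andP[Q'c _]; apply/bigcupP; exists (par M2 Q').
    exact: (outcome_par M2 oc Q'c).
  by apply: imset_f; rewrite inE Q'c (below_par M2)// below_refl eqxx.
elim/big_rec2 : _ => [|Q k B _ IH]; first by rewrite cards0.
by rewrite (leq_trans (leq_card_setU _ _))// leq_add2l.
Qed.

(** A large [N_(n+1)] makes one construction step look [d]-dimensional: in a crowded parent a fixed
    proportion of [mesh^d] boxes is occupied, between scales whose ratio [mesh] is unbounded along
    [nu]. *)
Lemma ae_dim_le_dimA :
  ~ (exists b : nat, forall k, (1 <= k)%N -> (N k <= b)%N) ->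
  {ae P, forall w, (d%:R%:E <= dimA (limit_set (C w) : set 'rV[R]_d))%E}.
Proof.
move=> unb.
have /choice[nu nuP] : forall j, exists n, (j <= n)%N /\ (j <= N n.+1)%N.
  move=> j; apply: contrapT => /forallNP h; apply: unb.
  exists (maxn j (\max_(k < j.+1) N k)) => k k1; rewrite leq_max.
  have [kj|jk] := ltnP k j.+1.
    by rewrite (leq_bigmax (Ordinal kj)) orbT.
  case: k k1 jk => // k _ jk; apply/orP; left; rewrite leqNgt; apply/negP => /ltnW jN.
  by apply: (h k); split.
have := ae_boxes_often d0 M2 NM rc (fun j => (nuP j).1); apply: filterS => w wP.
have oc := rc_outcome rc w.
have [Q0 Q0c] := outcome_nonempty M2 NM oc 0.
have [K K0 KP] := wP _ Q0 Q0c.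
apply: (dimA_ge_boxes d0 M2 NM oc (kappa := K^-1)); first by rewrite invr_gt0.
move=> B; pose b := Num.truncn B.
(* As [j <= N_(n+1) <= (2 * mesh)^d] at [n = nu j], this index forces [mesh >= b.+1], hence a scale
   ratio above [B]. *)
have [j bj [_ h]] := KP ((2 * b.+1) ^ d)%N.
have [Q Qc hQ] := exists_crowded_parent oc K0 h.
have mb := mesh_bounds R d0 NM (nu j); have /andP[m1 _] := mb.
have X : r (nu j) / (r (nu j) / (mesh (nu j))%:R) = (mesh (nu j))%:R.
  by rewrite invf_div mulrCA divff ?mulr1// gt_eqF ?scale_gt0.
exists (nu j), (nu j), Q, (mesh (nu j)); split=> //; rewrite X.
  apply/ltW/(lt_le_trans (truncnS_gt B)); rewrite ler_nat.
  have : ((2 * b.+1) ^ d <= (2 * mesh (nu j)) ^ d)%N.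
    apply: leq_trans (mesh_exp_ge R d0 NM (nu j)).
    by apply: leq_trans bj (nuP j).2.
  by rewrite leq_exp2r// leq_pmul2l.
rewrite powR_mulrn// ler_pdivrMl//; apply: le_trans hQ.
by rewrite -natrX ler_nat mesh_exp_le.
Qed.

Definition near_pairs m (rho : R) (X : {set cube m}) : R :=
  \sum_(Q1 in X) \sum_(Q2 in X) (near (4 * rho) Q1 Q2)%:R.

(** Two volume bounds: the neighbourhood has side [2 * (4 * rho) + r m], at most [9 * rho]; and a
    common ancestor of level [k] confines everything to a cube of side [r k]. *)
Lemma card_near_common_anc k m (Q1 : cube m) (rho : R) : (k <= m)%N -> r m <= rho ->
  #|[set Q2 | near (4 * rho) Q1 Q2 && common_anc k Q1 Q2]%SET|%:R * r m ^+ d <=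
  Num.min ((9 * rho) ^+ d) (r k ^+ d).
Proof.
move=> km rm; have r0 := scale_gt0 R M2 m; have rho0 := lt_le_trans r0 rm.
rewrite le_min; apply/andP; split.
  apply: (@le_trans _ _ (#|[set Q2 | near (4 * rho) Q1 Q2]%SET|%:R * r m ^+ d)).
    rewrite ler_wpM2r ?exprn_ge0 ?(ltW r0)// ler_nat; apply: subset_leq_card.
    by apply/fintype.subsetP => Q2; rewrite !inE => /andP[].
  apply: le_trans (ler_wpM2r _ (card_near M2 _ _)) _.
  - by rewrite exprn_ge0// ltW.
  - by rewrite mulr_ge0// ltW.
  have u0 : 0 <= 2 * (4 * rho) / r m + 1.
    by rewrite addr_ge0// divr_ge0 ?(ltW r0)// !mulr_ge0// ltW.
  rewrite -exprMn lerXn2r ?nnegrE ?mulr_ge0 ?(ltW r0) ?(ltW rho0)//.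
  by rewrite mulrDl divfK ?gt_eqF// mul1r; lra.
rewrite (scale_mul R M2 km) exprMn ler_wpM2r ?exprn_ge0 ?(ltW r0)//.
rewrite -natrX ler_nat.
have [A AQ1|noA] := pickP (fun A : cube k => below A Q1); last first.
  rewrite (_ : [set Q2 | _]%SET = finset.set0) ?cards0//.
  by apply/setP => Q2; rewrite !inE; apply/negP => /andP[_ /existsP[A]]; rewrite noA.
apply: leq_trans (card_below_le M2 m A); apply: subset_leq_card.
apply/fintype.subsetP => Q2; rewrite !inE => /andP[_ /existsP[A' /andP[A'Q1 A'Q2]]].
by rewrite (below_inj AQ1 A'Q1).
Qed.

Lemma expect_near_pairs m (rho : R) : r m <= rho ->
  expect P C (near_pairs rho : {set cube m} -> R) <=
  (pN 1 m)%:R ^+ 2 * \sum_(k < m.+1)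
     Num.min ((9 * rho) ^+ d) (r k ^+ d) / density R d M N k.
Proof.
move=> rm; rewrite /near_pairs (expect_pairs rc).
have dn0 := density_gt0 R M2 NM; have r0 := scale_gt0 R M2 m.
pose cnt k (Q1 : cube m) : R := #|[set Q2 | near (4 * rho) Q1 Q2 && common_anc k Q1 Q2]%SET|%:R.
apply: (@le_trans _ _ (\sum_(Q1 : cube m) density R d M N m ^+ 2 *
    \sum_(k < m.+1) cnt k Q1 / density R d M N k)).
  apply: ler_sum => Q1 _.
  apply: (@le_trans _ _ (\sum_(Q2 : cube m) (near (4 * rho) Q1 Q2)%:R *
     (density R d M N m ^+ 2 * \sum_(k < m.+1) (common_anc k Q1 Q2)%:R / density R d M N k))).
    by apply: ler_sum => Q2 _; rewrite ler_wpM2l//; apply: pr_pair.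
  under eq_bigr do rewrite mulrCA.
  rewrite -mulr_sumr ler_wpM2l ?sqr_ge0// le_eqVlt; apply/orP; left; apply/eqP.
  under eq_bigr do rewrite mulr_sumr.
  rewrite exchange_big /=; apply: eq_bigr => k _.
  under eq_bigr do rewrite mulrA.
  rewrite -mulr_suml; congr (_ / _).
  rewrite /cnt -sum1_card natr_sum [RHS]big_mkcond; apply: eq_bigr => Q2 _.
  by rewrite inE; case: (near _ _ _) => //=; case: (common_anc _ _ _); rewrite ?mulr1 ?mulr0.
rewrite -mulr_sumr exchange_big /= {1}/density exprMn -mulrA ler_wpM2l ?sqr_ge0//.
rewrite mulr_sumr; apply: ler_sum => k _.
rewrite -mulr_suml mulrA ler_wpM2r ?invr_ge0 ?(ltW (dn0 _))//.
have km : (k <= m)%N by rewrite -ltnS.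
set mn := Num.min _ _.
apply: (@le_trans _ _ (r m ^+ d * \sum_(Q1 : cube m) mn)).
  rewrite expr2 -mulrA ler_wpM2l ?exprn_ge0 ?(ltW r0)// mulr_sumr.
  by apply: ler_sum => Q1 _; rewrite mulrC; apply: card_near_common_anc.
rewrite sumr_const card_cube -[mn *+ _]mulr_natl mulrA natrX -exprMn.
by rewrite /scale mulVf ?expr1n ?mul1r// pnatr_eq0 -lt0n (pM_gt0 M2).
Qed.

End AlmostSure.

(** * Energy method for the Hausdorff dimension *)

Section HausdorffAlmostSure.
Variables (R : realType) (d : nat) (M N : nat -> nat).
Hypothesis d0 : (1 <= d)%N.
Hypothesis M2 : forall k, (1 <= k)%N -> (2 <= M k)%N.
Hypothesis NM : forall k, (1 <= k)%N -> (1 <= N k)%N && (N k <= M k ^ d)%N.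

Local Notation cube := (cube d M).
Local Notation pM := (pprod M).
Local Notation pN := (pprod N).
Local Notation r := (scale R M 1).

Let half0 : 0 < 2^-1 :> R. Proof. by rewrite invr_gt0. Qed.
Let half1 : 2^-1 < 1 :> R. Proof. by rewrite invf_lt1// ltr1n. Qed.

Lemma half_powR_lt1 (e : R) : 0 < e -> 0 < (2^-1 : R) `^ e < 1.
Proof.
move=> e0; rewrite powR_gt0//=; have := @gt0_ltr_powR R e e0 2^-1 1.
by rewrite powR1; apply; rewrite ?nnegrE// ltW.
Qed.

(* Discretisation of the [s]-energy of the uniform measure on the cubes
   of [X]. *)
Definition energy (s : R) m (X : {set cube m}) : R :=
  \sum_(0 <= j < pM 1 m | r m <= 2^-1 ^+ j)
     (2^-1 ^+ j) `^ (- s) * (near_pairs (2^-1 ^+ j) X / (pN 1 m)%:R ^+ 2).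

Lemma near_pairs_ge0 m rho (X : {set cube m}) : 0 <= near_pairs (R := R) rho X.
Proof. by apply: sumr_ge0 => Q1 _; apply: sumr_ge0 => Q2 _. Qed.

Lemma energy_ge0 s m (X : {set cube m}) : 0 <= energy s X.
Proof.
by apply: sumr_ge0 => j _; rewrite mulr_ge0 ?powR_ge0// divr_ge0 ?near_pairs_ge0.
Qed.

(** The geometric mean of the two volumes is [(9 rho)^sa r_k^(d - sa)]; division by the density
    leaves [r_k^(-sa) / P_k], at most [kappa r_k^(sb - sa)], which decays geometrically as
    [r_k <= 2^-k]. *)
Lemma scale_sum_bound (sa sb kappa rho : R) m : 0 < sa -> sa < sb -> sb <= d%:R ->
  0 < rho -> (forall k, r k `^ (- sb) <= kappa * (pN 1 k)%:R) ->
  \sum_(k < m.+1) Num.min ((9 * rho) ^+ d) (r k ^+ d) / density R d M N k <=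
  kappa * (9 * rho) `^ sa / (1 - 2^-1 `^ (sb - sa)).
Proof.
move=> sa0 sab sbd rho0 kP.
have dR0 : 0 < d%:R :> R by rewrite ltr0n.
have sad : 0 <= sa / d%:R <= 1.
  by rewrite divr_ge0 ?(ltW sa0)//= ler_pdivrMr// mul1r (le_trans (ltW sab)).
have rho9 : 0 < 9 * rho by rewrite mulr_gt0.
have q01 := half_powR_lt1 (_ : 0 < sb - sa).
have {}q01 : 0 < 2^-1 `^ (sb - sa) < 1 by apply: q01; rewrite subr_gt0.
have kappa0 : 0 <= kappa.
  by have := kP 0%N; rewrite scale0 powR1 pprod_nil mulr1; apply: le_trans.
apply: (@le_trans _ _ (\sum_(0 <= k < m.+1) kappa * (9 * rho) `^ sa * (2^-1 `^ (sb - sa)) ^+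
  k)).
  rewrite big_mkord; apply: ler_sum => k _.
  have r0 := scale_gt0 R M2 k; have Pk := prodN_gt0 R NM k.
  rewrite /density ler_pdivrMr ?mulr_gt0 ?exprn_gt0//.
  apply: le_trans (min_le_interp _ _ sad) _; rewrite ?exprn_gt0//.
  have -> : ((9 * rho) ^+ d) `^ (sa / d%:R) = (9 * rho) `^ sa.
    by rewrite -powR_mulrn ?(ltW rho9)// -powRrM mulrCA divff ?gt_eqF// mulr1.
  rewrite (@powRD_gt0 _ (r k ^+ d) 1) ?exprn_gt0// powRr1 ?exprn_ge0 ?(ltW r0)//.
  have -> : (r k ^+ d) `^ (- (sa / d%:R)) = r k `^ (- sa).
    by rewrite -powR_mulrn ?(ltW r0)// -powRrM mulrN mulrCA divff ?gt_eqF// mulr1.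
  rewrite mulrA mulrAC mulrA ler_wpM2r ?exprn_ge0 ?(ltW r0)//.
  rewrite -[leRHS]mulrA [kappa * _]mulrC -mulrA ler_wpM2l ?powR_ge0//.
  rewrite (_ : r k `^ (- sa) = r k `^ (sb - sa) * r k `^ (- sb)); last first.
    by rewrite -powRD_gt0//; congr (_ `^ _); ring.
  apply: (@le_trans _ _ ((2^-1 `^ (sb - sa)) ^+ k * (kappa * (pN 1 k)%:R))).
    apply: ler_pM; rewrite ?powR_ge0// -powR_exprn ?(ltW half0)//.
    apply: ge0_ler_powR; rewrite ?nnegrE ?subr_ge0 ?(ltW sab) ?(ltW r0)//.
    exact: scale_le_exp.
  by rewrite le_eqVlt; apply/orP; left; apply/eqP; ring.
rewrite -mulr_sumr ler_wpM2l ?mulr_ge0 ?powR_ge0//.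
by apply: le_trans (sum_geometric_le 0 m.+1 q01) _; rewrite expr0 div1r.
Qed.

Context (disp : measure_display) (T : measurableType disp) (P : probability T R).
Variable C : T -> forall n, {set cube n}.
Hypothesis rc : random_cantor N P C.

(** The gap [sb - sa] sums the levels [k], the gap [sa - s] the dyadic radii [j]; hence the
    intermediate exponent. The bound is uniform in [m]. *)
Lemma expect_energy (s sa sb kappa : R) m : s < sa -> 0 < sa -> sa < sb -> sb <= d%:R ->
  (forall k, r k `^ (- sb) <= kappa * (pN 1 k)%:R) ->
  expect P C (@energy s m) <=
  kappa * 9 `^ sa / (1 - 2^-1 `^ (sb - sa)) / (1 - 2^-1 `^ (sa - s)).
Proof.
move=> ssa sa0 sab sbd kP.
have q01 : 0 < (2^-1 : R) `^ (sa - s) < 1 by apply: half_powR_lt1; rewrite subr_gt0.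
have q'01 : 0 < (2^-1 : R) `^ (sb - sa) < 1 by apply: half_powR_lt1; rewrite subr_gt0.
have kappa0 : 0 <= kappa.
  by have := kP 0%N; rewrite scale0 powR1 pprod_nil mulr1; apply: le_trans.
have Pm := prodN_gt0 R NM m.
set A := _ / (1 - 2^-1 `^ (sb - sa)).
have A0 : 0 <= A.
  by rewrite divr_ge0 ?mulr_ge0 ?powR_ge0// subr_ge0; case/andP: q'01 => _ /ltW.
have -> : expect P C (@energy s m) =
    \sum_(0 <= j < pM 1 m | r m <= 2^-1 ^+ j)
     (2^-1 ^+ j) `^ (- s) * (expect P C (near_pairs (2^-1 ^+ j) : {set cube m} -> R) / (pN 1
       m)%:R ^+ 2).
  rewrite /expect /energy; under eq_bigr do rewrite mulr_sumr.
  rewrite exchange_big /=; apply: eq_bigr => j _.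
  rewrite mulr_suml mulr_sumr; apply: eq_bigr => X _; ring.
apply: (@le_trans _ _ (\sum_(0 <= j < pM 1 m | r m <= 2^-1 ^+ j) A * (2^-1 `^ (sa - s)) ^+ j)).
  apply: ler_sum => j rj; have rho0 : 0 < 2^-1 ^+ j :> R by rewrite exprn_gt0.
  apply: (@le_trans _ _ ((2^-1 ^+ j) `^ (- s) * (A * (2^-1 ^+ j) `^ sa))).
    rewrite ler_wpM2l ?powR_ge0// ler_pdivrMr ?exprn_gt0//.
    apply: le_trans (expect_near_pairs M2 NM rc rj) _.
    rewrite [leRHS]mulrC ler_wpM2l ?exprn_ge0 ?(ltW Pm)//.
    apply: le_trans (scale_sum_bound m sa0 sab sbd rho0 kP) _.
    rewrite powRM ?(ltW rho0)// /A.
    by rewrite le_eqVlt; apply/orP; left; apply/eqP; ring.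
  rewrite mulrCA -powRD_gt0// [- s + sa]addrC powR_exprn// ltW.
rewrite -mulr_sumr; apply: ler_wpM2l => //.
apply: (@le_trans _ _ (\sum_(0 <= j < pM 1 m) (2^-1 `^ (sa - s)) ^+ j)).
  rewrite big_mkcond; apply: ler_sum => j _.
  by case: ifP => // _; rewrite exprn_ge0 ?powR_ge0.
by apply: le_trans (sum_geometric_le 0 _ q01) _; rewrite expr0 div1r.
Qed.

(* Cubes of low potential carry at least half of the mass. *)
Lemma energy_mass (s K : R) m (X : {set cube m}) : 0 < s -> 0 < K ->
  #|X| = pN 1 m -> energy s X <= K ->
  exists A : {set cube m}, [/\ A \subset X, (#|X| <= 2 * #|A|)%N &
    forall Q rho, Q \in A -> r m < rho -> rho <= 1 ->
      #|[set Q' in A | near (4 * rho) Q Q']%SET|%:R <=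
        2 * K * 2 `^ s * rho `^ s * #|X|%:R].
Proof.
move=> s0 K0 cX EK.
have Pm : 0 < (pN 1 m)%:R :> R := prodN_gt0 R NM m.
pose v j (Q : cube m) : R := \sum_(Q2 in X) (near (4 * 2^-1 ^+ j : R) Q Q2)%:R.
pose Phi (Q : cube m) : R := \sum_(0 <= j < pM 1 m | r m <= 2^-1 ^+ j)
  (2^-1 ^+ j) `^ (- s) * (v j Q / (pN 1 m)%:R).
have v0 j Q : 0 <= v j Q by apply: sumr_ge0.
have t0 j Q : 0 <= (2^-1 ^+ j) `^ (- s) * (v j Q / (pN 1 m)%:R).
  by rewrite mulr_ge0 ?powR_ge0// divr_ge0.
have Phi0 Q : 0 <= Phi Q by apply: sumr_ge0.
have sumPhi : \sum_(Q in X) Phi Q <= K * (pN 1 m)%:R.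
  rewrite -ler_pdivrMr//; apply: le_trans EK; rewrite le_eqVlt; apply/orP; left; apply/eqP.
  rewrite /Phi exchange_big /= mulr_suml; apply: eq_bigr => j _.
  rewrite -mulr_sumr -mulr_suml /near_pairs -/(v j _) -mulrA; congr (_ * _).
  by rewrite -[LHS]mulrA -invfM expr2.
(* Markov's inequality for the potential [Phi] under the uniform measure on [X], at twice the bound
   on its mean. *)
pose A := [set Q in X | Phi Q <= 2 * K]%SET.
exists A; split.
- by apply/fintype.subsetP => Q; rewrite inE => /andP[].
- have AX : A \subset X by apply/fintype.subsetP => Q; rewrite inE => /andP[].
  have cD : (#|X| = #|A| + #|X :\: A|%SET)%N by rewrite -(cardsID A X) (finset.setIidPr AX).
  have : 2 * K * #|X :\: A|%SET%:R <= K * (pN 1 m)%:R.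
    apply: le_trans sumPhi; rewrite (big_setID A)/= mulr_natr -sumr_const.
    apply: ler_wpDl; first by apply: sumr_ge0.
    by apply: ler_sum => Q; rewrite !inE => /andP[+ QX]; rewrite QX /= -ltNge => /ltW.
  rewrite [2 * K]mulrC -mulrA ler_pM2l// -natrM ler_nat -cX cD; lia.
move=> Q rho QA rm rho1.
have [QX PhiQ] : Q \in X /\ Phi Q <= 2 * K by move: QA; rewrite inE => /andP[].
have rho0 : 0 < rho := lt_trans (scale_gt0 R M2 m) rm.
(* Rounding [rho] up to a dyadic radius below [2 * rho] costs the factor [2^s] of the final
   bound. *)
have [||j _ /andP[j1 j2]] := @locate_scale R (fun j => 2^-1 ^+ j) 0 rho.
- by rewrite expr0.
- by have [k kP] := half_pow_small rho0; exists k; rewrite ?kP.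
have rj : r m <= 2^-1 ^+ j := le_trans (ltW rm) j2.
(* The cut-off in [energy] loses no radius: [r m <= 2^-j] gives [j < 2^j <= pM 1 m]. *)
have jM : (j < pM 1 m)%N.
  apply: leq_trans (ltn_expl j (ltnSn 1)) _; move: rj.
  rewrite /scale exprVn lef_pV2 ?posrE ?exprn_gt0 ?ltr0n ?(pM_gt0 M2)//.
  by rewrite -natrX ler_nat.
have h0 : 0 < 2^-1 ^+ j :> R by rewrite exprn_gt0.
have vj : (2^-1 ^+ j) `^ (- s) * (v j Q / (pN 1 m)%:R) <= 2 * K.
  apply: le_trans PhiQ; rewrite /Phi big_mkcond (bigD1_seq j) ?mem_index_iota ?iota_uniq//=.
  by rewrite rj lerDl; apply: sumr_ge0 => i _; case: ifP.
apply: (@le_trans _ _ (v j Q)).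
  rewrite /v -sum1_card natr_sum big_mkcond [leRHS]big_mkcond; apply: ler_sum => Q2 _.
  rewrite !inE; case: (Q2 \in X) => //=; case: (Phi Q2 <= _) => //=.
  have le4 : 4 * rho <= 4 * 2^-1 ^+ j by rewrite ler_wpM2l.
  by have [h|_] //= := boolP (near (4 * rho) Q Q2); rewrite (near_le le4 h).
have {}vj : v j Q <= 2 * K * (2^-1 ^+ j) `^ s * (pN 1 m)%:R.
  rewrite -ler_pdivrMr// -ler_pdivrMr ?powR_gt0//.
  by rewrite powRN in vj; rewrite mulrC.
apply: (le_trans vj); rewrite cX ler_wpM2r// -!mulrA !ler_wpM2l ?(ltW K0)//.
rewrite -powRM ?(ltW rho0)//; apply: ge0_ler_powR;
  rewrite ?nnegrE ?(ltW s0) ?(ltW h0) ?mulr_ge0 ?(ltW rho0)//.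
by move: j1; rewrite exprS ltr_pdivrMl// => /ltW.
Qed.

Lemma ae_s1_le_dimH : {ae P, forall w, (s1 R M N <= dimH (limit_set (C w) : set 'rV[R]_d))%E}.
Proof.
apply: ae_lee_real => s; have [s_le0 _|s0 ss1] := leP s 0.
  by apply: aeW => w; apply: le_trans (dimH_ge0 _); rewrite lee_fin.
have [sb ssb sbs1] : exists2 s', s < s' & (s'%:E < s1 R M N)%E.
  case: (s1 R M N) ss1 => [t| |] // st.
    by rewrite lte_fin in st; exists ((s + t) / 2); rewrite ?lte_fin; lra.
  by exists (s + 1); [rewrite ltrDl|exact: ltry].
pose sa := (s + sb) / 2.
have ssa : s < sa by rewrite /sa; lra.
have sab : sa < sb by rewrite /sa; lra.
have sa0 := lt_trans s0 ssa; have sb0 := lt_trans sa0 sab.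
have [n1 n1P] := limn_einf_gt_near sbs1; pose n0 := maxn 1 n1.
have PP n : (n0 <= n)%N -> r n `^ (- sb) < (pN 1 n)%:R.
  rewrite geq_max => /andP[n_1 /n1P]; rewrite lte_fin lt_ln_ratio//.
    exact: prodN_gt0 NM n.
  exact: scale01.
have sbd : sb <= d%:R.
  rewrite leNgt; apply/negP => dsb.
  have := PP n0 (leqnn _); apply/negP; rewrite -leNgt.
  have /andP[r0 r1] := scale01 R M2 (leq_maxl 1 n1 : (1 <= n0)%N).
  apply: (@le_trans _ _ (r n0 `^ (- d%:R))).
    rewrite powR_invn ?(ltW r0)// /scale exprVn invrK -natrX ler_nat.
    exact: (pN_le_pM NM).
  by apply: ger_powR; rewrite ?r0 ?(ltW r1)// lerN2 ltW.
(* Finitely many levels precede [n0]; for them [r k] is at least [r n0] and [P_k] at least 1, so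
   this constant makes the bound uniform in [k]. *)
pose kappa := r n0 `^ (- sb).
have kappa1 : 1 <= kappa.
  have r0 := scale_gt0 R M2 n0.
  apply: (@le_trans _ _ (r n0 `^ 0)); first by rewrite powRr0.
  by apply: ger_powR; rewrite ?r0 ?scale_le1// oppr_le0 ltW.
have kP k : r k `^ (- sb) <= kappa * (pN 1 k)%:R.
  have [n0k|/ltnW kn0] := leqP n0 k.
    by apply: le_trans (ltW (PP k n0k)) _; rewrite ler_peMl.
  apply: (@le_trans _ _ kappa);
    last by rewrite ler_peMr ?(le_trans ler01 kappa1)// ler1n (pN_gt0 NM).
  rewrite /kappa !powRN lef_pV2 ?posrE ?powR_gt0 ?scale_gt0//.
  apply: ge0_ler_powR; rewrite ?nnegrE ?(ltW sb0) ?(ltW (scale_gt0 _ _ _))//.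
  exact: scale_le.
have := ae_frequently_bounded rc (f := fun m => @energy s m) (g := id)
  (fun m X => energy_ge0 s X) (fun m => expect_energy m ssa sa0 sab sbd kP).
apply: filterS => w [K K0 KP]; have oc := rc_outcome rc w.
apply: (@dimH_ge _ _ _ _ M2 NM _ s (2 * K * 2 `^ s) 1 oc s0) => //.
  by rewrite !mulr_gt0// powR_gt0.
move=> m0; have [m mm fm] := KP m0.
have [A [AX cA AP]] := energy_mass s0 K0 (card_outcome M2 oc m) fm.
by exists m, A.
Qed.

End HausdorffAlmostSure.

(** * Assembly of the upper and lower bounds *)

Theorem theorem1p1 (R : realType) (d : nat) (M N : nat -> nat)
    (hd : (1 <= d)%N)
    (hM : forall k, (1 <= k)%N -> (2 <= M k)%N)
    (hN : forall k, (1 <= k)%N -> (1 <= N k)%N && (N k <= M k ^ d)%N) :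
  (forall E : set 'rV[R]_d, Omega M N E ->
     (tstar R d M N <= dimH E)%E /\ (dimH E <= lower_dimB E)%E /\
     (lower_dimB E <= s1 R M N)%E) /\
  (forall E : set 'rV[R]_d, Omega M N E ->
     (sstar R M N <= dimP E)%E /\ (dimP E <= upper_dimB E)%E /\
     (upper_dimB E <= s2 R d M N)%E) /\
  almost_surely M N (fun E : set 'rV[R]_d =>
     dimH E = s1 R M N /\ lower_dimB E = s1 R M N) /\
  almost_surely M N (fun E : set 'rV[R]_d =>
     dimP E = s2 R d M N /\ upper_dimB E = s2 R d M N) /\
  ((exists b : nat, forall k, (1 <= k)%N -> (N k <= b)%N) ->
     forall E : set 'rV[R]_d, Omega M N E -> dimA E = s3 R M N) /\
  (~ (exists b : nat, forall k, (1 <= k)%N -> (N k <= b)%N) ->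
     almost_surely M N (fun E : set 'rV[R]_d => dimA E = (d%:R)%:E)).
Proof.
have HB (c : forall n, {set cube d M n}) : outcome N c -> (dimH (limit_set c : set 'rV[R]_d)
  <= lower_dimB (limit_set c : set 'rV[R]_d))%E.
  by move=> oc; apply: dimH_le_lower_dimB; exact: (limit_set_nonempty R hM hN oc).
have PB (c : forall n, {set cube d M n}) : outcome N c -> (dimP (limit_set c : set 'rV[R]_d)
  <= upper_dimB (limit_set c : set 'rV[R]_d))%E.
  by move=> oc; apply: dimP_le_upper_dimB; exact: (limit_set_nonempty R hM hN oc).
split.
  move=> _ [c oc ->]; split; first exact: tstar_le_dimH.
  by split; [exact: HB|exact: (lower_dimB_le_s1 R hM hN oc)].
split.
  move=> _ [c oc ->]; split; first exact: (sstar_le_dimP R hd hM hN oc).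
  by split; [exact: PB|exact: (upper_dimB_le_s2 R hd hM hN oc)].
split.
  move=> disp T P C rc; apply: filterS (ae_s1_le_dimH hd hM hN rc) => w h.
  have oc := rc_outcome rc w; have B1 := lower_dimB_le_s1 R hM hN oc.
  by split; apply/eqP; rewrite eq_le ?B1 ?h ?(le_trans (HB _ oc) B1) ?(le_trans h (HB _ oc)).
split.
  move=> disp T P C rc; apply: filterS (ae_s2_le_dimP hd hM hN rc) => w h.
  have oc := rc_outcome rc w; have B2 := upper_dimB_le_s2 R hd hM hN oc.
  by split; apply/eqP; rewrite eq_le ?B2 ?h ?(le_trans (PB _ oc) B2) ?(le_trans h (PB _ oc)).
split.
  move=> [b Nb] _ [c oc ->]; apply/eqP; rewrite eq_le.
  by rewrite (dimA_le_s3 R hM hN oc Nb) (s3_le_dimA R hd hM hN oc).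
move=> unb disp T P C rc; apply: filterS (ae_dim_le_dimA hd hM hN rc unb) => w h.
by apply/eqP; rewrite eq_le h dimA_le_dim.
Qed.
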